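(* Let $n\ge 1$ and $A\in\Omega_n$. The function $B\mapsto l_{\Omega_n}(A,B)$ is continuous on $\Omega_n$ if and only if one of the following holds: either $A$ is a scalar matrix (i.e. $A=\lambda I_n$ for some $\lambda\in\mathbb{C}$), or $n=2$ and $A$ is a cyclic matrix with two equal eigenvalues.
   Context: For an $n\times n$ complex matrix $A$, let $r(A)=\max\{|\lambda|:\det(\lambda I_n-A)=0\}$ be its spectral radius, where $I_n$ is the unit matrix. The spectral unit ball is the domain $\Omega_n=\{A\in\mathbb{C}^{n\times n}: r(A)<1\}$, regarded as an open subset of $\mathbb{C}^{n^2}$. A matrix is called cyclic (or non-derogatory) if it admits a cyclic vector, i.e. there is $v\in\mathbb{C}^n$ such that $v,Av,\dots,A^{n-1}v$ span $\mathbb{C}^n$. Let $\mathbb{D}\subset\mathbb{C}$ be the open unit disc and, for a domain $D\subset\mathbb{C}^m$, let $\mathcal{O}(\mathbb{D},D)$ be the set of holomorphic maps from $\mathbb{D}$ to $D$. The Lempert function of $D$ is defined, for $z,w\in D$, by $$l_D(z,w)=\inf\{|\alpha|:\alpha\in\mathbb{D},\ \exists\,\varphi\in\mathcal{O}(\mathbb{D},D)\text{ with }\varphi(0)=z,\ \varphi(\alpha)=w\}.$$ *)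

(* Defs.v *)
From mathcomp Require Import all_boot all_order all_algebra.
From mathcomp Require Import all_classical all_reals all_analysis.
From mathcomp Require Import complex.

Set Implicit Arguments.
Unset Strict Implicit.
Unset Printing Implicit Defensive.

Import Order.TTheory GRing.Theory Num.Theory.
Import numFieldNormedType.Exports.

Local Open Scope classical_set_scope.
Local Open Scope ring_scope.

(* The bundled form of [R[i]]: the topology and norm that the analysis library
   puts on every [numClosedFieldType], and on matrices over it, are inferred
   for [Cplx R] but not for the bare type [complex R]. *)
Definition Cplx (R : realType) : numClosedFieldType := (R[i])%C.

(* The norm [`|z|] is itself an element of [Cplx R]; [modulus] is the same
   quantity as an element of [R]. *)
Definition modulus (R : realType) (z : Cplx R) : R := complex.Re `|z|.

Definition unit_disc (R : realType) : set (Cplx R) := [set z | modulus z < 1].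

(* For [0 < n] the set of eigenvalues is finite and nonempty, so that this
   supremum is a maximum. *)
Definition spectral_radius (R : realType) (n : nat) (A : 'M[Cplx R]_n) : R :=
  sup [set modulus z | z in [set z : Cplx R | \det (z%:M - A) = 0]].

Definition spectral_ball (R : realType) (n : nat) : set 'M[Cplx R]_n :=
  [set A | spectral_radius A < 1].
Arguments spectral_ball : clear implicits.

Definition cyclic_mx (R : realType) (n : nat) (A : 'M[Cplx R]_n) : Prop :=
  exists v : 'cV[Cplx R]_n,
    <<[seq A ^+ k *m v | k <- iota 0 n]>>%VS = fullv.

(* Derivability over the field [Cplx R] is complex differentiability; the disc
   being open, the values of [f] outside of it are irrelevant. *)
Definition holomorphic_disc (R : realType) (V : normedModType (Cplx R))
    (D : set V) (f : Cplx R -> V) : Prop :=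
  (forall z, unit_disc z -> derivable f z 1) /\
  (forall z, unit_disc z -> D (f z)).

Definition lempert (R : realType) (V : normedModType (Cplx R)) (D : set V)
    (z w : V) : R :=
  inf [set modulus a | a in [set a : Cplx R | unit_disc a /\
    exists f : Cplx R -> V, [/\ holomorphic_disc D f, f 0 = z & f a = w]]].

(* Main.v *)
Require Import Defs.
From mathcomp Require Import all_boot all_order all_algebra fingroup perm.
From mathcomp Require Import all_classical all_reals all_analysis.
From mathcomp Require Import complex spectral ring lra zify.

Import Order.TTheory GRing.Theory Num.Theory.
Import numFieldNormedType.Exports.

Set Implicit Arguments.
Unset Strict Implicit.
Unset Printing Implicit Defensive.

Local Open Scope classical_set_scope.
Local Open Scope ring_scope.

(** A disc here is a holomorphic map of the unit disc into the spectral ball, and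
    [reach A B a] says that some disc takes the values [A] at [0] and [B] at [a].
    Discs may be conjugated by holomorphic paths of invertible matrices, so that, for
    nonzero [a], [reach A B a] depends only on the conjugacy classes of [A] and [B]
    ([reach_conj_l], [reach_conj_r]). Conjugacy classes are not closed: conjugates of a
    cyclic matrix accumulate at every matrix of the same spectrum, such as a diagonal
    one ([diag_degeneration]). This is where continuity in the second variable tends to
    fail: if it holds at [A], then a disc from [A] to some matrix [T] bounds the Lempert
    function at the diagonal matrix with the spectrum of [T] ([cont_diag_limit]), which
    is often too good to be true. Moebius transformations of the ball move any single
    eigenvalue to zero ([cont_mobmx]).

    Continuity. From the zero matrix the Lempert function is the spectral radius
    ([lempert0]), by a Schwarz lemma for traces of powers ([spectral_schwarz]), and the
    spectral radius is continuous. From a nonzero nilpotent matrix of size two it is a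
    supremum of moduli of equicontinuous functions of the trace and the determinant
    ([nilpotent_lempert]): these functions map pairs of points of the unit disc to the
    unit disc ([bidisc_lt]), and the bounds they give are attained on explicit
    geodesics ([geodesic_exists]), realized by companion matrices ([pair_reach]).

    Discontinuity for several eigenvalues ([several_eigenvalues_not_cont]). After Moebius
    transformations there is an eigenvalue [y] of largest modulus whose copies can be
    paired with copies of a smaller eigenvalue [x]; all other eigenvalues are smaller
    than [y]. The two by two blocks with spectrum [x, y] are reached from nilpotent
    blocks at a parameter smaller than [|y|], because in a suitable coordinate the
    geodesic computes a midpoint of [x] and [y] ([bidisc_midpoint]). Hence [A] is joined
    at a parameter smaller than [|y|] to a nilpotent matrix, whose conjugates accumulate
    at zero, while the distance of [A] to zero is its spectral radius [|y|].

    Discontinuity for a nonzero nilpotent matrix of size [n + 1], with [n > 1]. The test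
    points are diagonal matrices equal to the scalar [b] up to one row, with zero trace.
    Near them a disc [f] is constrained: [f - b] is divisible by [z - a] in all rows
    but one, and the maximum principle applies to the quotient of its characteristic
    polynomial ([pencil]). If [A] has rank [n] then it is conjugate to the shift, and a
    disc to a companion matrix with the test spectrum has parameter of order [b^2],
    whereas the constraint says that [b^(n+1)] is at most of order [a^n]
    ([regular_not_cont]). If [A] has smaller rank then it degenerates to a matrix of rank
    one ([delta_degeneration]), from which the parameter has order [beta^(n+1)] for
    [b = beta^n], whereas now [det f] vanishes twice at the origin and [b] is at most of
    the order of [a] ([corank2_not_cont]).

    The maximum principle and the Schwarz lemma rest on the invariance of circular means
    of holomorphic functions, which is Goursat's theorem for a rectangle in logarithmic
    coordinates ([rectangle_integral_eq0], [mean_value_le]). *)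

(** * The modulus and the topology of the complex plane *)

Section Modulus.
Context {R : realType}.
Local Notation C := (Cplx R).
Implicit Types (z w : C) (x : R).

Definition ofR (x : R) : C := (x%:C)%C.

Lemma normE z : `|z| = ofR (modulus z).
Proof. by rewrite /modulus /ofR normc_def. Qed.

Lemma ofR_lt x (y : R) : (ofR x < ofR y) = (x < y).
Proof. exact: ltcR. Qed.

Lemma ofR_le x (y : R) : (ofR x <= ofR y) = (x <= y).
Proof. exact: lecR. Qed.

Lemma ofR_inj : injective ofR.
Proof. exact: complexI. Qed.

Lemma ofRD x y : ofR (x + y) = ofR x + ofR y.
Proof. exact: (rmorphD (real_complex R)). Qed.

Lemma ofRM x y : ofR (x * y) = ofR x * ofR y.
Proof. exact: (rmorphM (real_complex R)). Qed.

Lemma ofRB x y : ofR (x - y) = ofR x - ofR y.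
Proof. exact: (rmorphB (real_complex R)). Qed.

Lemma ofR0 : ofR 0 = 0. Proof. by []. Qed.
Lemma ofR1 : ofR 1 = 1. Proof. by []. Qed.

Lemma ofRX x n : ofR (x ^+ n) = ofR x ^+ n.
Proof. exact: (rmorphXn (real_complex R)). Qed.

Lemma ofRV x : ofR x^-1 = (ofR x)^-1.
Proof. exact: (fmorphV (real_complex R)). Qed.

Lemma ofR_nat n : ofR n%:R = n%:R.
Proof. exact: (rmorph_nat (real_complex R)). Qed.

Lemma ofR_eq0 x : (ofR x == 0) = (x == 0).
Proof. exact: (fmorph_eq0 (real_complex R)). Qed.

Lemma modulus_ge0 z : 0 <= modulus z.
Proof. by rewrite -ofR_le -normE normr_ge0. Qed.

Lemma modulus0 : modulus (0 : C) = 0.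
Proof. by apply: ofR_inj; rewrite -normE normr0. Qed.

Lemma modulus1 : modulus (1 : C) = 1.
Proof. by apply: ofR_inj; rewrite -normE normr1. Qed.

Lemma modulus_eq0 z : (modulus z == 0) = (z == 0).
Proof. by rewrite -ofR_eq0 -normE normr_eq0. Qed.

Lemma modulus_gt0 z : (0 < modulus z) = (z != 0).
Proof. by rewrite lt_def modulus_ge0 andbT modulus_eq0. Qed.

Lemma modulusM z w : modulus (z * w) = modulus z * modulus w.
Proof. by apply: ofR_inj; rewrite ofRM -!normE normrM. Qed.

Lemma modulusV z : modulus z^-1 = (modulus z)^-1.
Proof. by apply: ofR_inj; rewrite ofRV -!normE normfV. Qed.

Lemma modulus_div z w : modulus (z / w) = modulus z / modulus w.
Proof. by rewrite modulusM modulusV. Qed.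

Lemma modulusX z n : modulus (z ^+ n) = modulus z ^+ n.
Proof. by apply: ofR_inj; rewrite ofRX -!normE normrX. Qed.

Lemma modulusN z : modulus (- z) = modulus z.
Proof. by apply: ofR_inj; rewrite -!normE normrN. Qed.

Lemma modulusC z w : modulus (z - w) = modulus (w - z).
Proof. by apply: ofR_inj; rewrite -!normE distrC. Qed.

Lemma modulusD z w : modulus (z + w) <= modulus z + modulus w.
Proof. by rewrite -ofR_le ofRD -!normE ler_normD. Qed.

Lemma modulusB z w : modulus (z - w) <= modulus z + modulus w.
Proof. by rewrite -(modulusN w); exact: modulusD. Qed.

Lemma modulus_ofR x : modulus (ofR x) = `|x|.
Proof. by apply: ofR_inj; rewrite -normE /ofR normc_def /= expr0n /= addr0 sqrtr_sqr. Qed.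

Lemma modulus_ge_sub z w : modulus z - modulus w <= modulus (z - w).
Proof.
have /= := modulusD (z - w) w; rewrite subrK; lra.
Qed.

Lemma modulus_sum (I : Type) (r : seq I) (P : pred I) (F : I -> C) :
  modulus (\sum_(i <- r | P i) F i) <= \sum_(i <- r | P i) modulus (F i).
Proof.
elim/big_ind2: _ => [|x1 x2 y1 y2 h1 h2|//]; first by rewrite modulus0.
by apply: le_trans (modulusD _ _) _; rewrite lerD.
Qed.

Lemma modulus_prod (I : Type) (r : seq I) (P : pred I) (F : I -> C) :
  modulus (\prod_(i <- r | P i) F i) = \prod_(i <- r | P i) modulus (F i).
Proof.
by elim/big_ind2: _ => [|x1 x2 y1 y2 h1 h2|//]; rewrite ?modulus1 ?modulusM ?h1 ?h2.
Qed.

Lemma modulus_sqr z : modulus z ^+ 2 = complex.Re z ^+ 2 + complex.Im z ^+ 2.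
Proof. by apply: ofR_inj; rewrite ofRX -normE -add_Re2_Im2. Qed.

Lemma ReD z w : complex.Re (z + w) = complex.Re z + complex.Re w.
Proof. by case: z; case: w. Qed.
Lemma ImD z w : complex.Im (z + w) = complex.Im z + complex.Im w.
Proof. by case: z; case: w. Qed.
Lemma ReN z : complex.Re (- z) = - complex.Re z.
Proof. by case: z. Qed.
Lemma ImN z : complex.Im (- z) = - complex.Im z.
Proof. by case: z. Qed.
Lemma ReM z w :
  complex.Re (z * w) = complex.Re z * complex.Re w - complex.Im z * complex.Im w.
Proof. by case: z; case: w. Qed.
Lemma ImM z w :
  complex.Im (z * w) = complex.Re z * complex.Im w + complex.Im z * complex.Re w.
Proof. by case: z => a b; case: w => c d /=. Qed.

Lemma complex_eq z w :
  complex.Re z = complex.Re w -> complex.Im z = complex.Im w -> z = w.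
Proof. by case: z => a b; case: w => c d /= -> ->. Qed.

Definition mkC (x y : R) : C := (x +i* y)%C.

Lemma Re_le_modulus z : `|complex.Re z| <= modulus z.
Proof.
rewrite -(ger0_norm (modulus_ge0 z)) -ler_sqr ?nnegrE // !real_normK ?num_real //.
by rewrite modulus_sqr lerDl sqr_ge0.
Qed.

Lemma Im_le_modulus z : `|complex.Im z| <= modulus z.
Proof.
rewrite -(ger0_norm (modulus_ge0 z)) -ler_sqr ?nnegrE // !real_normK ?num_real //.
by rewrite modulus_sqr lerDr sqr_ge0.
Qed.

Lemma modulus_le_ReIm z : modulus z <= `|complex.Re z| + `|complex.Im z|.
Proof.
rewrite -ler_sqr ?nnegrE ?modulus_ge0 ?addr_ge0 ?normr_ge0 //.
rewrite modulus_sqr sqrrD -[complex.Re z ^+ 2]real_normK ?num_real //.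
rewrite -[complex.Im z ^+ 2]real_normK ?num_real //.
have := mulr_ge0 (normr_ge0 (complex.Re z)) (normr_ge0 (complex.Im z)).
rewrite mulr2n; nra.
Qed.

Definition conjC (z : C) : C := (z^*)%C.

Lemma conjCD z w : conjC (z + w) = conjC z + conjC w.
Proof. exact: (rmorphD (@conjc R)). Qed.
Lemma conjCM z w : conjC (z * w) = conjC z * conjC w.
Proof. exact: (rmorphM (@conjc R)). Qed.
Lemma conjCN z : conjC (- z) = - conjC z.
Proof. exact: (rmorphN (@conjc R)). Qed.
Lemma conjC0E : conjC 0 = 0. Proof. exact: (rmorph0 (@conjc R)). Qed.
Lemma conjC_ofR x : conjC (ofR x) = ofR x.
Proof. exact: conjc_real. Qed.
Lemma modulus_conj z : modulus (conjC z) = modulus z.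
Proof. by apply: ofR_inj; rewrite -!normE /conjC normcJ. Qed.
Lemma mul_conj z : z * conjC z = ofR (modulus z ^+ 2).
Proof. by rewrite ofRX -normE /conjC sqr_normc. Qed.
Lemma Re_conj z : complex.Re (conjC z) = complex.Re z. Proof. by case: z. Qed.
Lemma Im_conj z : complex.Im (conjC z) = - complex.Im z. Proof. by case: z. Qed.

Lemma nbhsCP z (P : set C) :
  nbhs z P <-> exists2 e : R, 0 < e & forall w, modulus (w - z) < e -> P w.
Proof.
split.
  move=> /nbhs_normP [e /= e0 he].
  have [r er] : exists r, e = ofR r.
    by exists (complex.Re e); apply: complex_eq => //=; have := ger0_Im (ltW e0).
  exists r; first by rewrite -ofR_lt -er.
  move=> w hw; apply: he; rewrite /ball_ /= distrC normE er ofR_lt //.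
move=> [e e0 he]; apply/nbhs_normP; exists (ofR e); first by rewrite /= -ofR0 ofR_lt.
by move=> w; rewrite /ball_ /= distrC normE ofR_lt; exact: he.
Qed.

Lemma continuousCP (f : C -> C) z : {for z, continuous f} <->
  forall e : R, 0 < e ->
    exists2 d : R, 0 < d & forall w, modulus (w - z) < d -> modulus (f w - f z) < e.
Proof.
split=> [fz e e0|h P /nbhsCP [e e0 he]].
  have /fz /nbhsCP [d d0 hd] : nbhs (f z) [set y | modulus (y - f z) < e].
    by apply/nbhsCP; exists e.
  by exists d.
by have [d d0 hd] := h _ e0; apply/nbhsCP; exists d => // w /hd; exact: he.
Qed.

End Modulus.

(** * Cauchy's theorem for a rectangle *)

Section Goursat.
Context {R : realType}.
Implicit Types (x y e d : R).

Lemma mvt_closed (g dg : R -> R) (a b : R) : a <= b ->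
  (forall x : R, a <= x <= b -> is_derive x 1 g (dg x)) ->
  exists2 c : R, a <= c <= b & g b - g a = dg c * (b - a).
Proof.
move=> ab hg.
have [x||c + ->] := @MVT_segment _ g dg a b ab.
- by rewrite in_itv /= => /andP[h1 h2]; apply: hg; rewrite !ltW.
- apply: continuous_in_subspaceT => x; rewrite inE /= in_itv /= => hx.
  have /derivable1_diffP/differentiable_continuous := @ex_derive _ _ _ _ _ _ _ (hg _ hx).
  exact.
by rewrite in_itv /= => hc; exists c.
Qed.

Lemma mvt_bound (g dg : R -> R) (a b M : R) : a <= b ->
  (forall x : R, a <= x <= b -> is_derive x 1 g (dg x)) ->
  (forall x : R, a <= x <= b -> `|dg x| <= M) -> `|g b - g a| <= M * (b - a).
Proof.
move=> ab hg hM; have [c hc ->] := mvt_closed ab hg.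
rewrite normrM (ger0_norm (_ : 0 <= b - a)) ?subr_ge0 //.
by rewrite ler_wpM2r ?subr_ge0 // hM.
Qed.

(** The primitive is based at a left endpoint [c], below which it is not
    controlled; this suffices since all rectangles below are bounded. *)
Definition prim (c : R) (f : R -> R) (x : R) : R :=
  \int[lebesgue_measure]_(t in `[c, x]) f t.

Lemma is_derive_prim (c : R) (f : R -> R) (x : R) :
  continuous f -> c < x -> is_derive x 1 (prim c f) (f x).
Proof.
move=> cf cx.
have xu : x < x + 1 by rewrite ltrDl.
have intf : (@lebesgue_measure R).-integrable `[c, x + 1] (EFin \o f).
  apply: continuous_compact_integrable; first exact: segment_compact.
  exact: continuous_subspaceT.
have [df Df] := continuous_FTC1_closed xu intf cx (cf x).
by apply: DeriveDef; [exact: df|rewrite -derive1E].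
Qed.

(** Real differentiability together with the Cauchy-Riemann equations. *)
Definition cr_diff (u v : R -> R -> R) (x y : R) :=
  exists A B : R, forall e : R, 0 < e -> exists2 d : R, 0 < d &
    forall x' y' : R, `|x' - x| < d -> `|y' - y| < d ->
    `|u x' y' - u x y - A * (x' - x) + B * (y' - y)|
       <= e * (`|x' - x| + `|y' - y|) /\
    `|v x' y' - v x y - B * (x' - x) - A * (y' - y)|
       <= e * (`|x' - x| + `|y' - y|).

Lemma halving_pow (w : R) n : w / 2 ^+ n.+1 = w / 2 ^+ n / 2.
Proof. by rewrite exprSr invfM mulrA. Qed.

(** The dyadic covering argument: a property of rectangles that holds for all
    small rectangles about each point, and passes from the four quarters of a
    rectangle to the rectangle itself, holds for the rectangle one starts with.
    Otherwise some nested sequence of bad rectangles would shrink to a point. *)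
Lemma quartering_induction (P : R -> R -> nat -> Prop) (w l x0 y0 : R) :
  0 <= w -> 0 <= l ->
  (forall x y n,
     (forall i j : bool, P (x + i%:R * (w / 2 ^+ n.+1)) (y + j%:R * (l / 2 ^+ n.+1)) n.+1) ->
     P x y n) ->
  (forall px py : R, x0 <= px <= x0 + w -> y0 <= py <= y0 + l ->
     exists N : nat, forall n x y, (N <= n)%N ->
       x <= px <= x + w / 2 ^+ n -> y <= py <= y + l / 2 ^+ n -> P x y n) ->
  P x0 y0 0%N.
Proof.
move=> w0 l0 hquarter hsmall; apply: contrapT => hP.
have step (s : R * R * nat) : exists ij : bool * bool, ~ P s.1.1 s.1.2 s.2 ->
    ~ P (s.1.1 + ij.1%:R * (w / 2 ^+ s.2.+1)) (s.1.2 + ij.2%:R * (l / 2 ^+ s.2.+1)) s.2.+1.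
  case: s => [[x y] n] /=; apply: contrapT => /forallNP h.
  have hp : P x y n.
    by apply: hquarter => i j; have /not_implyP[_ /contrapT] := h (i, j).
  by have /not_implyP[/(_ hp)] := h (true, true).
have [pick pickP] := choice step.
pose next (s : R * R * nat) := (s.1.1 + (pick s).1%:R * (w / 2 ^+ s.2.+1),
   s.1.2 + (pick s).2%:R * (l / 2 ^+ s.2.+1), s.2.+1).
pose sq n := iter n next (x0, y0, 0%N).
have sq2 n : (sq n).2 = n by elim: n => //= n ->.
have bad n : ~ P (sq n).1.1 (sq n).1.2 n.
  elim: n => [//|n ih]; have := pickP (sq n); rewrite sq2 => /(_ ih).
  by rewrite /= /next /= sq2.
(* both coordinates behave alike: a generic limit argument for one of them *)
have nest (c : nat -> R) (h : R) : 0 <= h ->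
    (forall n, c n <= c n.+1 /\ c n.+1 + h / 2 ^+ n.+1 <= c n + h / 2 ^+ n) ->
    exists p, forall n, c n <= p <= c n + h / 2 ^+ n.
  move=> h0 hc.
  have mono m n : (m <= n)%N -> c m <= c n /\ c n + h / 2 ^+ n <= c m + h / 2 ^+ m.
    elim: n => [|n ih]; first by rewrite leqn0 => /eqP->.
    rewrite leq_eqVlt => /orP[/eqP-> //|]; rewrite ltnS => /ih[h1 h2].
    by have [h3 h4] := hc n; split; [apply: le_trans h1 h3|apply: le_trans h4 h2].
  have pos n : 0 <= h / 2 ^+ n by rewrite divr_ge0 // exprn_ge0.
  have ub m n : c m <= c n + h / 2 ^+ n.
    have [/mono[h1 _]|/ltnW/mono[_ h2]] := leqP m n.
      by apply: le_trans h1 _; rewrite lerDl.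
    by apply: le_trans h2; rewrite lerDl.
  exists (sup (range c)) => n; apply/andP; split.
    apply: ub_le_sup; last by exists n.
    by exists (c 0%N + h / 2 ^+ 0) => _ [m _ <-].
  apply: ge_sup; first by exists (c 0%N), 0%N.
  by move=> _ [m _ <-].
have half (h : R) n : h / 2 ^+ n.+1 + h / 2 ^+ n.+1 = h / 2 ^+ n.
  by rewrite halving_pow -splitr.
have stepb (b : bool) (c h : R) n : 0 <= h -> c <= c + b%:R * (h / 2 ^+ n.+1) /\
    c + b%:R * (h / 2 ^+ n.+1) + h / 2 ^+ n.+1 <= c + h / 2 ^+ n.
  move=> h0; have hp : 0 <= h / 2 ^+ n.+1 by rewrite divr_ge0 // exprn_ge0.
  by have := half h n; case: b; rewrite /= ?mul0r ?mul1r; lra.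
have [px hpx] : exists p, forall n, (sq n).1.1 <= p <= (sq n).1.1 + w / 2 ^+ n.
  by apply: nest => // n; rewrite /= sq2; exact: stepb.
have [py hpy] : exists p, forall n, (sq n).1.2 <= p <= (sq n).1.2 + l / 2 ^+ n.
  by apply: nest => // n; rewrite /= sq2; exact: stepb.
have := hpx 0%N; have := hpy 0%N; rewrite /= expr0 !divr1 => hy hx.
have [N hN] := hsmall px py hx hy.
by apply: (bad N); apply: hN.
Qed.

Lemma dyadic_small (w d : R) : 0 < d ->
  exists N : nat, forall n, (N <= n)%N -> `|w| / 2 ^+ n < d.
Proof.
move=> d0; have [N hN] : exists N : nat, `|w| / d < N%:R.
  by exists (Num.bound (`|w| / d)); apply: archi_boundP; rewrite divr_ge0 // ltW.
exists N => n Nn; rewrite ltr_pdivrMr ?exprn_gt0 // mulrC -ltr_pdivrMr //.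
apply: lt_le_trans hN _; apply: (@le_trans _ _ n%:R); first by rewrite ler_nat.
by rewrite -natrX ler_nat ltnW // ltn_expl.
Qed.

(** On a rectangle where [u] and [v] are nearly affine, with Cauchy-Riemann
    linear part, the contributions of the linear parts cancel. *)
Lemma rectangle_integral_local (u v Pu Pv : R -> R -> R)
    (x y W L A B px py eta : R) : 0 <= W -> 0 <= L ->
  (forall x' y' : R, x <= x' <= x + W -> y <= y' <= y + L ->
     [/\ is_derive y' 1 (Pu x') (u x' y'), is_derive x' 1 (Pv y') (v x' y'),
      `|u x' y' - u px py - A * (x' - px) + B * (y' - py)| <= eta &
      `|v x' y' - v px py - B * (x' - px) - A * (y' - py)| <= eta]) ->
  `|(Pu (x + W) (y + L) - Pu (x + W) y) - (Pu x (y + L) - Pu x y)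
   - ((Pv (y + L) (x + W) - Pv (y + L) x) - (Pv y (x + W) - Pv y x))|
  <= 2 * eta * (W + L).
Proof.
move=> W0 L0 est.
have x1 : x <= x <= x + W by rewrite lexx lerDl.
have x2 : x <= x + W <= x + W by rewrite lexx lerDl W0.
have y1 : y <= y <= y + L by rewrite lexx lerDl.
have y2 : y <= y + L <= y + L by rewrite lexx lerDl L0.
have B1 : `|(Pu (x + W) (y + L) - Pu (x + W) y) - (Pu x (y + L) - Pu x y) - A * W * L|
    <= 2 * eta * L.
  pose g t := Pu (x + W) t - Pu x t - A * W * t.
  have -> : (Pu (x + W) (y + L) - Pu (x + W) y) - (Pu x (y + L) - Pu x y) - A * W * L
    = g (y + L) - g y by rewrite /g; ring.
  rewrite [X in _ <= _ * X](_ : L = y + L - y); last by ring.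
  apply: (@mvt_bound g (fun t => u (x + W) t - u x t - A * W)); first by rewrite lerDl.
    move=> t ht; have [d1 _ _ _] := est _ _ x2 ht; have [d2 _ _ _] := est _ _ x1 ht.
    have d3 : is_derive t 1 (fun t => A * W * t : R) (A * W).
      by apply: is_derive_eq; rewrite /GRing.scale /= mulr1.
    exact: is_deriveB.
  move=> t ht; have [_ _ e1 _] := est _ _ x2 ht; have [_ _ e2 _] := est _ _ x1 ht.
  have := lerD e1 e2; rewrite [X in _ <= X -> _](_ : _ = 2 * eta); last by ring.
  apply: le_trans; apply: le_trans (ler_normB _ _).
  by rewrite le_eqVlt; apply/orP; left; apply/eqP; congr `|_|; ring.
have B2 : `|(Pv (y + L) (x + W) - Pv (y + L) x) - (Pv y (x + W) - Pv y x) - A * L * W|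
    <= 2 * eta * W.
  pose g t := Pv (y + L) t - Pv y t - A * L * t.
  have -> : (Pv (y + L) (x + W) - Pv (y + L) x) - (Pv y (x + W) - Pv y x) - A * L * W
    = g (x + W) - g x by rewrite /g; ring.
  rewrite [X in _ <= _ * X](_ : W = x + W - x); last by ring.
  apply: (@mvt_bound g (fun t => v t (y + L) - v t y - A * L)); first by rewrite lerDl.
    move=> t ht; have [_ d1 _ _] := est _ _ ht y2; have [_ d2 _ _] := est _ _ ht y1.
    have d3 : is_derive t 1 (fun t => A * L * t : R) (A * L).
      by apply: is_derive_eq; rewrite /GRing.scale /= mulr1.
    exact: is_deriveB.
  move=> t ht; have [_ _ _ e1] := est _ _ ht y2; have [_ _ _ e2] := est _ _ ht y1.
  have := lerD e1 e2; rewrite [X in _ <= X -> _](_ : _ = 2 * eta); last by ring.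
  apply: le_trans; apply: le_trans (ler_normB _ _).
  by rewrite le_eqVlt; apply/orP; left; apply/eqP; congr `|_|; ring.
have := lerD B1 B2.
rewrite [X in _ <= X -> _](_ : _ = 2 * eta * (W + L)); last by ring.
apply: le_trans; apply: le_trans (ler_normB _ _).
by rewrite le_eqVlt; apply/orP; left; apply/eqP; congr `|_|; ring.
Qed.

(** Goursat's argument for the imaginary part of the integral of [u + i v]
    along the boundary of a rectangle, written through primitives of [u] along
    vertical and of [v] along horizontal lines; additivity of the boundary
    integral is then an identity, and its smallness is the mean value theorem. *)
Lemma rectangle_integral_eq0 (u v Pu Pv : R -> R -> R) (x0 y0 w l : R) :
  0 <= w -> 0 <= l ->
  (forall x y : R, x0 <= x <= x0 + w -> y0 <= y <= y0 + l -> is_derive y 1 (Pu x) (u x y)) ->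
  (forall x y : R, x0 <= x <= x0 + w -> y0 <= y <= y0 + l -> is_derive x 1 (Pv y) (v x y)) ->
  (forall x y : R, x0 <= x <= x0 + w -> y0 <= y <= y0 + l -> cr_diff u v x y) ->
  (Pu (x0 + w) (y0 + l) - Pu (x0 + w) y0) - (Pu x0 (y0 + l) - Pu x0 y0)
  = (Pv (y0 + l) (x0 + w) - Pv (y0 + l) x0) - (Pv y0 (x0 + w) - Pv y0 x0).
Proof.
move=> w0 l0 dPu dPv hcr; apply/eqP; rewrite -subr_eq0.
pose T x y (n : nat) := let w' := w / 2 ^+ n in let l' := l / 2 ^+ n in
  (Pu (x + w') (y + l') - Pu (x + w') y) - (Pu x (y + l') - Pu x y)
  - ((Pv (y + l') (x + w') - Pv (y + l') x) - (Pv y (x + w') - Pv y x)).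
have -> : (Pu (x0 + w) (y0 + l) - Pu (x0 + w) y0) - (Pu x0 (y0 + l) - Pu x0 y0)
  - ((Pv (y0 + l) (x0 + w) - Pv (y0 + l) x0) - (Pv y0 (x0 + w) - Pv y0 x0))
  = T x0 y0 0%N by rewrite /T expr0 !divr1.
rewrite -normr_le0; apply/ler_addgt0Pr => e e0; rewrite add0r.
pose K := (w + l) ^+ 2 + 1.
have K0 : 0 < K by rewrite /K ltr_wpDl // sqr_ge0.
pose eta := e / (2 * K).
have eta0 : 0 < eta by rewrite divr_gt0 // mulr_gt0.
have half n (h : R) : h / 2 ^+ n = h / 2 ^+ n.+1 + h / 2 ^+ n.+1.
  by rewrite halving_pow -splitr.
suff hT : x0 <= x0 -> x0 + w / 2 ^+ 0 <= x0 + w ->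
    y0 <= y0 -> y0 + l / 2 ^+ 0 <= y0 + l ->
    `|T x0 y0 0%N| <= 2 * eta * ((w + l) / 2 ^+ 0) ^+ 2.
  apply: le_trans (hT _ _ _ _) _; rewrite ?expr0 ?divr1 //.
  have -> : 2 * eta = e / K by rewrite /eta; field; rewrite gt_eqF.
  rewrite [e / K * _]mulrAC ler_pdivrMr // ler_pM2l // /K; lra.
pose Q x y n := x0 <= x -> x + w / 2 ^+ n <= x0 + w ->
  y0 <= y -> y + l / 2 ^+ n <= y0 + l ->
  `|T x y n| <= 2 * eta * ((w + l) / 2 ^+ n) ^+ 2.
apply: (@quartering_induction Q w l x0 y0) => // [x y n hq h1 h2 h3 h4|px py hpx hpy].
  have ew := half n w; have el := half n l.
  (* a quarter lies inside the rectangle *)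
  have inside (i : bool) (z h Z : R) : 0 <= h -> z + (h + h) <= Z ->
      z + i%:R * h + h <= Z.
    by clear=> h0; apply: le_trans; rewrite -addrA lerD2l lerD2r; case: i;
      rewrite ?mul1r ?mul0r.
  have low (i : bool) (z h Z : R) : 0 <= h -> Z <= z -> Z <= z + i%:R * h.
    by clear=> h0 /le_trans; apply; rewrite lerDl mulr_ge0.
  have p1 : 0 <= w / 2 ^+ n.+1 by rewrite divr_ge0 // exprn_ge0.
  have p2 : 0 <= l / 2 ^+ n.+1 by rewrite divr_ge0 // exprn_ge0.
  rewrite ew in h2; rewrite el in h4.
  have q i j := hq i j (low _ _ _ _ p1 h1) (inside i _ _ _ p1 h2)
                       (low _ _ _ _ p2 h3) (inside j _ _ _ p2 h4).
  have q00 := q false false; have q01 := q false true.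
  have q10 := q true false; have q11 := q true true.
  rewrite !mul0r !addr0 in q00; rewrite mul0r mul1r addr0 in q01.
  rewrite mul0r mul1r addr0 in q10; rewrite !mul1r in q11.
  have -> : T x y n = T x y n.+1 + T x (y + l / 2 ^+ n.+1) n.+1
     + T (x + w / 2 ^+ n.+1) y n.+1 + T (x + w / 2 ^+ n.+1) (y + l / 2 ^+ n.+1) n.+1.
    rewrite /T ew el !addrA; ring.
  rewrite [X in _ <= X](_ : _ = 2 * eta * ((w + l) / 2 ^+ n.+1) ^+ 2 +
     2 * eta * ((w + l) / 2 ^+ n.+1) ^+ 2 + 2 * eta * ((w + l) / 2 ^+ n.+1) ^+ 2 +
     2 * eta * ((w + l) / 2 ^+ n.+1) ^+ 2); last by rewrite half; ring.
  do 3 (apply: le_trans (ler_normD _ _) _; apply: lerD => //).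
have [A [B hAB]] := hcr _ _ hpx hpy.
have [d d0 hd] := hAB _ eta0.
have [N1 hN1] := dyadic_small w d0; have [N2 hN2] := dyadic_small l d0.
exists (maxn N1 N2) => n x y; rewrite geq_max => /andP[/hN1 n1 /hN2 n2] hx hy h1 h2 h3 h4.
rewrite (ger0_norm w0) in n1; rewrite (ger0_norm l0) in n2.
have p1 : 0 <= w / 2 ^+ n by rewrite divr_ge0 // exprn_ge0.
have p2 : 0 <= l / 2 ^+ n by rewrite divr_ge0 // exprn_ge0.
rewrite /T (mulrDl w l).
move: (w / 2 ^+ n) (l / 2 ^+ n) n1 n2 p1 p2 hx hy h1 h2 h3 h4.
move=> W L Wd Ld W0 L0 hx hy h1 h2 h3 h4.
have near z pz Z : Z < d -> z <= pz <= z + Z ->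
    forall t, z <= t <= z + Z -> `|t - pz| < d /\ `|t - pz| <= Z.
  clear; move=> Zd /andP[z1 z2] t /andP[t1 t2].
  have : `|t - pz| <= Z.
    rewrite ler_norml lerBrDr lerBlDr addrC; apply/andP; split.
      by rewrite lerBlDr (le_trans z2) // lerD2r.
    by rewrite (le_trans t2) // [in leRHS]addrC lerD2r.
  by split=> //; apply: le_lt_trans Zd.
have nx := near x px W Wd hx; have ny := near y py L Ld hy.
rewrite (_ : 2 * eta * (W + L) ^+ 2 = 2 * (eta * (W + L)) * (W + L)); last by ring.
apply: (@rectangle_integral_local u v Pu Pv x y W L A B px py) => // x' y' hx' hy'.
have hx'' : x0 <= x' <= x0 + w.
  by case/andP: hx' => a b; rewrite (le_trans h1 a) (le_trans b h2).
have hy'' : y0 <= y' <= y0 + l.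
  by case/andP: hy' => a b; rewrite (le_trans h3 a) (le_trans b h4).
have [a1 a2] := nx _ hx'; have [b1 b2] := ny _ hy'.
have [c1 c2] := hd _ _ a1 b1.
split; [exact: dPu|exact: dPv|apply: le_trans c1 _|apply: le_trans c2 _];
  by rewrite ler_pM2l // lerD.
Qed.

End Goursat.

(** * The complex exponential and the mean value inequality *)

Section MeanValue.
Context {R : realType}.
Local Notation C := (Cplx R).

Lemma derivableCP (f : C -> C) (z : C) : derivable f z 1 <->
  exists l : C, forall e : R, 0 < e -> exists2 d : R, 0 < d &
    forall w, modulus (w - z) < d ->
      modulus (f w - f z - l * (w - z)) <= e * modulus (w - z).
Proof.
split.
  move=> /cvg_ex [l hl]; exists l => e e0.
  have /hl : nbhs l [set y | modulus (y - l) < e] by apply/nbhsCP; exists e.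
  move=> /nbhsCP [d d0 hd]; exists d => // w hw.
  have [->|wz] := eqVneq w z; first by rewrite !subrr mulr0 subrr modulus0 mulr0.
  have wz0 : w - z != 0 by rewrite subr_eq0.
  have := hd (w - z); rewrite subr0 => /(_ hw wz0) /=.
  rewrite /GRing.scale /= mulr1 subrK => h.
  rewrite -[f w - f z](mulVKf wz0) [l * _]mulrC -mulrBr modulusM mulrC.
  by rewrite ler_wpM2r ?modulus_ge0 // ltW.
move=> [l hl]; apply/cvg_ex; exists l => P /nbhsCP [e e0 he].
have [d d0 hd] := hl (e / 2) (divr_gt0 e0 (ltr0Sn _ 1)).
apply/nbhsCP; exists d => // h; rewrite subr0 => hh h0; apply: he => /=.
rewrite /GRing.scale /= mulr1 /=.
have := hd (h + z); rewrite addrK => /(_ hh) /= hle.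
have -> : h^-1 * (f (h + z) - f z) - l = h^-1 * (f (h + z) - f z - l * h).
  by rewrite [RHS]mulrBr [l * h]mulrC mulKf.
rewrite modulusM modulusV mulrC ltr_pdivrMr ?modulus_gt0 //.
apply: le_lt_trans hle _; rewrite ltr_pM2r ?modulus_gt0 //; lra.
Qed.

Lemma derivable_continuousC (f : C -> C) z : derivable f z 1 -> {for z, continuous f}.
Proof. by move=> /derivable1_diffP/differentiable_continuous. Qed.

Lemma derivable_compC (f g : C -> C) z :
  derivable f z 1 -> derivable g (f z) 1 -> derivable (g \o f) z 1.
Proof.
move=> /derivable1_diffP df /derivable1_diffP dg.
by apply/(derivable1_diffP (g \o f)); exact: (@differentiable_comp _ _ _ _ f g z df dg).
Qed.

Lemma is_derive_approx (f : R -> R) (x df : R) : is_derive x 1 f df ->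
  forall e : R, 0 < e -> exists2 d : R, 0 < d & forall h : R, `|h| < d ->
    `|f (x + h) - f x - df * h| <= e * `|h|.
Proof.
move=> [/cvg_ex [l hl] dfE] e e0.
have ldf : l = df by rewrite -dfE; apply/esym/cvg_lim.
have /cvgrPdist_le /(_ e e0) := hl; rewrite ldf => /nbhs_ballP [d /= d0 hd].
exists d => // h hh.
have [->|h0] := eqVneq h 0; first by rewrite addr0 subrr mulr0 subrr normr0 mulr0.
have := hd h; rewrite /ball /= sub0r normrN => /(_ hh h0).
rewrite /GRing.scale /= mulr1 [h + x]addrC distrC => hle.
have -> : f (x + h) - f x - df * h = (h^-1 * (f (x + h) - f x) - df) * h.
  by rewrite mulrBl mulrAC mulVf // mul1r.
by rewrite normrM ler_wpM2r.
Qed.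

Definition cexp (w : C) : C :=
  mkC (expR (complex.Re w) * cos (complex.Im w)) (expR (complex.Re w) * sin (complex.Im w)).

Lemma cexpD (z w : C) : cexp (z + w) = cexp z * cexp w.
Proof.
apply: complex_eq; rewrite ?ReM ?ImM /= ReD ImD expRD ?cosD ?sinD; ring.
Qed.

Lemma modulus_cexp (w : C) : modulus (cexp w) = expR (complex.Re w).
Proof.
apply/eqP; rewrite -(eqrXn2 (ltn0Sn 1)) ?modulus_ge0 ?expR_ge0 //; apply/eqP.
by rewrite modulus_sqr /= !exprMn -mulrDr cos2Dsin2 mulr1.
Qed.

Lemma cexp_neq0 (w : C) : cexp w != 0.
Proof. by rewrite -modulus_gt0 modulus_cexp expR_gt0. Qed.

Lemma cexp0 : cexp 0 = 1.
Proof. by apply: complex_eq; rewrite /= expR0 ?cos0 ?sin0 ?mulr1 ?mulr0. Qed.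

Lemma cexp_approx0 (e : R) : 0 < e -> exists2 d : R, 0 < d &
  forall h : C, modulus h < d -> modulus (cexp h - 1 - h) <= e * modulus h.
Proof.
move=> e0; pose k := e / 7.
have k0 : 0 < k by rewrite divr_gt0.
have [d1 d10 h1] := is_derive_approx (is_derive_expR 0) k0.
have [d2 d20 h2] := is_derive_approx (is_derive_cos 0) k0.
have [d3 d30 h3] := is_derive_approx (is_derive_sin 0) k0.
pose d := Num.min 1 (Num.min k (Num.min d1 (Num.min d2 d3))).
exists d; first by rewrite !lt_min ltr01 k0 d10 d20 d30.
move=> h; rewrite !lt_min => /and5P[m1 mk md1 md2 md3].
have Rx := Re_le_modulus h; have Iy := Im_le_modulus h.
move: (h1 _ (le_lt_trans Rx md1)) (h2 _ (le_lt_trans Iy md2)) (h3 _ (le_lt_trans Iy md3)).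
rewrite !add0r expR0 cos0 sin0 !(mul1r, oppr0, mul0r, subr0, addr0).
case: h m1 mk Rx Iy {md1 md2 md3} => x y /= m1 mk Rx Iy a1 a2 a3.
set M := modulus _ in m1 mk Rx Iy *.
have M0 : 0 <= M by exact: modulus_ge0.
have X1 : `|1 + x| <= 2.
  by apply: le_trans (ler_normD _ _) _; rewrite normr1 lerD2l (le_trans Rx) // ltW.
have c1 : `|cos y| <= 1 by rewrite ler_norml cos_geN1 cos_le1.
have s1 : `|sin y| <= 1 by rewrite ler_norml sin_geN1 sin_le1.
have b1 : `|expR x - 1 - x| <= k * M by apply: le_trans a1 _; rewrite ler_pM2l.
have b2 : `|cos y - 1| <= k * M by apply: le_trans a2 _; rewrite ler_pM2l.
have b3 : `|sin y - y| <= k * M by apply: le_trans a3 _; rewrite ler_pM2l.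
have kM : 0 <= k * M by rewrite mulr_ge0 // ltW.
have b4 : `|x * y| <= k * M.
  by rewrite normrM ler_pM // (le_trans Rx) // ltW.
have p1 : `|(expR x - 1 - x) * cos y| <= k * M.
  by rewrite normrM -[leRHS]mulr1 ler_pM.
have p2 : `|(1 + x) * (cos y - 1)| <= 2 * (k * M) by rewrite normrM ler_pM.
have p3 : `|(expR x - 1 - x) * sin y| <= k * M.
  by rewrite normrM -[leRHS]mulr1 ler_pM.
have p4 : `|(1 + x) * (sin y - y)| <= 2 * (k * M) by rewrite normrM ler_pM.
apply: le_trans (modulus_le_ReIm _) _; rewrite !(ReD, ImD, ReN, ImN) /= oppr0 addr0.
have -> : expR x * cos y - 1 - x =
   (expR x - 1 - x) * cos y + (1 + x) * (cos y - 1) by ring.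
have -> : expR x * sin y - y =
   (expR x - 1 - x) * sin y + (1 + x) * (sin y - y) + x * y by ring.
have -> : e * M = 7 * (k * M) by rewrite /k; field.
have q1 := le_trans (ler_normD _ _) (lerD p1 p2).
have q2 := le_trans (ler_normD _ _) (lerD (le_trans (ler_normD _ _) (lerD p3 p4)) b4).
apply: le_trans (lerD q1 q2) _.
by clear -kM; lra.
Qed.

Lemma derivable_cexp (w : C) : derivable cexp w 1.
Proof.
apply/derivableCP; exists (cexp w) => e e0.
have k0 : 0 < e / modulus (cexp w) by rewrite divr_gt0 // modulus_gt0 cexp_neq0.
have [d d0 hd] := cexp_approx0 k0.
exists d => // w' hw; have := hd _ hw; set h := w' - w => hle.
have -> : w' = w + h by rewrite /h addrC subrK.
have -> : cexp (w + h) - cexp w - cexp w * h = cexp w * (cexp h - 1 - h).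
  by rewrite cexpD; ring.
rewrite modulusM; have := ler_wpM2l (modulus_ge0 (cexp w)) hle.
suff -> : modulus (cexp w) * (e / modulus (cexp w) * modulus h) = e * modulus h by [].
have := cexp_neq0 w; rewrite -modulus_eq0.
by move: (modulus (cexp w)) (modulus h) => a b a0; field.
Qed.

(** Hence two nonzero complex numbers are joined by an entire function without
    zeros. *)
Lemma cexp_surj (u : C) : u != 0 -> exists w, cexp w = u.
Proof.
move=> u0; pose r := modulus u; have r0 : 0 < r by rewrite modulus_gt0.
pose c := complex.Re u / r; pose s := complex.Im u / r.
have cs : c ^+ 2 + s ^+ 2 = 1.
  rewrite /c /s !expr_div_n -mulrDl -modulus_sqr divff // expf_neq0 //.
  by rewrite gt_eqF.
have c1 : -1 <= c <= 1.
  rewrite -ler_norml -(@ler_pXn2r _ 2) ?nnegrE // expr1n real_normK ?num_real //.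
  by rewrite -cs lerDl sqr_ge0.
have s2 : sin (acos c) = `|s|.
  rewrite sin_acos // -sqrtr_sqr; congr Num.sqrt; rewrite -cs; ring.
have [t ct st] : exists2 t, cos t = c & sin t = s.
  have [s0|s0] := leP 0 s.
    by exists (acos c); rewrite ?acosK // s2 ger0_norm.
  exists (- acos c); first by rewrite cosN acosK.
  by rewrite sinN s2 ltr0_norm // opprK.
exists (mkC (ln r) t); apply: complex_eq; rewrite /= lnK ?posrE // ?ct ?st mulrC divfK //.
- by rewrite gt_eqF.
- by rewrite gt_eqF.
Qed.

Lemma cr_diff_derivable (g : C -> C) (x y : R) : derivable g (mkC x y) 1 ->
  cr_diff (fun x y => complex.Re (g (mkC x y))) (fun x y => complex.Im (g (mkC x y))) x y.
Proof.
move=> /derivableCP [l hl]; exists (complex.Re l), (complex.Im l) => e e0.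
have [d d0 hd] := hl _ e0; exists (d / 2); first by rewrite divr_gt0.
move=> x' y' hx hy.
have mle : modulus (mkC x' y' - mkC x y) <= `|x' - x| + `|y' - y|.
  exact: modulus_le_ReIm.
have lt : modulus (mkC x' y' - mkC x y) < d.
  by apply: le_lt_trans mle _; rewrite [d]splitr ltrD.
have := hd _ lt; set q := _ - _ - _ => hq.
have qd : modulus q <= e * (`|x' - x| + `|y' - y|).
  by apply: le_trans hq _; rewrite ler_pM2l.
split; [apply: le_trans qd; apply: le_trans (Re_le_modulus q)|
        apply: le_trans qd; apply: le_trans (Im_le_modulus q)];
  rewrite le_eqVlt; apply/orP; left; apply/eqP; congr `|_|;
  rewrite /q !(ReD, ImD, ReN, ImN, ReM, ImM) /=; ring.
Qed.

Lemma cr_diff_continuous (u v : R -> R -> R) (x y : R) : cr_diff u v x y ->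
  {for y, continuous (u x)} /\ {for x, continuous (v ^~ y)}.
Proof.
move=> [A [B hAB]].
have lim (f : R -> R) (p D : R) :
    (exists2 d : R, 0 < d & forall t : R, `|t - p| < d -> `|f t - f p - D * (t - p)| <= `|t - p|) ->
    {for p, continuous f}.
  clear => -[d d0 hd]; apply/cvgrPdist_lt => e e0.
  have K0 : 0 < 1 + `|D| by rewrite ltr_wpDr.
  near=> t.
  have ht : `|t - p| < d by rewrite distrC; near: t; exact: (@cvgr_dist_lt _ _ _ _ _ id).
  have ht2 : `|t - p| < e / (1 + `|D|).
    rewrite distrC; near: t; apply: (@cvgr_dist_lt _ _ _ _ _ id); first exact: cvg_id.
    exact: divr_gt0.
  rewrite distrC -[f t - f p](subrK (D * (t - p))).
  apply: le_lt_trans (ler_normD _ _) _.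
  apply: le_lt_trans (lerD (hd _ ht) (lexx _)) _.
  rewrite normrM -[X in X + _]mul1r -mulrDl mulrC -ltr_pdivlMr //.
have [d d0 hd] := hAB 1 ltr01; split.
  apply: (@lim _ _ (- B)); exists d => // t ht.
  have xx : `|x - x| < d by rewrite subrr normr0.
  have [+ _] := hd x t xx ht; rewrite subrr normr0.
  rewrite mulr0 subr0 add0r mul1r; apply: le_trans.
  by rewrite le_eqVlt; apply/orP; left; apply/eqP; congr `|_|; ring.
apply: (@lim _ _ B); exists d => // t ht.
have yy : `|y - y| < d by rewrite subrr normr0.
have [_] := hd t y ht yy; rewrite subrr normr0.
by rewrite mulr0 subr0 addr0 mul1r.
Unshelve. all: by end_near.
Qed.

(** In logarithmic coordinates [z0 + exp (x + i y)] the circles about [z0]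
    become vertical segments and periodicity cancels the horizontal sides of
    the rectangle theorem, so the mean of [F] over circles about [z0] does not
    depend on the radius. The centre itself is only reached in the limit:
    continuity suffices there, which makes removable singularities harmless. *)
Lemma mean_value_le (F : C -> C) (z0 : C) (r r1 m : R) : 0 < r < r1 ->
  (forall z, 0 < modulus (z - z0) < r1 -> derivable F z 1) ->
  {for z0, continuous F} ->
  (forall z, modulus (z - z0) = r -> complex.Re (F z) <= m) ->
  complex.Re (F z0) <= m.
Proof.
move=> /andP[r0 rr1] dF cF hm; apply/ler_addgt0Pr => e e0.
have /continuousCP /(_ _ e0) [d d0 hd] := cF.
pose b := ln r; pose b1 := ln ((r + r1) / 2).
have mid : r < (r + r1) / 2 < r1.
  by rewrite ltr_pdivlMr // ltr_pdivrMr // !mulr_natr !mulr2n ltrD2l ltrD2r rr1.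
have [m1 m2] := andP mid.
have rm0 : 0 < (r + r1) / 2 by apply: lt_trans m1.
have bb1 : b < b1 by rewrite ltr_ln ?posrE.
pose a : R := Num.min (b - 1) (ln d - 1).
have ab : a < b by rewrite gt_min ltrBlDr ltrDl ltr01.
have ad : expR a < d.
  rewrite -[ltRHS](lnK (d0 : d \is Num.pos)) ltr_expR gt_min; apply/orP; right.
  by rewrite ltrBlDr ltrDl.
pose g (w : C) := F (z0 + cexp w).
have dg w : complex.Re w <= b1 -> derivable g w 1.
  move=> wb; apply: (@derivable_compC (fun w => z0 + cexp w) F).
    by apply: derivableD; [exact: derivable_cst|exact: derivable_cexp].
  apply: dF; rewrite addrC addKr modulus_cexp expR_gt0 /=.
  apply: le_lt_trans m2; rewrite -[leRHS](lnK (rm0 : _ \is Num.pos)).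
  by rewrite ler_expR.
pose u0 x y := complex.Re (g (mkC x y)); pose v0 x y := complex.Im (g (mkC x y)).
(* truncating the first variable makes both functions continuous on the line *)
pose u x y := u0 (Num.min x b1) y; pose v x y := v0 (Num.min x b1) y.
have cr0 x y : x <= b1 -> cr_diff u0 v0 x y.
  by move=> xb; apply: cr_diff_derivable; apply: dg.
have cr x y : x < b1 -> cr_diff u v x y.
  move=> xb; have [A [B hAB]] := cr0 x y (ltW xb).
  exists A, B => k k0; have [dl dl0 hdl] := hAB _ k0.
  exists (Num.min dl (b1 - x)); first by rewrite lt_min dl0 subr_gt0.
  move=> x' y'; rewrite !lt_min => /andP[h1 h2] /andP[h3 _].
  have xb' : x' < b1.
    by have := le_lt_trans (ler_norm _) h2; rewrite ltrD2r.
  have ex : Num.min x b1 = x by rewrite min_l // ltW.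
  have ex' : Num.min x' b1 = x' by rewrite min_l // ltW.
  by rewrite /u /v ex ex'; exact: hdl.
have minb x : Num.min x b1 <= b1 by rewrite ge_min lexx orbT.
have cu x : continuous (u x).
  by move=> y; have [+ _] := cr_diff_continuous (cr0 (Num.min x b1) y (minb x)).
have cv y : continuous (v ^~ y).
  move=> x; have [_ c0] := cr_diff_continuous (cr0 (Num.min x b1) y (minb x)).
  apply: (@continuous_comp _ _ _ (fun x => Num.min x b1) (v0 ^~ y)) => //.
  by apply: continuous_min; [exact: cvg_id|exact: cvg_cst].
pose Pu x := prim (-1) (u x); pose Pv y := prim (a - 1) (v ^~ y).
have a1 : a - 1 < a by rewrite ltrBlDr ltrDl.
have dPu (x y : R) : 0 <= y -> is_derive y 1 (Pu x) (u x y).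
  by move=> y0; apply: is_derive_prim; [exact: cu|apply: lt_le_trans y0; rewrite oppr_lt0].
have dPv (x y : R) : a <= x -> is_derive x 1 (Pv y) (v x y).
  by move=> xa; apply: is_derive_prim; [exact: cv|apply: lt_le_trans xa].
have pi2 : 0 < 2 * pi :> R by rewrite mulr_gt0 // pi_gt0.
have abE : a + (b - a) = b by rewrite addrC subrK.
have := @rectangle_integral_eq0 R u v Pu Pv a 0 (b - a) (2 * pi).
rewrite abE add0r subr_ge0 => /(_ (ltW ab) (ltW pi2)).
have per x : v x (2 * pi) = v x 0.
  by rewrite /v /v0 /g /cexp /= mulr_natl cos2pi sin2pi cos0 sin0.
have PvE : Pv (2 * pi) = Pv 0.
  by rewrite /Pv; congr (prim _ _); apply/funext => x; exact: per.
move=> rect.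
have h1 : forall x y : R, a <= x <= b -> 0 <= y <= 2 * pi -> is_derive y 1 (Pu x) (u x y).
  by move=> x y _ /andP[y0 _]; exact: dPu.
have h2 : forall x y : R, a <= x <= b -> 0 <= y <= 2 * pi -> is_derive x 1 (Pv y) (v x y).
  by move=> x y /andP[xa _] _; exact: dPv.
have h3 : forall x y : R, a <= x <= b -> 0 <= y <= 2 * pi -> cr_diff u v x y.
  by move=> x y /andP[_ xb] _; apply: cr; apply: le_lt_trans bb1.
have := rect h1 h2 h3; rewrite PvE (subrr (Pv 0 b - Pv 0 a)) => /subr0_eq Iab {rect}.
have mvt (x : R) : exists2 c : R, True & Pu x (2 * pi) - Pu x 0 = u x c * (2 * pi).
  have dP (y : R) : 0 <= y <= 2 * pi -> is_derive y 1 (Pu x) (u x y).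
    by move=> /andP[y0 _]; exact: dPu.
  have [c _ ->] := mvt_closed (ltW pi2) dP.
  by rewrite subr0; exists c.
have [c1 _ Ib] := mvt b; have [c2 _ Ia] := mvt a.
have piN0 : 2 * pi != 0 :> R by rewrite gt_eqF.
have /(mulIf piN0) uE := etrans (esym Ib) (etrans Iab Ia).
have ub : u b c1 <= m.
  have eb : Num.min b b1 = b by apply: min_l; exact: ltW.
  rewrite /u /u0 eb; apply: hm; rewrite addrC addKr modulus_cexp.
  exact: lnK.
have ua : complex.Re (F z0) - u a c2 <= e.
  have ea : Num.min a b1 = a by apply: min_l; apply: ltW; exact: lt_trans bb1.
  rewrite /u /u0 ea.
  rewrite -ReN -ReD; apply: le_trans (ler_norm _) _; apply: le_trans (Re_le_modulus _) _.
  rewrite modulusC; apply: ltW; apply: hd; rewrite addrC addKr modulus_cexp.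
  exact: ad.
rewrite -lerBlDr; apply: le_trans ub; rewrite uE lerBlDr addrC -lerBlDr.
exact: ua.
Qed.

End MeanValue.

(** * The maximum principle and almost holomorphic functions *)

Section MaximumPrinciple.
Context {R : realType}.
Local Notation C := (Cplx R).
Local Notation D := (@unit_disc R).

Lemma dnbhsCP (z : C) (P : set C) : (\forall w \near z^', P w) <->
  exists2 d : R, 0 < d & forall w, 0 < modulus (w - z) < d -> P w.
Proof.
split=> [/nbhsCP [d d0 hd]|[d d0 hd]].
  exists d => // w /andP[h1 h2]; apply: hd => //.
  by move: h1; rewrite modulus_gt0 subr_eq0.
apply/nbhsCP; exists d => // w h1 h2; apply: hd.
by rewrite h1 modulus_gt0 subr_eq0 h2.
Qed.

Lemma modulus_lipschitz (z w : C) : `|modulus z - modulus w| <= modulus (z - w).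
Proof.
have h1 := modulus_ge_sub z w; have h2 := modulus_ge_sub w z.
rewrite ler_norml h1 andbT lerNl opprB modulusC; exact: h2.
Qed.

Lemma continuous_modulus : continuous (@modulus R : C -> R).
Proof.
move=> z P /nbhs_ballP [e e0 he]; apply/nbhsCP; exists e => // w hw; apply: he.
by apply: le_lt_trans (modulus_lipschitz _ _) _; rewrite modulusC.
Qed.

Definition cdisc (s : R) : set C := [set z | modulus z <= s].

Lemma compact_cdisc (s : R) : compact (cdisc s).
Proof.
pose sq : set (R * R) := `[- s, s] `*` `[- s, s].
have csq : compact sq by apply: compact_setX; exact: segment_compact.
pose f (p : R * R) : C := mkC p.1 p.2.
have cf : continuous f.
  move=> [x y] P /nbhsCP [e e0 he].
  have e2 : 0 < e / 2 by rewrite divr_gt0.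
  exists (ball x (e / 2), ball y (e / 2)).
    by split; apply: nbhsx_ballx.
  move=> [x' y'] /= [h1 h2]; apply: he; apply: le_lt_trans (modulus_le_ReIm _) _.
  by rewrite [e]splitr /= ltrD // distrC.
apply: (@subclosed_compact _ _ (f @` sq)).
- rewrite (_ : cdisc s = (@modulus R : C -> R) @^-1` [set x | x <= s]) //.
  by apply: closed_comp; [move=> z _; exact: continuous_modulus|exact: closed_le].
- by apply: continuous_compact => //; exact: continuous_subspaceT.
move=> z hz; exists (complex.Re z, complex.Im z); last by case: z hz.
split; rewrite /= in_itv /= -ler_norml.
  by apply: le_trans hz; exact: Re_le_modulus.
by apply: le_trans hz; exact: Im_le_modulus.
Qed.

Lemma modulus_sqr_expand (z z0 : C) : modulus z ^+ 2 =
  modulus z0 ^+ 2 + 2 * complex.Re (conjC z0 * (z - z0)) + modulus (z - z0) ^+ 2.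
Proof.
rewrite !modulus_sqr; case: z => a b; case: z0 => c d; rewrite !ReM /=; ring.
Qed.

Lemma derivable_sub (a z : C) : derivable (fun w : C => w - a) z 1.
Proof.
by apply/derivableCP; exists 1 => e e0; exists 1 => // w _;
  rewrite (_ : _ - _ - _ = 0) ?modulus0 ?mulr_ge0 ?modulus_ge0 ?ltW //; ring.
Qed.

(** At an interior maximum [z0] of [|f| + eta |z|^2], the mean value inequality
    for the real part of [c f + 2 eta conj z0 (z - z0)], with [c] unimodular and
    [c (f z0) = |f z0|], contradicts maximality by the amount [eta r^2]. *)
Lemma max_principle (f : C -> C) (s M : R) : 0 < s ->
  (forall z, modulus z <= s -> {for z, continuous f}) ->
  (forall z, modulus z < s -> \forall w \near z^', derivable f w 1) ->
  (forall z, modulus z = s -> modulus (f z) <= M) ->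
  forall z, modulus z <= s -> modulus (f z) <= M.
Proof.
move=> s0 cf df hM z1 hz1; rewrite leNgt; apply/negP => hlt.
have M0 : 0 <= M.
  apply: le_trans (modulus_ge0 _) (hM (ofR s) _).
  by rewrite modulus_ofR ger0_norm // ltW.
pose eta := (modulus (f z1) - M) / (2 * s ^+ 2).
have s2 : 0 < s ^+ 2 by rewrite exprn_gt0.
have eta0 : 0 < eta by rewrite divr_gt0 ?subr_gt0 // mulr_gt0.
have etaE : M + eta * s ^+ 2 < modulus (f z1).
  have -> : eta * s ^+ 2 = (modulus (f z1) - M) / 2.
    by rewrite /eta; field; rewrite gt_eqF.
  rewrite addrC -ltrBrDr ltr_pdivrMr // mulr_natr mulr2n ltrDl subr_gt0 //.
pose v (z : C) : R := modulus (f z) + eta * modulus z ^+ 2.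
have cv : {within cdisc s, continuous v}.
  apply: continuous_in_subspaceT => z; rewrite inE => hz.
  have cm := @continuous_modulus z.
  have c1 : {for z, continuous (fun z => modulus (f z))}.
    exact: (@continuous_comp _ _ _ f (@modulus R) z (cf z hz) (@continuous_modulus _)).
  have c2 : {for z, continuous (fun z : C => modulus z ^+ 2)}.
    exact: (@continuous_comp _ _ _ (@modulus R) (fun x : R => x ^+ 2) z cm (@exprn_continuous _ 2 _)).
  have c3 : {for z, continuous (fun z : C => eta * modulus z ^+ 2)}.
    exact: (@continuousM _ _ (fun=> eta) (fun z : C => modulus z ^+ 2) z (@cst_continuous _ _ eta z) c2).
  exact: (continuousD c1 c3).
have ne : cdisc s !=set0 by exists z1.
have [z0 + hmax] := compact_EVT_max ne (@compact_cdisc s) cv.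
rewrite inE /cdisc /= => hz0.
have vz z : modulus z <= s -> v z <= v z0 by move=> hz; apply: hmax; rewrite inE.
have fz0 : M + eta * s ^+ 2 < v z0.
  apply: lt_le_trans etaE (le_trans _ (vz _ hz1)).
  by rewrite lerDl mulr_ge0 ?sqr_ge0 // ltW.
have z0s : modulus z0 < s.
  rewrite lt_neqAle hz0 andbT; apply/eqP => zs; move: fz0.
  by rewrite /v zs ltrD2r ltNge hM.
have M1 : M < modulus (f z0).
  have : eta * modulus z0 ^+ 2 <= eta * s ^+ 2.
    by rewrite ler_pM2l // lerXn2r ?nnegrE ?modulus_ge0 // ltW.
  move: fz0; rewrite /v; clear; lra.
have F0 : 0 < modulus (f z0) by apply: le_lt_trans M1.
have /dnbhsCP [d d0 hd] := df _ z0s.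
pose r1 := Num.min d (s - modulus z0); pose r := r1 / 2.
have r10 : 0 < r1 by rewrite lt_min d0 subr_gt0.
have r0 : 0 < r by rewrite divr_gt0.
have rr1 : r < r1 by rewrite ltr_pdivrMr // mulr_natr mulr2n ltrDl.
pose c : C := conjC (f z0) / ofR (modulus (f z0)).
have c1 : modulus c = 1.
  by rewrite modulus_div modulus_conj modulus_ofR ger0_norm ?modulus_ge0 // divff // gt_eqF.
have cz0 : c * f z0 = ofR (modulus (f z0)).
  rewrite /c mulrAC [_ * f z0]mulrC mul_conj -ofRV -ofRM; congr ofR.
  by rewrite expr2 mulfK // gt_eqF.
pose F (z : C) : C := c * f z + ofR (2 * eta) * conjC z0 * (z - z0).
have dF z : 0 < modulus (z - z0) < r1 -> derivable F z 1.
  move=> /andP[h1]; rewrite lt_min => /andP[h2 h3].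
  have dfz : derivable f z 1 by apply: hd; rewrite h1.
  have d1 := derivableM (derivable_cst c z 1) dfz.
  have d2 := @derivable_sub z0 z.
  have d3 := derivableM (derivable_cst (ofR (2 * eta) * conjC z0) z 1) d2.
  exact: (derivableD d1 d3).
have cF : {for z0, continuous F}.
  have cfz : {for z0, continuous f} := cf _ (ltW z0s).
  have d1 := continuousM (@cst_continuous _ _ c z0) cfz.
  have d2 := derivable_continuousC (@derivable_sub z0 z0).
  have d3 := continuousM (@cst_continuous _ _ (ofR (2 * eta) * conjC z0) z0) d2.
  exact: (continuousD d1 d3).
have := @mean_value_le R F z0 r r1 (modulus (f z0) - eta * r ^+ 2).
rewrite r0 rr1 => /(_ isT dF cF).
have Fz0 : complex.Re (F z0) = modulus (f z0).
  by rewrite /F subrr mulr0 addr0 cz0.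
rewrite Fz0 => hh; have : modulus (f z0) <= modulus (f z0) - eta * r ^+ 2.
  apply: hh => z zr.
  have zs : modulus z <= s.
    have : r < s - modulus z0 by apply: lt_le_trans rr1 _; rewrite ge_min lexx orbT.
    have := modulus_ge_sub z z0; rewrite zr; clear; lra.
  have e1 : complex.Re (c * f z) <= modulus (f z).
    apply: le_trans (ler_norm _) _; apply: le_trans (Re_le_modulus _) _.
    by rewrite modulusM c1 mul1r.
  have e2 : complex.Re (ofR (2 * eta) * conjC z0 * (z - z0)) =
     eta * (2 * complex.Re (conjC z0 * (z - z0))).
    by rewrite -mulrA ReM /= mul0r subr0; ring.
  have e3 := modulus_sqr_expand z z0; rewrite zr in e3.
  have := vz _ zs; rewrite /v e3 /F ReD e2.
  move: e1; clear; move: (complex.Re _) (complex.Re _) => a b; lra.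
rewrite lerBrDr gerDl leNgt mulr_gt0 // exprn_gt0 //.
Qed.

(** Continuous on the unit disc and holomorphic off a discrete subset of it; the
    class is stable under division by [z - a] when the numerator vanishes and is
    differentiable at [a], and the maximum principle holds in it. *)
Inductive ahol (f : C -> C) : Prop := Ahol of (forall z, D z ->
  {for z, continuous f} /\ \forall w \near z^', derivable f w 1).

Inductive hol (f : C -> C) : Prop := Hol of (forall z, D z -> derivable f z 1).

Lemma aholP f z : ahol f -> D z ->
  {for z, continuous f} /\ \forall w \near z^', derivable f w 1.
Proof. by move=> [+ Dz]; exact. Qed.

Lemma holP f z : hol f -> D z -> derivable f z 1.
Proof. by move=> [+ Dz]; exact. Qed.

Lemma disc_near (z : C) : D z -> \forall w \near z, D w.
Proof.
move=> Dz; apply/nbhsCP; exists (1 - modulus z); first by rewrite subr_gt0.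
move=> w hw; rewrite /unit_disc /=.
have := modulus_ge_sub w z; move: hw; clear; lra.
Qed.

Lemma disc_dnear (z : C) : D z -> \forall w \near z^', D w.
Proof. by move=> /disc_near; apply: cvg_within. Qed.

Lemma hol_ahol f : hol f -> ahol f.
Proof.
move=> hf; split=> z Dz; split; first exact: (derivable_continuousC (holP hf Dz)).
by apply: filterS (disc_dnear Dz) => w /(holP hf).
Qed.

Lemma hol_cst (c : C) : hol (fun=> c).
Proof. by split=> z _; exact: derivable_cst. Qed.

Lemma hol_id : hol id.
Proof. by split=> z _; exact: derivable_id. Qed.

Lemma holD f g : hol f -> hol g -> hol (fun z => f z + g z).
Proof. by move=> hf hg; split=> z Dz; exact: (derivableD (holP hf Dz) (holP hg Dz)). Qed.

Lemma holM f g : hol f -> hol g -> hol (fun z => f z * g z).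
Proof. by move=> hf hg; split=> z Dz; exact: (derivableM (holP hf Dz) (holP hg Dz)). Qed.

Lemma holN f : hol f -> hol (fun z => - f z).
Proof. by move=> hf; split=> z Dz; exact: (derivableN (holP hf Dz)). Qed.

Lemma holB f g : hol f -> hol g -> hol (fun z => f z - g z).
Proof. by move=> hf hg; exact: (holD hf (holN hg)). Qed.

Lemma holV f : hol f -> (forall z, D z -> f z != 0) -> hol (fun z => (f z)^-1).
Proof. by move=> hf f0; split=> z Dz; exact: (derivableV (f0 z Dz) (holP hf Dz)). Qed.

Lemma ahol_cst (c : C) : ahol (fun=> c).
Proof. exact/hol_ahol/hol_cst. Qed.

Lemma aholD f g : ahol f -> ahol g -> ahol (fun z => f z + g z).
Proof.
move=> hf hg; split=> z Dz; have [cf df] := aholP hf Dz; have [cg dg] := aholP hg Dz.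
split; first exact: (continuousD cf cg).
by apply: filterS2 df dg => w d1 d2; exact: (derivableD d1 d2).
Qed.

Lemma aholM f g : ahol f -> ahol g -> ahol (fun z => f z * g z).
Proof.
move=> hf hg; split=> z Dz; have [cf df] := aholP hf Dz; have [cg dg] := aholP hg Dz.
split; first exact: (continuousM cf cg).
by apply: filterS2 df dg => w d1 d2; exact: (derivableM d1 d2).
Qed.

(** The difference quotient at [a], with the derivative as its value at [a]. *)
Lemma ahol_quotient (f : C -> C) (a : C) : D a -> ahol f -> derivable f a 1 ->
  exists2 h, ahol h & (forall z, f z = f a + (z - a) * h z) /\
    (forall z, z != a -> derivable f z 1 -> derivable h z 1).
Proof.
move=> Da hf /derivableCP [l hl].
pose h z := if z == a then l else (f z - f a) / (z - a).
have near_ne z : z != a -> \forall w \near z, h w = (f w - f a) / (w - a).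
  move=> za; apply/nbhsCP; exists (modulus (z - a)); first by rewrite modulus_gt0 subr_eq0.
  move=> w hw; rewrite /h ifN //; apply: contraTneq hw => ->.
  by rewrite modulusC ltxx.
have dh z : z != a -> derivable f z 1 -> derivable h z 1.
  move=> za dfz; apply: (@near_eq_derivable _ _ _ (fun w => (f w - f a) / (w - a))).
    by apply: filterS (near_ne z za) => w ->.
  have za0 : z - a != 0 by rewrite subr_eq0.
  have d1 := derivableB dfz (derivable_cst (f a) z 1).
  have d2 := @derivable_sub a z.
  exact: (derivableM d1 (@derivableV _ _ (fun w : C => w - a) z 1 za0 d2)).
exists h; last first.
  split=> // z; rewrite /h; case: eqVneq => [->|za]; first by rewrite subrr mul0r addr0.
  by rewrite mulrC divfK ?subr_eq0 // addrC subrK.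
split=> z Dz; have [cf df] := aholP hf Dz; split.
  have [->|za] := eqVneq z a.
    apply/continuousCP => e e0.
    have [d d0 hd] := hl (e / 2) (divr_gt0 e0 (ltr0Sn _ 1)); exists d => // w hw.
    rewrite /h eqxx; case: eqVneq => [_|wa]; first by rewrite subrr modulus0.
    have wa0 : w - a != 0 by rewrite subr_eq0.
    have -> : (f w - f a) / (w - a) - l = (f w - f a - l * (w - a)) / (w - a).
      by rewrite [RHS]mulrBl mulfK.
    rewrite modulus_div ltr_pdivrMr ?modulus_gt0 //.
    apply: le_lt_trans (hd _ hw) _; rewrite ltr_pM2r ?modulus_gt0 //.
    by rewrite ltr_pdivrMr // mulr_natr mulr2n ltrDl.
  have hzE : (f z - f a) / (z - a) = h z by have := nbhs_singleton (near_ne z za).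
  have cq : (fun w => (f w - f a) / (w - a)) @ z --> h z.
    have za0 : z - a != 0 by rewrite subr_eq0.
    have d1 := continuousB cf (@cst_continuous _ _ (f a) z).
    have d2 := derivable_continuousC (@derivable_sub a z).
    by rewrite -hzE; exact: (continuousM d1 (@continuousV _ _ (fun w : C => w - a) z za0 d2)).
  move=> P hP; have : nbhs z ([set w | h w = (f w - f a) / (w - a)] `&`
      (fun w => (f w - f a) / (w - a)) @^-1` P).
    by apply: filterI; [exact: near_ne|exact: cq].
  by apply: (@filterS _ (nbhs z)) => w [/= -> hw].
have ne : \forall w \near z^', w != a.
  have [->|za] := eqVneq z a; first exact: nbhs_dnbhs_neq.
  apply: cvg_within; apply/nbhsCP; exists (modulus (z - a)).
    by rewrite modulus_gt0 subr_eq0.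
  by move=> w; apply: contraTneq => ->; rewrite modulusC ltxx.
by apply: filterS2 df ne => w dfw wa; exact: dh.
Qed.

(** The maximum principle for bounds that hold asymptotically at the boundary. *)
Lemma ahol_bound (f : C -> C) (M : R) : ahol f ->
  (forall e : R, 0 < e -> exists2 s0 : R, s0 < 1 &
     forall z, s0 < modulus z < 1 -> modulus (f z) <= M + e) ->
  forall z, D z -> modulus (f z) <= M.
Proof.
move=> hf hM z Dz; apply/ler_addgt0Pr => e e0; have [s0 s01 hs] := hM _ e0.
pose m := Num.max s0 (modulus z).
have m1 : m < 1 by rewrite gt_max s01.
pose s := (m + 1) / 2.
have ms : m < s by rewrite /s ltr_pdivlMr // mulr_natr mulr2n ltrD2l.
have s1 : s < 1 by rewrite /s ltr_pdivrMr // mul1r ltrD2r.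
have [s0s zs] : s0 < s /\ modulus z < s by move: ms; rewrite gt_max => /andP[].
have sp : 0 < s by apply: le_lt_trans zs; exact: modulus_ge0.
apply: (@max_principle f s _ sp _ _ _ z (ltW zs)).
- by move=> w hw; have [] := aholP hf (le_lt_trans hw s1).
- by move=> w hw; have [] := aholP hf (lt_trans hw s1).
by move=> w hw; apply: hs; rewrite hw s0s.
Qed.

(** The quotient of [f] by [z] is at most [M / s] on the circle of radius [s]. *)
Lemma schwarz (f : C -> C) (M : R) : ahol f -> derivable f 0 1 -> f 0 = 0 -> 0 <= M ->
  (forall z, D z -> modulus (f z) <= M) ->
  forall z, D z -> modulus (f z) <= M * modulus z.
Proof.
move=> hf df f0 M0 hM z Dz.
have D0 : D 0 by rewrite /unit_disc /= modulus0.
have [h hh [hE _]] := ahol_quotient D0 hf df.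
have {}hE w : f w = w * h w by rewrite hE f0 add0r subr0.
suff hb : modulus (h z) <= M by rewrite hE modulusM mulrC ler_wpM2r ?modulus_ge0.
apply: ahol_bound hh _ z Dz => e e0.
have q0 : 0 < M + e by rewrite ltr_wpDl.
exists (M / (M + e)); first by rewrite ltr_pdivrMr // mul1r ltrDl.
move=> w /andP[w1 w2]; have := hM w w2; rewrite hE modulusM => hw.
have wpos : 0 < modulus w by apply: le_lt_trans w1; rewrite divr_ge0 // ltW.
rewrite -(ler_pM2l wpos); apply: le_trans hw _.
by move: w1; rewrite ltr_pdivrMr // => /ltW.
Qed.

End MaximumPrinciple.

(** * Matrix-valued functions *)

(** Determinants, traces and products of matrices are polynomials in the entries,
    so they preserve every class of scalar functions that is a ring containing
    the constants. *)
Section FunctionRings.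
Context {L : comNzRingType} {T : Type}.

Definition fun_ring (K : (T -> L) -> Prop) : Prop :=
  [/\ forall c, K (fun=> c),
      forall f g, K f -> K g -> K (fun t => f t + g t) &
      forall f g, K f -> K g -> K (fun t => f t * g t)].

Definition mxK (K : (T -> L) -> Prop) m n (M : T -> 'M[L]_(m, n)) : Prop :=
  forall i j, K (fun t => M t i j).

Variables (K : (T -> L) -> Prop) (Kr : fun_ring K).

Lemma fr_ext (f g : T -> L) : f =1 g -> K f -> K g.
Proof. by move=> /funext->. Qed.

Lemma fr_sum (I : Type) (r : seq I) (P : pred I) (F : I -> T -> L) :
  (forall i, P i -> K (F i)) -> K (fun t => \sum_(i <- r | P i) F i t).
Proof.
case: Kr => Kc Kd Km hF; elim: r => [|i r ih].
  by apply: (fr_ext _ (Kc 0)) => t; rewrite big_nil.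
case Pi : (P i); last by apply: (fr_ext _ ih) => t; rewrite big_cons Pi.
by apply: (fr_ext _ (Kd _ _ (hF i Pi) ih)) => t; rewrite big_cons Pi.
Qed.

Lemma fr_prod (I : Type) (r : seq I) (P : pred I) (F : I -> T -> L) :
  (forall i, P i -> K (F i)) -> K (fun t => \prod_(i <- r | P i) F i t).
Proof.
case: Kr => Kc Kd Km hF; elim: r => [|i r ih].
  by apply: (fr_ext _ (Kc 1)) => t; rewrite big_nil.
case Pi : (P i); last by apply: (fr_ext _ ih) => t; rewrite big_cons Pi.
by apply: (fr_ext _ (Km _ _ (hF i Pi) ih)) => t; rewrite big_cons Pi.
Qed.

Lemma fr_cst c : K (fun=> c). Proof. by case: Kr. Qed.
Lemma fr_add f g : K f -> K g -> K (fun t => f t + g t). Proof. by case: Kr => _ + _; apply. Qed.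
Lemma fr_mul f g : K f -> K g -> K (fun t => f t * g t). Proof. by case: Kr => _ _; apply. Qed.

Lemma fr_opp f : K f -> K (fun t => - f t).
Proof. by move=> hf; apply: (fr_ext _ (fr_mul (fr_cst (-1)) hf)) => t; rewrite mulN1r. Qed.

Lemma fr_sub f g : K f -> K g -> K (fun t => f t - g t).
Proof. by move=> hf hg; exact: (fr_add hf (fr_opp hg)). Qed.

Lemma fr_exp f k : K f -> K (fun t => f t ^+ k).
Proof.
move=> hf; elim: k => [|k ih]; first by apply: (fr_ext _ (fr_cst 1)) => t; rewrite expr0.
by apply: (fr_ext _ (fr_mul hf ih)) => t; rewrite exprS.
Qed.

Lemma mxK_ext m n (M N : T -> 'M[L]_(m, n)) : M =1 N -> mxK K M -> mxK K N.
Proof. by move=> /funext->. Qed.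

Lemma mxK_cst m n (M : 'M[L]_(m, n)) : mxK K (fun=> M).
Proof. by move=> i j; exact: fr_cst. Qed.

Lemma mxK_add m n (M N : T -> 'M[L]_(m, n)) :
  mxK K M -> mxK K N -> mxK K (fun t => M t + N t).
Proof. by move=> hM hN i j; apply: (fr_ext _ (fr_add (hM i j) (hN i j))) => t; rewrite mxE. Qed.

Lemma mxK_opp m n (M : T -> 'M[L]_(m, n)) : mxK K M -> mxK K (fun t => - M t).
Proof. by move=> hM i j; apply: (fr_ext _ (fr_opp (hM i j))) => t; rewrite mxE. Qed.

Lemma mxK_sub m n (M N : T -> 'M[L]_(m, n)) :
  mxK K M -> mxK K N -> mxK K (fun t => M t - N t).
Proof. by move=> hM hN; exact: (mxK_add hM (mxK_opp hN)). Qed.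

Lemma mxK_scale m n (f : T -> L) (M : T -> 'M[L]_(m, n)) :
  K f -> mxK K M -> mxK K (fun t => f t *: M t).
Proof. by move=> hf hM i j; apply: (fr_ext _ (fr_mul hf (hM i j))) => t; rewrite mxE. Qed.

Lemma mxK_mul m n p (M : T -> 'M[L]_(m, n)) (N : T -> 'M[L]_(n, p)) :
  mxK K M -> mxK K N -> mxK K (fun t => M t *m N t).
Proof.
move=> hM hN i k.
have h : K (fun t => \sum_j M t i j * N t j k).
  by apply: (@fr_sum 'I_n _ xpredT (fun j t => M t i j * N t j k)) => j _; exact: fr_mul.
by apply: (fr_ext _ h) => t; rewrite mxE.
Qed.

Lemma mxK_exp n (M : T -> 'M[L]_n) k : mxK K M -> mxK K (fun t => M t ^+ k).
Proof.
move=> hM; elim: k => [|k ih].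
  by apply: (mxK_ext _ (mxK_cst (1%:M : 'M[L]_n))) => t; rewrite expr0.
by apply: (mxK_ext _ (mxK_mul hM ih)) => t; rewrite exprS.
Qed.

Lemma fr_tr n (M : T -> 'M[L]_n) : mxK K M -> K (fun t => \tr (M t)).
Proof. by move=> hM; apply: fr_sum => i _; exact: hM. Qed.

Lemma fr_det n (M : T -> 'M[L]_n) : mxK K M -> K (fun t => \det (M t)).
Proof.
move=> hM; apply: fr_sum => s _; apply: fr_mul; first exact: fr_cst.
by apply: fr_prod => i _; exact: hM.
Qed.

Lemma mxK_adj n (M : T -> 'M[L]_n) : mxK K M -> mxK K (fun t => \adj (M t)).
Proof.
move=> hM i j; apply: (fr_ext (f := fun t => cofactor (M t) j i)); first by move=> t; rewrite mxE.
apply: fr_mul; first exact: fr_cst.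
apply: fr_det => k l; apply: (fr_ext (f := fun t => M t (lift j k) (lift i l))) => // t.
by rewrite !mxE.
Qed.

End FunctionRings.

Definition polyK {L : comNzRingType} {T : Type} (K : (T -> L) -> Prop)
  (p : T -> {poly L}) : Prop := forall k, K (fun t => (p t)`_k).

Lemma poly_ring (L : comNzRingType) (T : Type) (K : (T -> L) -> Prop) :
  fun_ring K -> fun_ring (polyK K).
Proof.
move=> Kr; split=> [c k|f g hf hg k|f g hf hg k]; first exact: fr_cst.
  by apply: (fr_ext _ (fr_add Kr (hf k) (hg k))) => t; rewrite coefD.
have h : K (fun t => \sum_(j < k.+1) (f t)`_j * (g t)`_(k - j)).
  apply: (@fr_sum _ _ _ Kr 'I_k.+1 _ xpredT (fun (j : 'I_k.+1) t => (f t)`_j * (g t)`_(k - j))).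
  by move=> j _; apply: fr_mul.
by apply: (fr_ext _ h) => t; rewrite coefM.
Qed.

Lemma polyK_char_poly (L : comNzRingType) (T : Type) (K : (T -> L) -> Prop) n
    (M : T -> 'M[L]_n) : fun_ring K -> mxK K M -> polyK K (fun t => char_poly (M t)).
Proof.
move=> Kr hM; apply: (fr_det (poly_ring Kr)) => i j k.
apply: (fr_ext (f := fun t => ('X *+ (i == j))`_k - (M t i j)%:P`_k)).
  by move=> t; rewrite !mxE coefB.
apply: (fr_sub Kr); first exact: fr_cst.
apply: (fr_ext (f := fun t => if k == 0%N then M t i j else 0)).
  by move=> t; rewrite coefC.
by case: (k == 0%N); [exact: hM|exact: fr_cst].
Qed.

Section MatrixFunctions.
Context {R : realType}.
Local Notation C := (Cplx R).
Local Notation D := (@unit_disc R).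

Lemma hol_ring : fun_ring (@hol R).
Proof.
by split; [exact: hol_cst|move=> f g hf hg; exact: holD|move=> f g hf hg; exact: holM].
Qed.

Lemma ahol_ring : fun_ring (@ahol R).
Proof.
by split; [exact: ahol_cst|move=> f g hf hg; exact: aholD|move=> f g hf hg; exact: aholM].
Qed.

Lemma invmx_adj n (A : 'M[C]_n) : A \in unitmx -> invmx A = (\det A)^-1 *: \adj A.
Proof. by move=> uA; rewrite /invmx uA. Qed.

Lemma hol_invmx n (M : C -> 'M[C]_n) : mxK (@hol R) M ->
  (forall z, D z -> M z \in unitmx) ->
  exists2 N, mxK (@hol R) N & forall z, D z -> N z = invmx (M z).
Proof.
move=> hM uM; exists (fun z => (\det (M z))^-1 *: \adj (M z)).
  apply: mxK_scale; [exact: hol_ring| |apply: mxK_adj hM; exact: hol_ring].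
  apply: holV; first by apply: fr_det hM; exact: hol_ring.
  by move=> z /uM; rewrite unitmxE unitfE.
by move=> z /uM /invmx_adj ->.
Qed.

Lemma nbhsMP m n (A : 'M[C]_(m, n)) (P : set 'M[C]_(m, n)) : nbhs A P <->
  exists2 e : R, 0 < e & forall B : 'M[C]_(m, n), (forall i j, modulus (B i j - A i j) < e) -> P B.
Proof.
split=> [[Q hQ QP]|[e e0 he]]; last first.
  exists (fun i j => [set z | modulus (z - A i j) < e]).
    by move=> i j; apply/nbhsCP; exists e.
  by move=> B hB; apply: he => i j; exact: hB.
have /choice [e he] (ij : 'I_m * 'I_n) : exists e : R, 0 < e /\
    forall w, modulus (w - A ij.1 ij.2) < e -> Q ij.1 ij.2 w.
  by have /nbhsCP [e e0 he] := hQ ij.1 ij.2; exists e.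
exists (\big[Num.min/1]_ij e ij).
  by apply: lt_bigmin => // ij _; case: (he ij).
move=> B hB; apply: QP => i j; have [_] := he (i, j); apply.
by apply: lt_le_trans (hB i j) _; rewrite (bigmin_le_cond _ _ (_ : xpredT (i, j))).
Qed.

Lemma derivable_mxCP m n (M : C -> 'M[C]_(m, n)) (z : C) :
  derivable M z 1 <-> forall i j, derivable (fun w => M w i j) z 1.
Proof.
split=> [/cvg_ex [l hl] i j|h].
  apply/cvg_ex; exists (l i j) => P hP.
  have : nbhs l [set B | P (B i j)] by exact: coord_continuous.
  by move=> /hl h1; apply: (@filterS _ (0 : C)^' _ _ _ _ h1) => h /=; rewrite !mxE.
have /choice [l hl] (ij : 'I_m * 'I_n) :
    exists l : C, h^-1 *: (((fun w => M w ij.1 ij.2) \o shift z) (h *: (1 : C)) - M z ij.1 ij.2)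
       @[h --> (0 : C)^'] --> l.
  by have /cvg_ex := h ij.1 ij.2.
apply/cvg_ex; exists (\matrix_(i, j) l (i, j)) => P [Q hQ QP].
have h1 : \forall h \near (0 : C)^', forall ij : 'I_m * 'I_n, Q ij.1 ij.2
    (h^-1 *: (((fun w => M w ij.1 ij.2) \o shift z) (h *: (1 : C)) - M z ij.1 ij.2)).
  apply: filter_forall => -[i j]; have := hQ i j; rewrite mxE => /hl.
  exact.
by apply: (@filterS _ (0 : C)^' _ _ _ _ h1) => h0 hh; apply: QP => i j; have := hh (i, j); rewrite /= !mxE.
Qed.

Lemma holomorphic_discE n (S : set 'M[C]_n) (f : C -> 'M[C]_n) :
  holomorphic_disc S f <-> mxK (@hol R) f /\ forall z, D z -> S (f z).
Proof.
split=> [[h1 h2]|[h1 h2]]; split=> //.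
  by move=> i j; split=> z Dz; have /derivable_mxCP := h1 z Dz; apply.
by move=> z Dz; apply/derivable_mxCP => i j; have := h1 i j => /holP; apply.
Qed.

End MatrixFunctions.

(** * Eigenvalues and the spectral ball *)

Section Eigenvalues.
Context {R : realType}.
Local Notation C := (Cplx R).
Local Notation D := (@unit_disc R).

Lemma eigP n (A : 'M[C]_n) z : \det (z%:M - A) = 0 <->
  exists2 v : 'rV[C]_n, v != 0 & v *m A = z *: v.
Proof.
split=> [/eqP/det0P [v v0]|[v v0 hv]].
  by rewrite mulmxBr mul_mx_scalar => /subr0_eq hv; exists v.
by apply/eqP/det0P; exists v => //; rewrite mulmxBr mul_mx_scalar hv subrr.
Qed.

Lemma trigonalize n (A : 'M[C]_n) : exists P U : 'M[C]_n,
  [/\ P \in unitmx, is_trig_mx U & P *m A = U *m P].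
Proof.
case: n A => [|n] A.
  by exists 1%:M, A; rewrite unitmx1 mul1mx mulmx1 flatmx0; split=> //; apply/is_trig_mxP => -[].
have [P uP] := Schur A isT; have Pu := unitarymx_unit uP.
rewrite /similar_to /= => ht; exists P, (conjmx P A); split=> //.
by rewrite conjumx // mulmxKV.
Qed.

Lemma det_similar n (P A B : 'M[C]_n) z : P \in unitmx -> P *m A = B *m P ->
  \det (z%:M - A) = \det (z%:M - B).
Proof.
move=> Pu PA; have P0 : \det P != 0 by rewrite -unitfE -unitmxE.
apply: (mulfI P0); rewrite -det_mulmx mulmxBr PA mul_mx_scalar -mul_scalar_mx.
by rewrite -mulmxBl det_mulmx mulrC.
Qed.

Lemma det_trig_sub n (U : 'M[C]_n) z : is_trig_mx U ->
  \det (z%:M - U) = \prod_i (z - U i i).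
Proof.
move=> /is_trig_mxP tU; rewrite det_trig; last first.
  apply/is_trig_mxP => i j ij; rewrite !mxE tU // subr0.
  by rewrite -val_eqE /= ltn_eqF.
by apply: eq_bigr => i _; rewrite !mxE eqxx.
Qed.

Lemma eig_trig n (U : 'M[C]_n) z : is_trig_mx U ->
  \det (z%:M - U) = 0 <-> exists i, z = U i i.
Proof.
move=> tU; rewrite det_trig_sub //; split=> [/eqP|[i ->]].
  by rewrite prodf_seq_eq0 => /hasP [i _ /=]; rewrite subr_eq0 => /eqP ->; exists i.
by apply/eqP; rewrite prodf_seq_eq0; apply/hasP; exists i; rewrite ?mem_index_enum //= subrr.
Qed.

Lemma eig_factor n (A : 'M[C]_n) : exists d : 'I_n -> C,
  forall z, \det (z%:M - A) = \prod_i (z - d i).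
Proof.
have [P [U [Pu tU PA]]] := trigonalize A.
by exists (fun i => U i i) => z; rewrite (det_similar z Pu PA) det_trig_sub.
Qed.

Lemma eig_factorP n (A : 'M[C]_n) (d : 'I_n -> C) z :
  (forall z, \det (z%:M - A) = \prod_i (z - d i)) ->
  \det (z%:M - A) = 0 <-> exists i, z = d i.
Proof.
move=> ->; split=> [/eqP|[i ->]].
  by rewrite prodf_seq_eq0 => /hasP [i _ /=]; rewrite subr_eq0 => /eqP ->; exists i.
by apply/eqP; rewrite prodf_seq_eq0; apply/hasP; exists i; rewrite ?mem_index_enum //= subrr.
Qed.

Lemma spectral_radiusP n (A : 'M[C]_n) : (0 < n)%N ->
  (exists2 z, \det (z%:M - A) = 0 & modulus z = spectral_radius A) /\
  (forall z, \det (z%:M - A) = 0 -> modulus z <= spectral_radius A).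
Proof.
move=> n0; have [d hd] := eig_factor A.
pose i0 := Ordinal n0.
pose E : set R := [set modulus z | z in [set z : C | \det (z%:M - A) = 0]].
have [i hi] : exists i, forall j, modulus (d j) <= modulus (d i).
  exists [arg max_(i > i0) modulus (d i)]%O => j.
  by case: Order.TotalTheory.arg_maxP => //= i _; apply.
have Ed z : \det (z%:M - A) = 0 -> modulus z <= modulus (d i).
  by move=> /(eig_factorP _ hd) [j ->].
have di : \det ((d i)%:M - A) = 0 by apply/(eig_factorP _ hd); exists i.
have Es : spectral_radius A = modulus (d i).
  apply/eqP; rewrite eq_le; apply/andP; split.
    by apply: ge_sup; [exists (modulus (d i)), (d i)|move=> _ [z /Ed hz <-]].
  by apply: ub_le_sup; [exists (modulus (d i)) => _ [z /Ed hz <-]|exists (d i)].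
by rewrite Es; split; [exists (d i)|].
Qed.

Lemma ballP n (A : 'M[C]_n) : (0 < n)%N -> spectral_ball R n A <->
  forall z, \det (z%:M - A) = 0 -> modulus z < 1.
Proof.
move=> n0; have [[z0 h1 h2] h3] := spectral_radiusP A n0; split.
  by move=> hA z /h3 /le_lt_trans; apply.
by rewrite /spectral_ball /= -h2; apply.
Qed.

Lemma ball_row n (A : 'M[C]_n) : (0 < n)%N -> spectral_ball R n A <->
  forall z (v : 'rV[C]_n), v != 0 -> v *m A = z *: v -> modulus z < 1.
Proof.
move=> n0; rewrite ballP //; split=> h z.
  by move=> v v0 hv; apply: h; apply/eigP; exists v.
by move=> /eigP [v v0 hv]; exact: h hv.
Qed.

Lemma ball_similar n (P A B : 'M[C]_n) : (0 < n)%N -> P \in unitmx ->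
  P *m A = B *m P -> spectral_ball R n A <-> spectral_ball R n B.
Proof.
by move=> n0 Pu PA; rewrite !ballP //; split=> h z; move: (h z);
  rewrite (det_similar z Pu PA).
Qed.

Lemma ball_trig n (U : 'M[C]_n) : (0 < n)%N -> is_trig_mx U ->
  (forall i, modulus (U i i) < 1) -> spectral_ball R n U.
Proof. by move=> n0 tU h; apply/ballP => // z /(eig_trig _ tU) [i ->]. Qed.

Lemma trig_mul n (U V : 'M[C]_n) : is_trig_mx U -> is_trig_mx V ->
  is_trig_mx (U *m V) /\ forall i, (U *m V) i i = U i i * V i i.
Proof.
move=> /is_trig_mxP tU /is_trig_mxP tV; split.
  apply/is_trig_mxP => i j ij; rewrite mxE big1 // => k _.
  have [ik|ki] := ltnP i k; first by rewrite tU // mul0r.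
  by rewrite tV ?mulr0 //; apply: leq_ltn_trans ij.
move=> i; rewrite mxE (bigD1 i) //= big1 ?addr0 // => k ki.
have [ik|ik|/val_inj ik] := ltngtP i k; first by rewrite tU // mul0r.
  by rewrite tV // mulr0.
by rewrite ik eqxx in ki.
Qed.

Lemma trig_exp n (U : 'M[C]_n) k : is_trig_mx U ->
  is_trig_mx (U ^+ k) /\ forall i, (U ^+ k) i i = (U i i) ^+ k.
Proof.
move=> tU; elim: k => [|k [t1 h1]].
  split; last by move=> i; rewrite !expr0 mxE eqxx.
  by apply/is_trig_mxP => i j ij; rewrite expr0 mxE -val_eqE /= ltn_eqF.
have [t2 h2] := trig_mul tU t1; rewrite exprS; split=> // i.
by rewrite [LHS]h2 h1 exprS.
Qed.

Lemma similar_exp n (P A B : 'M[C]_n) k : P *m A = B *m P ->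
  P *m A ^+ k = B ^+ k *m P.
Proof.
move=> PA; elim: k => [|k ih]; first by rewrite !expr0 mulmx1 mul1mx.
by rewrite !exprS mulmxA PA -mulmxA ih mulmxA.
Qed.

Lemma tr_similar n (P A B : 'M[C]_n) : P \in unitmx -> P *m A = B *m P ->
  \tr A = \tr B.
Proof.
by move=> Pu PA; rewrite -[A](mulKmx Pu) PA mxtrace_mulC -mulmxA mulmxV // mulmx1.
Qed.

Lemma tr_power_sum n (A : 'M[C]_n) : exists2 d : 'I_n -> C,
  (forall z, \det (z%:M - A) = 0 <-> exists i, z = d i) &
  forall k, \tr (A ^+ k) = \sum_i d i ^+ k.
Proof.
have [P [U [Pu tU PA]]] := trigonalize A.
exists (fun i => U i i); first by move=> z; rewrite (det_similar z Pu PA); exact: eig_trig.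
move=> k; rewrite (tr_similar Pu (similar_exp k PA)).
by apply: eq_bigr => i _; case: (trig_exp k tU) => _ ->.
Qed.

Lemma expr_bounded (x B : R) : (forall k, x ^+ k <= B) -> x <= 1.
Proof.
move=> h; rewrite leNgt; apply/negP => x1.
have e0 : 0 < x - 1 by rewrite subr_gt0.
have bern k : 1 + k%:R * (x - 1) <= x ^+ k.
  elim: k => [|k ih]; first by rewrite mul0r addr0 expr0.
  rewrite exprS; apply: le_trans (ler_wpM2l (ltW (lt_trans ltr01 x1)) ih).
  have : 0 <= k%:R * (x - 1) * (x - 1) by rewrite !mulr_ge0 // ltW.
  rewrite -natr1; lra.
pose k := Num.bound (`|B| / (x - 1)).
have hk : `|B| / (x - 1) < k%:R by apply: archi_boundP; rewrite divr_ge0 // ltW.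
rewrite ltr_pdivrMr // in hk.
have := le_trans (bern k) (h k); have := ler_norm B.
move: hk; clear; move: (k%:R * (x - 1)) => y; lra.
Qed.

(** Multiplying the sequence of power sums by an annihilating polynomial of the
    other values isolates the powers of one of them. *)
Lemma power_sums_bounded n (d : 'I_n -> C) (M : R) :
  (forall k, modulus (\sum_i d i ^+ k) <= M) -> forall i, modulus (d i) <= 1.
Proof.
move=> hM i0; pose mu := d i0.
pose Q : {poly C} := \prod_(i | d i != mu) ('X - (d i)%:P).
have Q0 i : d i != mu -> Q.[d i] = 0.
  by move=> hi; rewrite /Q (bigD1 i) //= hornerM hornerXsubC subrr mul0r.
have Qmu : Q.[mu] != 0.
  rewrite /Q horner_prod prodf_seq_neq0; apply/allP => i _; apply/implyP => hi.
  by rewrite hornerXsubC subr_eq0 eq_sym.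
pose m := #|[pred i | d i == mu]|.
have m0 : (0 < m)%N by apply/card_gt0P; exists i0; rewrite inE eqxx.
have sumE k : \sum_i d i ^+ k * Q.[d i] = m%:R * (mu ^+ k * Q.[mu]).
  rewrite (bigID (fun i => d i == mu)) /= [X in _ + X]big1 ?addr0; last first.
    by move=> i hi; rewrite Q0 ?mulr0.
  rewrite (eq_bigr (fun=> mu ^+ k * Q.[mu])); last by move=> i /eqP ->.
  rewrite [RHS]mulr_natl -sumr_const; apply: eq_bigl => i; by rewrite inE.
pose B := M * \sum_(l < size Q) modulus Q`_l.
have hB k : modulus (\sum_i d i ^+ k * Q.[d i]) <= B.
  have -> : \sum_i d i ^+ k * Q.[d i] = \sum_(l < size Q) Q`_l * \sum_i d i ^+ (k + l).
    under eq_bigr => i _ do rewrite horner_coef mulr_sumr.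
    rewrite exchange_big /=; apply: eq_bigr => l _; rewrite mulr_sumr.
    by apply: eq_bigr => i _; rewrite mulrCA exprD.
  apply: le_trans (modulus_sum _ _ _) _; rewrite /B mulr_sumr.
  by apply: ler_sum => l _; rewrite modulusM mulrC ler_wpM2r ?modulus_ge0.
have q0 : 0 < m%:R * modulus Q.[mu] by rewrite mulr_gt0 ?ltr0n // modulus_gt0.
apply: (@expr_bounded _ (B / (m%:R * modulus Q.[mu]))) => k.
rewrite ler_pdivlMr //; apply: le_trans (hB k); rewrite sumE !modulusM modulusX.
by rewrite -ofR_nat modulus_ofR normr_nat mulrCA.
Qed.

Lemma tr_exp_le n (A : 'M[C]_n) (r : R) k :
  (forall z, \det (z%:M - A) = 0 -> modulus z <= r) ->
  modulus (\tr (A ^+ k)) <= n%:R * r ^+ k.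
Proof.
move=> hr; have [d hd ->] := tr_power_sum A.
apply: le_trans (modulus_sum _ _ _) _.
have -> : n%:R * r ^+ k = \sum_(i < n) r ^+ k by rewrite sumr_const card_ord mulr_natl.
apply: ler_sum => i _; rewrite modulusX.
have di : modulus (d i) <= r by apply: hr; apply/hd; exists i.
by rewrite lerXn2r ?nnegrE ?modulus_ge0 // (le_trans (modulus_ge0 _) di).
Qed.

Lemma inv_pow_near1 (k : nat) (e : R) : 0 < e -> exists2 s0 : R, 0 < s0 < 1 &
  forall s : R, s0 < s < 1 -> (s ^+ k)^-1 <= 1 + e.
Proof.
elim: k e => [|k ih] e e0.
  exists (1 / 2); first by apply/andP; split; lra.
  by move=> s _; rewrite expr0 invr1 lerDl ltW.
pose e' := Num.min 1 (e / 3).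
have e'0 : 0 < e' by rewrite lt_min ltr01 divr_gt0.
have [s1 /andP[s10 s11] hs1] := ih _ e'0.
pose s2 := (1 + e')^-1.
have e1 : 0 < 1 + e' by rewrite addr_gt0.
exists (Num.max s1 s2).
  by rewrite lt_max s10 gt_max s11 /= invf_lt1 // ltrDl.
move=> s /andP[]; rewrite gt_max => /andP[h1 h2] h3.
have s0 : 0 < s by apply: lt_trans h1.
have a1 : (s ^+ k)^-1 <= 1 + e' by apply: hs1; rewrite h1.
have a2 : s^-1 <= 1 + e' by rewrite -[leRHS]invrK lef_pV2 ?posrE ?invr_gt0 // ltW.
rewrite exprS invfM; apply: le_trans (ler_pM _ _ a2 a1) _.
- by rewrite invr_ge0 ltW.
- by rewrite invr_ge0 exprn_ge0 // ltW.
have b1 : e' <= 1 by rewrite ge_min lexx.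
have b2 : e' <= e / 3 by rewrite ge_min lexx orbT.
move: e'0 b1 b2; clear; move: e' => x; nra.
Qed.

(** The Schwarz lemma for the spectral radius: [X z / z] has bounded power
    traces near the circle, hence, by the maximum principle applied to every
    power trace, throughout the disc. *)
Lemma spectral_schwarz n (X : C -> 'M[C]_n) : (0 < n)%N ->
  mxK (@hol R) X -> X 0 = 0 -> (forall z, D z -> spectral_ball R n (X z)) ->
  forall b, D b -> forall l, \det (l%:M - X b) = 0 -> modulus l <= modulus b.
Proof.
move=> n0 hX X0 hball b Db l.
have D0 : D 0 by rewrite /unit_disc /= modulus0.
have /choice [psi hpsi] (ij : 'I_n * 'I_n) : exists h : C -> C, ahol h /\
    forall z, X z ij.1 ij.2 = z * h z.
  have hij := hX ij.1 ij.2.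
  have [h hh [hE _]] := ahol_quotient D0 (hol_ahol hij) (holP hij D0).
  by exists h; split=> // z; rewrite hE X0 mxE add0r subr0.
pose Psi z : 'M[C]_n := \matrix_(i, j) psi (i, j) z.
have XE z : X z = z *: Psi z.
  by apply/matrixP => i j; rewrite !mxE; case: (hpsi (i, j)) => _ ->.
have hPsi : mxK (@ahol R) Psi.
  move=> i j; apply: (fr_ext (f := psi (i, j))); first by move=> z; rewrite mxE.
  by case: (hpsi (i, j)).
have eigX z mu : \det (mu%:M - Psi z) = 0 -> \det ((z * mu)%:M - X z) = 0.
  by move=> /eigP [v v0 hv]; apply/eigP; exists v => //; rewrite XE -scalemxAr hv scalerA.
have trb k z : D z -> modulus (\tr (Psi z ^+ k)) <= n%:R.
  move=> Dz; apply: (@ahol_bound R (fun z => \tr (Psi z ^+ k)) n%:R _ _ z Dz).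
    by apply: (fr_tr ahol_ring); apply: (mxK_exp ahol_ring).
  move=> e e0; have e'0 : 0 < e / n%:R by rewrite divr_gt0 // ltr0n.
  have [s0 /andP[s00 s01] hs] := inv_pow_near1 k e'0; exists s0 => // w /andP[w1 w2].
  have wpos : 0 < modulus w by apply: lt_trans w1.
  have wk : (modulus w)^-1 ^+ k <= 1 + e / n%:R by rewrite exprVn; apply: hs; rewrite w1.
  apply: le_trans (tr_exp_le k (r := (modulus w)^-1) _) _.
    move=> mu /eigX; have h := (ballP (X w) n0).1 (hball w w2) => /(h _).
    by rewrite modulusM mulrC -ltr_pdivlMr // div1r => /ltW.
  apply: le_trans (ler_wpM2l _ wk) _; first exact: ler0n.
  by rewrite mulrDr mulr1 mulrCA divff ?mulr1 // gt_eqF // ltr0n.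
have psib mu : \det (mu%:M - Psi b) = 0 -> modulus mu <= 1.
  have [d hd htr] := tr_power_sum (Psi b).
  move=> /hd [i ->]; apply: (@power_sums_bounded n d n%:R) => k.
  by rewrite -htr; exact: trb.
move=> /eigP [v v0]; have [b0|b0] := eqVneq b 0.
  rewrite b0 X0 mulmx0 => /esym/eqP; rewrite scalemx_eq0 (negPf v0) orbF => /eqP ->.
  by rewrite lexx.
rewrite XE -scalemxAr => hv.
have /psib : \det ((b^-1 * l)%:M - Psi b) = 0.
  by apply/eigP; exists v => //; rewrite -scalerA -hv scalerA mulVf // scale1r.
by rewrite modulusM modulusV mulrC ler_pdivrMr ?modulus_gt0 // mul1r.
Qed.

End Eigenvalues.

(** * Analytic discs in the spectral ball *)

#[local] Opaque spectral_ball.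

Section Moebius.
Context {R : realType}.
Local Notation C := (Cplx R).
Local Notation D := (@unit_disc R).

(** The involutive automorphism of the unit disc exchanging [0] and [a]. *)
Definition mob (a z : C) : C := (a - z) / (1 - conjC a * z).

Lemma D0 : D 0. Proof. by rewrite /unit_disc /= modulus0. Qed.

Lemma mob_denom_neq0 a z : D a -> D z -> 1 - conjC a * z != 0.
Proof.
move=> Da Dz; rewrite subr_eq0; apply/eqP => h.
have : modulus (conjC a * z) < 1.
  rewrite modulusM modulus_conj -[ltRHS]mulr1.
  by apply: ltr_pM => //; exact: modulus_ge0.
by rewrite -h modulus1 ltxx.
Qed.

Lemma mob_identity (a z : C) : modulus (1 - conjC a * z) ^+ 2 - modulus (a - z) ^+ 2 =
  (1 - modulus a ^+ 2) * (1 - modulus z ^+ 2).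
Proof.
rewrite !modulus_sqr; case: a => a b; case: z => c d.
by rewrite !(ReD, ImD, ReN, ImN, ReM, ImM, Re_conj, Im_conj) /=; ring.
Qed.

Lemma D_sqr (z : C) : D z -> 0 < 1 - modulus z ^+ 2.
Proof. by move=> Dz; rewrite subr_gt0 expr_lt1 // modulus_ge0. Qed.

Lemma mob_disc a z : D a -> D z -> D (mob a z).
Proof.
move=> Da Dz; rewrite /unit_disc /= modulus_div ltr_pdivrMr ?modulus_gt0 ?mob_denom_neq0 //.
rewrite mul1r -ltr_sqr ?nnegrE ?modulus_ge0 // -subr_gt0 mob_identity.
by rewrite mulr_gt0 // D_sqr.
Qed.

Lemma mob0 a : mob a 0 = a.
Proof. by rewrite /mob mulr0 !subr0 divr1. Qed.

Lemma mobaa a : mob a a = 0.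
Proof. by rewrite /mob subrr mul0r. Qed.

Lemma hol_comp (f g : C -> C) : hol f -> hol g -> (forall z, D z -> D (g z)) ->
  hol (fun z => f (g z)).
Proof.
move=> hf hg hD; split=> z Dz.
exact: (derivable_compC (holP hg Dz) (holP hf (hD z Dz))).
Qed.

Lemma hol_mob a : D a -> hol (mob a).
Proof.
move=> Da; apply: (holM (holB (hol_cst a) (@hol_id R))).
apply: (holV (holB (hol_cst 1) (holM (hol_cst (conjC a)) (@hol_id R)))).
by move=> z Dz; exact: mob_denom_neq0.
Qed.

Definition mobmx n (c : C) (X : 'M[C]_n) : 'M[C]_n :=
  (c%:M - X) *m invmx (1%:M - conjC c *: X).

Lemma mobmx_unit n c (X : 'M[C]_n) : (0 < n)%N -> D c -> spectral_ball R n X ->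
  1%:M - conjC c *: X \in unitmx.
Proof.
move=> n0 Dc hX; rewrite unitmxE unitfE; apply/negP => /det0P [v v0].
rewrite mulmxBr mulmx1 -scalemxAr => /subr0_eq hv.
have c0 : conjC c != 0.
  by apply/eqP => c0; move: v0; rewrite hv c0 scale0r eqxx.
have := (ball_row X n0).1 hX (conjC c)^-1 v v0.
rewrite {2}hv scalerA mulVf // scale1r => /(_ erefl).
rewrite modulusV modulus_conj invf_lt1 ?modulus_gt0; last first.
  by apply/eqP => c1; move: c0; rewrite c1 conjC0E eqxx.
by move=> /(lt_trans Dc); rewrite ltxx.
Qed.

Lemma mobmx_eig n c (X : 'M[C]_n) (v : 'rV[C]_n) l : (0 < n)%N -> D c ->
  spectral_ball R n X -> v != 0 -> v *m X = l *: v ->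
  v *m mobmx c X = mob c l *: v.
Proof.
move=> n0 Dc hX v0 hv; have Eu := mobmx_unit n0 Dc hX.
have Dl : D l := (ball_row X n0).1 hX l v v0 hv.
have hE : v *m (1%:M - conjC c *: X) = (1 - conjC c * l) *: v.
  by rewrite mulmxBr mulmx1 -scalemxAr hv scalerA scalerBl scale1r.
have -> : v *m mobmx c X = (c - l) *: v *m invmx (1%:M - conjC c *: X).
  by rewrite mulmxA mulmxBr mul_mx_scalar hv scalerBl.
apply: (row_free_inj (A := 1%:M - conjC c *: X)); first by rewrite row_free_unit.
rewrite mulmxKV // -scalemxAl hE scalerA /mob divfK //.
exact: mob_denom_neq0.
Qed.

Lemma mobmx_eig_inv n c (X : 'M[C]_n) (v : 'rV[C]_n) l : (0 < n)%N -> D c ->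
  spectral_ball R n X -> v != 0 -> v *m mobmx c X = l *: v ->
  exists2 m, v *m X = m *: v & l = mob c m.
Proof.
move=> n0 Dc hX v0 hv; have Eu := mobmx_unit n0 Dc hX.
have e1 : c *: v - v *m X = l *: v - (l * conjC c) *: (v *m X).
  rewrite -mul_mx_scalar -mulmxBr -scalerA -scalerBr.
  have -> : v - conjC c *: (v *m X) = v *m (1%:M - conjC c *: X).
    by rewrite mulmxBr mulmx1 -scalemxAr.
  by rewrite scalemxAl -hv -mulmxA mulmxKV.
have e2 : (1 - l * conjC c) *: (v *m X) = (c - l) *: v.
  rewrite !scalerBl scale1r -[X in X - _](subKr (c *: v)) e1 opprB.
  by rewrite addrCA addrAC subrr add0r.
have q0 : 1 - l * conjC c != 0.
  apply/eqP => q; move: e2; rewrite q scale0r => /esym/eqP.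
  rewrite scalemx_eq0 (negPf v0) orbF subr_eq0 => /eqP cl.
  move: q; rewrite -cl mul_conj => /subr0_eq; rewrite -ofR1 => /ofR_inj /esym.
  by apply/eqP; rewrite lt_eqF // expr_lt1 // modulus_ge0.
pose m := (c - l) / (1 - l * conjC c).
have hm : v *m X = m *: v.
  apply: (scalerI q0); rewrite e2 scalerA /m mulrC divfK //.
exists m => //.
by have := mobmx_eig n0 Dc hX v0 hm; rewrite hv => /eqP; rewrite -subr_eq0 -scalerBl
  scalemx_eq0 (negPf v0) orbF subr_eq0 => /eqP.
Qed.

Lemma mobmx_ball n c (X : 'M[C]_n) : (0 < n)%N -> D c ->
  spectral_ball R n X -> spectral_ball R n (mobmx c X).
Proof.
move=> n0 Dc hX; apply/ball_row => // z v v0 /(mobmx_eig_inv n0 Dc hX v0) [m hm ->].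
by apply: mob_disc => //; exact: (ball_row X n0).1 hX m v v0 hm.
Qed.

Lemma mobmxK n c (X : 'M[C]_n) : (0 < n)%N -> D c ->
  spectral_ball R n X -> mobmx c (mobmx c X) = X.
Proof.
move=> n0 Dc hX; have Eu := mobmx_unit n0 Dc hX.
rewrite {1}/mobmx; set Y := mobmx c X; set E := 1%:M - conjC c *: X in Eu.
have YE : Y *m E = c%:M - X by rewrite /Y /mobmx mulmxKV.
have E'u : 1%:M - conjC c *: Y \in unitmx.
  exact: (mobmx_unit n0 Dc (mobmx_ball n0 Dc hX)).
have k : (1 - c * conjC c) != 0 :> C.
  by rewrite mul_conj -ofR1 -ofRB ofR_eq0 gt_eqF // D_sqr.
have e1 : (c%:M - Y) *m E = (1 - c * conjC c) *: X.
  rewrite mulmxBl YE /E mulmxBr mulmx1 mul_scalar_mx scalerA scalerBl scale1r.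
  by rewrite opprB addrAC addrCA subrr addr0 addrC.
have e2 : (1%:M - conjC c *: Y) *m E = (1 - c * conjC c)%:M.
  rewrite mulmxBl mul1mx -scalemxAl YE /E scalerBr scale_scalar_mx.
  rewrite opprB addrA subrK [conjC c * c]mulrC.
  by apply/matrixP => i j; rewrite !mxE -mulrnBl.
have e3 : E *m (1%:M - conjC c *: Y) = (1 - c * conjC c)%:M.
  by rewrite -[E *m _](mulmxK Eu) -(mulmxA E) e2 mul_mx_scalar -scalemxAl (mulmxV Eu) scalemx1.
have : (c%:M - Y) *m E *m (1%:M - conjC c *: Y) =
   (1 - c * conjC c) *: (X *m (1%:M - conjC c *: Y)) by rewrite e1 -scalemxAl.
rewrite -mulmxA e3 mul_mx_scalar => /(scalerI k) ->.
by rewrite mulmxK.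
Qed.

End Moebius.

Section Reach.
Context {R : realType} {n : nat}.
Local Notation C := (Cplx R).
Local Notation D := (@unit_disc R).
Local Notation ball := (spectral_ball R n).
Implicit Types (A B T P : 'M[C]_n) (a : C).

(** The relation whose infimum of [|a|] is the Lempert function. *)
Definition reach A B a : Prop := D a /\
  exists f : C -> 'M[C]_n, [/\ holomorphic_disc ball f, f 0 = A & f a = B].

Lemma reachP A B a : reach A B a <-> D a /\
  exists f, [/\ mxK (@hol R) f, forall z, D z -> ball (f z), f 0 = A & f a = B].
Proof.
split=> -[Da [f]]; first by case=> /holomorphic_discE [h1 h2] h3 h4; split=> //; exists f.
by case=> h1 h2 h3 h4; split=> //; exists f; split=> //; apply/holomorphic_discE.
Qed.

Lemma lempert_le A B a : reach A B a -> lempert ball A B <= modulus a.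
Proof.
move=> h; apply: ge_inf; last by exists a.
by exists 0 => _ [z _ <-]; exact: modulus_ge0.
Qed.

Lemma le_lempert A B (c : R) : (exists a, reach A B a) ->
  (forall a, reach A B a -> c <= modulus a) -> c <= lempert ball A B.
Proof.
move=> [a ha] h; apply: lb_le_inf; first by exists (modulus a), a.
by move=> _ [b hb <-]; exact: h.
Qed.

Lemma reach_ball A B a : reach A B a -> ball A /\ ball B.
Proof.
by move=> /reachP [Da [f [_ h <- <-]]]; split; apply: h => //; exact: D0.
Qed.

Lemma reach_sym A B a : reach A B a -> reach B A a.
Proof.
move=> /reachP [Da [f [h1 h2 h3 h4]]]; apply/reachP; split=> //.
have hD z : D z -> D (mob a z) := fun Dz => mob_disc Da Dz.
exists (fun z => f (mob a z)); rewrite mob0 mobaa; split=> [i j|z Dz|//|//].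
  exact: (@hol_comp R (fun z => f z i j) (mob a) (h1 i j) (hol_mob Da) hD).
exact: h2 (hD z Dz).
Qed.

Lemma reach_similar A B P a : (0 < n)%N -> P \in unitmx -> reach A B a ->
  reach (P *m A *m invmx P) (P *m B *m invmx P) a.
Proof.
move=> n0 Pu /reachP [Da [f [h1 h2 <- <-]]]; apply/reachP; split=> //.
exists (fun z => P *m f z *m invmx P); split=> [|z Dz|//|//].
  exact: (mxK_mul hol_ring (mxK_mul hol_ring (mxK_cst hol_ring P) h1)
                           (mxK_cst hol_ring (invmx P))).
have e : P *m f z = (P *m f z *m invmx P) *m P by rewrite mulmxKV.
exact: (ball_similar n0 Pu e).1 (h2 z Dz).
Qed.

Lemma reach_mobmx A B c a : (0 < n)%N -> D c -> reach A B a ->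
  reach (mobmx c A) (mobmx c B) a.
Proof.
move=> n0 Dc /reachP [Da [f [h1 h2 <- <-]]]; apply/reachP; split=> //.
have hE : mxK (@hol R) (fun z => 1%:M - conjC c *: f z).
  apply: (mxK_sub hol_ring); first exact: (mxK_cst hol_ring).
  by apply: (mxK_scale hol_ring) => //; exact: hol_cst.
have [N hN NE] := hol_invmx hE (fun z Dz => mobmx_unit n0 Dc (h2 z Dz)).
exists (fun z => (c%:M - f z) *m N z); split.
- exact: (mxK_mul hol_ring (mxK_sub hol_ring (mxK_cst hol_ring _) h1) hN).
- by move=> z Dz; rewrite NE //; exact: mobmx_ball (h2 z Dz).
- by rewrite (NE _ D0).
- by rewrite (NE _ Da).
Qed.

(** A triangular form of [P] is deformed to the identity by scaling its
    off-diagonal entries and by exponentials on its diagonal. *)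
Lemma GL_path P a : P \in unitmx -> a != 0 -> exists G : C -> 'M[C]_n,
  [/\ mxK (@hol R) G, forall z, G z \in unitmx, G 0 = 1%:M & G a = P].
Proof.
move=> Pu a0; have [Q [U [Qu tU QP]]] := trigonalize P.
have Ui i : U i i != 0.
  have : \det P != 0 by rewrite -unitfE -unitmxE.
  have -> : \det P = \prod_i U i i.
    rewrite -det_trig // -[P](mulKmx Qu) QP !det_mulmx mulrCA -det_mulmx.
    by rewrite mulVmx // det1 mulr1.
  by rewrite prodf_seq_neq0 => /allP /(_ i (mem_index_enum i)) /implyP; apply.
have /choice [w hw] i : exists w, cexp w = U i i by exact: cexp_surj.
pose V z : 'M[C]_n := \matrix_(i, j)
   if i == j then cexp (w i * (z / a)) else U i j * (z / a).
have hz : hol (fun z => z / a) := holM (@hol_id R) (hol_cst a^-1).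
have hV : mxK (@hol R) V.
  move=> i j; apply: (fr_ext (f := fun z => if i == j then cexp (w i * (z / a)) else U i j * (z / a))).
    by move=> z; rewrite mxE.
  case: (i == j); last exact: (holM (hol_cst _) hz).
  have hc := holM (hol_cst (w i)) hz.
  split=> z Dz; exact: (derivable_compC (holP hc Dz) (@derivable_cexp R _)).
have uV z : V z \in unitmx.
  rewrite unitmxE det_trig; last first.
    apply/is_trig_mxP => i j ij; rewrite mxE ifN ?(is_trig_mxP tU) ?mul0r //.
    by rewrite -val_eqE /= ltn_eqF.
  rewrite unitfE prodf_seq_neq0; apply/allP => i _; apply/implyP => _.
  by rewrite mxE eqxx cexp_neq0.
have Va : V a = U.
  apply/matrixP => i j; rewrite mxE divff // !mulr1 hw.
  by case: eqP => [->|].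
have V0 : V 0 = 1%:M.
  by apply/matrixP => i j; rewrite !mxE mul0r !mulr0 cexp0; case: eqP.
exists (fun z => invmx Q *m V z *m Q); split.
- exact: (mxK_mul hol_ring (mxK_mul hol_ring (mxK_cst hol_ring _) hV)
                             (mxK_cst hol_ring _)).
- by move=> z; rewrite !unitmx_mul unitmx_inv Qu uV.
- by rewrite V0 mulmx1 mulVmx.
- by rewrite Va -mulmxA -QP mulKmx.
Qed.

(** Conjugating a disc by a path that starts at the identity moves one endpoint
    within its conjugacy class and fixes the other. *)
Lemma reach_conj_r A B P a : (0 < n)%N -> P \in unitmx -> a != 0 -> reach A B a ->
  reach A (P *m B *m invmx P) a.
Proof.
move=> n0 Pu a0 /reachP [Da [f [h1 h2 h3 h4]]]; apply/reachP; split=> //.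
have [G [hG uG G0 Ga]] := GL_path Pu a0.
have [N hN NE] := hol_invmx hG (fun z _ => uG z).
exists (fun z => G z *m f z *m N z); split.
- exact: (mxK_mul hol_ring (mxK_mul hol_ring hG h1) hN).
- move=> z Dz; rewrite NE //; have e : G z *m f z = (G z *m f z *m invmx (G z)) *m G z by rewrite mulmxKV.
  exact: (ball_similar n0 (uG z) e).1 (h2 z Dz).
- by rewrite (NE _ D0) G0 h3 mul1mx invmx1 mulmx1.
- by rewrite (NE _ Da) Ga h4.
Qed.

Lemma reach_conj_l A B P a : (0 < n)%N -> P \in unitmx -> a != 0 -> reach A B a ->
  reach (P *m A *m invmx P) B a.
Proof. by move=> n0 Pu a0 /reach_sym h; apply: reach_sym; exact: reach_conj_r. Qed.

End Reach.

(** * Continuity of the spectrum, and perturbation of discs *)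

Section Spectrum.
Context {R : realType} {n : nat}.
Local Notation C := (Cplx R).
Local Notation D := (@unit_disc R).
Local Notation ball := (spectral_ball R n).

Definition contAt (T : topologicalType) (x : T) (f : T -> C) : Prop :=
  {for x, continuous f}.

Lemma near_finite (T : topologicalType) (x : T) (I : finType) (P : I -> T -> Prop) :
  (forall i, \forall y \near x, P i y) -> \forall y \near x, forall i, P i y.
Proof. exact: filter_forall. Qed.

Lemma cont_ring (T : topologicalType) (x : T) : fun_ring (contAt x).
Proof.
split=> [c|f g hf hg|f g hf hg]; first exact: cst_continuous.
  exact: (continuousD hf hg).
exact: (continuousM hf hg).
Qed.

Lemma cont_near (T : topologicalType) (f : T -> C) (x : T) (e : R) :
  contAt x f -> 0 < e -> \forall y \near x, modulus (f y - f x) < e.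
Proof.
move=> cf e0; have : nbhs (f x) [set w | modulus (w - f x) < e] by apply/nbhsCP; exists e.
exact: cf.
Qed.

Lemma cont_entries (A : 'M[C]_n) :
  mxK (@contAt 'M[C]_n A) (fun B : 'M[C]_n => B).
Proof. by move=> i j; exact: coord_continuous. Qed.

Lemma horner_char_poly (A : 'M[C]_n) z : (char_poly A).[z] = \det (z%:M - A).
Proof.
rewrite -[LHS]horner_evalE -det_map_mx; congr (\det _).
apply/matrixP=> i j.
by rewrite !mxE /= /horner_eval hornerD hornerN hornerMn hornerX hornerC.
Qed.

Lemma det_coef (A : 'M[C]_n) (w : C) :
  \det (w%:M - A) = \sum_(k < n.+1) (char_poly A)`_k * w ^+ k.
Proof. by rewrite -horner_char_poly horner_coef size_char_poly. Qed.

Lemma det_coef_diff (A B : 'M[C]_n) (w : C) : \det (w%:M - A) - \det (w%:M - B) =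
  \sum_(k < n.+1) ((char_poly A)`_k - (char_poly B)`_k) * w ^+ k.
Proof. by rewrite !det_coef -sumrB; apply: eq_bigr => k _; rewrite mulrBl. Qed.

Lemma eig_bound (B : 'M[C]_n) w : \det (w%:M - B) = 0 ->
  modulus w <= \sum_i \sum_j modulus (B i j).
Proof.
move=> /eigP [v v0 hv].
have /rV0Pn [i hi] := v0.
have [k hk] : exists k, forall j, modulus (v 0 j) <= modulus (v 0 k).
  exists [arg max_(k > i) modulus (v 0 k)]%O => j.
  by case: Order.TotalTheory.arg_maxP => //= k _; apply.
have vk : 0 < modulus (v 0 k) by apply: lt_le_trans (hk i); rewrite modulus_gt0.
have /rowP /(_ k) := hv; rewrite !mxE => hvk.
rewrite -(ler_pM2r vk) -modulusM -hvk.
apply: le_trans (modulus_sum _ _ _) _; rewrite mulr_suml.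
apply: ler_sum => j _; rewrite modulusM [leRHS]mulrC; apply: ler_pM; rewrite ?modulus_ge0 //.
rewrite (bigD1 k) //= lerDl; apply: sumr_ge0 => l _; exact: modulus_ge0.
Qed.

Lemma prod_lt_pow (d : 'I_n -> C) w (e : R) : (0 < n)%N -> 0 < e ->
  modulus (\prod_i (w - d i)) < e ^+ n -> exists i, modulus (w - d i) < e.
Proof.
move=> n0 e0 h; apply/existsP; apply: contraLR h => /existsPn h.
rewrite -leNgt modulus_prod -[X in _ ^+ X]card_ord -prodr_const.
by apply: ler_prod => i _; rewrite ltW //= leNgt.
Qed.

(** Roots depend continuously on the coefficients: if the value at [w] of a monic
    polynomial is small, then one of its roots is near [w]. *)
Lemma eig_upper (A : 'M[C]_n) (e : R) : (0 < n)%N -> 0 < e -> \forall B \near A,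
  forall w, \det (w%:M - B) = 0 -> exists2 z, \det (z%:M - A) = 0 & modulus (z - w) < e.
Proof.
move=> n0 e0; have [d hd] := eig_factor A.
pose K0 : R := \sum_(i < n) \sum_(j < n) (modulus (A i j) + 1).
have K00 : 0 <= K0.
  by apply: sumr_ge0 => i _; apply: sumr_ge0 => j _; rewrite addr_ge0 // modulus_ge0.
pose S : R := \sum_(k < n.+1) K0 ^+ k + 1.
have S0 : 0 < S.
  by apply: ltr_wpDl => //; apply: sumr_ge0 => k _; exact: exprn_ge0.
pose del := e ^+ n / S.
have del0 : 0 < del by rewrite divr_gt0 // exprn_gt0.
have near1 : \forall B \near A, forall i j, modulus ((B : 'M[C]_n) i j - A i j) < 1.
  by apply/nbhsMP; exists 1.
have near2 : \forall B \near A, forall k : 'I_n.+1,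
    modulus ((char_poly B)`_k - (char_poly A)`_k) < del.
  apply: (near_finite (P := fun (k : 'I_n.+1) (B : 'M[C]_n) =>
    modulus ((char_poly B)`_k - (char_poly A)`_k) < del)) => k.
  have cc : contAt A (fun B : 'M[C]_n => (char_poly B)`_k).
    exact: (polyK_char_poly (cont_ring A) (@cont_entries A)).
  exact: cont_near cc del0.
apply: filterS2 near1 near2 => B h1 h2 w hw.
have wK : modulus w <= K0.
  apply: le_trans (eig_bound hw) _; apply: ler_sum => i _; apply: ler_sum => j _.
  have := modulus_ge_sub (B i j) (A i j); have := h1 i j; clear; lra.
have : modulus (\det (w%:M - A)) < e ^+ n.
  have := det_coef_diff B A w; rewrite hw sub0r => /(congr1 (@modulus R)); rewrite modulusN => ->.
  apply: le_lt_trans (modulus_sum _ _ _) _.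
  apply: (@le_lt_trans _ _ (del * \sum_(k < n.+1) K0 ^+ k)).
    rewrite mulr_sumr; apply: ler_sum => k _; rewrite modulusM modulusX.
    apply: ler_pM; rewrite ?modulus_ge0 ?exprn_ge0 ?modulus_ge0 //; first exact: ltW.
    by rewrite lerXn2r ?nnegrE ?modulus_ge0.
  by rewrite /del mulrAC ltr_pdivrMr // ltr_pM2l ?exprn_gt0 // /S ltrDl.
rewrite hd => /(prod_lt_pow n0 e0) [i hi]; exists (d i); last by rewrite modulusC.
by apply/(eig_factorP _ hd); exists i.
Qed.

Lemma eig_lower (A : 'M[C]_n) (z : C) (e : R) : (0 < n)%N -> 0 < e ->
  \det (z%:M - A) = 0 -> \forall B \near A,
  exists2 w, \det (w%:M - B) = 0 & modulus (z - w) < e.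
Proof.
move=> n0 e0 hz.
have cdet : contAt A (fun B : 'M[C]_n => \det (z%:M - B)).
  apply: (fr_det (cont_ring A)); apply: (mxK_sub (cont_ring A)); last exact: cont_entries.
  exact: (mxK_cst (cont_ring A)).
have en : 0 < e ^+ n by exact: exprn_gt0.
have : \forall B \near A, modulus (\det (z%:M - B) - \det (z%:M - A)) < e ^+ n.
  exact: (cont_near cdet en).
apply: filterS => B; rewrite hz subr0; have [d hd] := eig_factor B.
rewrite hd => /(prod_lt_pow n0 e0) [i hi]; exists (d i) => //.
by apply/(eig_factorP _ hd); exists i.
Qed.

Lemma spectral_radius_continuous (A : 'M[C]_n) : (0 < n)%N ->
  {for A, continuous (fun B : 'M[C]_n => spectral_radius B)}.
Proof.
move=> n0 P /nbhs_ballP [e e0 he].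
have [[z hz zr] hA] := spectral_radiusP A n0.
have up := eig_upper A n0 e0; have lo := eig_lower n0 e0 hz.
apply: filterS2 up lo => B h1 [w hw zw]; apply: he.
have [[w' hw' wr] hB] := spectral_radiusP B n0.
have [z' hz' zw'] := h1 w' hw'.
have a1 := hA _ hz'; have a2 := hB _ hw.
have b1 := modulus_ge_sub z w; have b2 := modulus_ge_sub w' z'.
rewrite modulusC in b2; change (`|spectral_radius A - spectral_radius B| < e).
rewrite ltr_norml.
move: zw zw' a1 a2 b1 b2; rewrite -zr -wr; clear.
move: (modulus (z - w)) (modulus (z' - w')) => x y.
by move=> *; apply/andP; split; lra.
Qed.

Lemma ball_open (A : 'M[C]_n) : (0 < n)%N -> ball A -> \forall B \near A, ball B.
Proof.
move=> n0 hA; have [[z0 hz0 zr] hz] := spectral_radiusP A n0.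
have r1 : modulus z0 < 1 by apply: (ballP A n0).1.
have e0 : 0 < 1 - modulus z0 by rewrite subr_gt0.
apply: filterS (eig_upper A n0 e0) => B hB; apply/ballP => // w /hB [z /hz].
rewrite -zr => h1 h2; have := modulus_ge_sub w z; rewrite modulusC in h2.
move: h1 h2; clear; lra.
Qed.

(** After a slight shrinking of its parameter a disc stays in a compact part of the
    ball, where there is room for adding [(1 - z / a') (A - E)]. *)
Lemma reach_perturb (E T : 'M[C]_n) (a a' : C) : (0 < n)%N ->
  reach E T a -> D a' -> modulus a < modulus a' ->
  \forall A \near E, reach A T a'.
Proof.
move=> n0 /reachP [Da [f [h1 h2 fE fT]]] Da' aa'.
have a'0 : a' != 0 by rewrite -modulus_gt0; apply: le_lt_trans aa'; exact: modulus_ge0.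
have q1 : modulus (a / a') < 1.
  by rewrite modulus_div ltr_pdivrMr ?modulus_gt0 // mul1r.
pose phi (A : 'M[C]_n) z := f (z * (a / a')) + (1 - z / a') *: (A - E).
have qD z : modulus z <= 1 -> D (z * (a / a')).
  move=> hz; rewrite /unit_disc /= modulusM; apply: le_lt_trans q1.
  by rewrite -[leRHS]mul1r ler_wpM2r ?modulus_ge0.
have cover := (compact_near_coveringP (cdisc 1)).1 (@compact_cdisc R 1).
have key : \forall A \near E, (cdisc 1 : set C) `<=` (fun z => ball (phi A z)).
  apply: (cover 'M[C]_n (nbhs E) (fun A z => ball (phi A z)) _) => z hz.
  have Dq := qD z hz.
  have /nbhsMP [e e0 he] := ball_open n0 (h2 _ Dq).
  have e2 : 0 < e / 2 by rewrite divr_gt0.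
  pose N (ij : 'I_n * 'I_n) (w : C) : Prop :=
    modulus (f (w * (a / a')) ij.1 ij.2 - f (z * (a / a')) ij.1 ij.2) < e / 2.
  have near1 : \forall w \near (z : C), forall ij, N ij w.
    apply: (@near_finite C z _ N) => -[i j]; rewrite /N /=.
    have cf := derivable_continuousC (holP (h1 i j) Dq).
    have cs : {for z, continuous (fun w : C => w * (a / a'))}.
      exact: (continuousM (@cvg_id _ (nbhs z)) (@cst_continuous _ _ (a / a') z)).
    have cc : {for z, continuous (fun w : C => f (w * (a / a')) i j)}.
      exact: (@continuous_comp _ _ _ (fun w : C => w * (a / a')) (fun w => f w i j) z cs cf).
    exact: (cont_near cc e2).
  pose K : R := 1 + (modulus z + 1) / modulus a'.
  have K0 : 0 < K.
    rewrite ltr_pwDl // divr_ge0 ?modulus_ge0 // addr_ge0 // modulus_ge0 //.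
  have near2 : \forall w \near z, modulus (1 - w / a') <= K.
    apply/nbhsCP; exists 1 => // w hw; apply: le_trans (modulusB _ _) _.
    rewrite modulus1 lerD2l modulus_div ler_pM2r ?invr_gt0 ?modulus_gt0 //.
    have := modulus_ge_sub w z; move: hw; clear; lra.
  exists ([set w | (forall ij : 'I_n * 'I_n,
      modulus (f (w * (a / a')) ij.1 ij.2 - f (z * (a / a')) ij.1 ij.2) < e / 2)
      /\ modulus (1 - w / a') <= K],
      [set A : 'M[C]_n | forall i j, modulus (A i j - E i j) < e / 2 / K]).
    split=> /=; first exact: filterI.
    by apply/nbhsMP; exists (e / 2 / K) => //; exact: divr_gt0.
  move=> [w A] /= [[hw1 hw2] hA]; apply: he => i j.
  rewrite /phi !mxE addrAC; apply: le_lt_trans (modulusD _ _) _.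
  rewrite [e]splitr; apply: ltr_leD; first exact: hw1 (i, j).
  rewrite modulusM -[leRHS](mulrK (unitf_gt0 K0)) mulrC [leRHS]mulrAC.
  by apply: ler_pM; rewrite ?modulus_ge0 //; apply: ltW; exact: hA.
apply: filterS key => A hA; apply/reachP; split=> //; exists (phi A); split.
- have hz : hol (fun z => z * (a / a')) := holM (@hol_id R) (hol_cst _).
  have hs : forall z, D z -> D (z * (a / a')) by move=> z Dz; apply: qD; exact: ltW.
  have hh : hol (fun z => 1 - z / a').
    exact: (holB (hol_cst 1) (holM (@hol_id R) (hol_cst a'^-1))).
  apply: (mxK_add hol_ring); last exact: (mxK_scale hol_ring hh (mxK_cst hol_ring _)).
  by move=> i j; exact: (@hol_comp R (fun z => f z i j) _ (h1 i j) hz hs).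
- by move=> z Dz; apply: hA; exact: ltW.
- by rewrite /phi !mul0r subr0 scale1r fE addrC subrK.
- by rewrite /phi mulrC divfK // divff // subrr scale0r addr0.
Qed.

(** Conjugation by [diag (t ^ w i)] with [t] tending to zero kills the entries
    between indices of different weights. *)
Lemma weight_degeneration (U : 'M[C]_n) (w : 'I_n -> nat) (e : R) :
  (forall i j, U i j != 0 -> (w j <= w i)%N) -> 0 < e ->
  exists2 Q : 'M[C]_n, Q \in unitmx &
    forall i j, modulus ((Q *m U *m invmx Q) i j - (if w i == w j then U i j else 0)) < e.
Proof.
move=> hw e0; pose S : R := \sum_i \sum_j modulus (U i j) + 1.
have le_S i j : modulus (U i j) < S.
  rewrite /S (bigD1 i) //= (bigD1 j) //= -!addrA ltr_pwDr //.
  by rewrite ltr_wpDl ?ltr_wpDl ?ltr01 ?sumr_ge0 // => k _;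
    rewrite ?modulus_ge0 ?sumr_ge0 // => l _; exact: modulus_ge0.
have S0 : 0 < S by rewrite ltr_wpDl ?sumr_ge0 // => k _; rewrite sumr_ge0 // => l _;
  exact: modulus_ge0.
pose t := Num.min 1 (e / S).
have t0 : 0 < t by rewrite lt_min ltr01 divr_gt0.
have t1 : t <= 1 by rewrite ge_min lexx.
have te : t * S <= e by rewrite -ler_pdivlMr // ge_min lexx orbT.
pose Q : 'M[C]_n := diag_mx (\row_i (ofR t) ^+ w i).
pose Q' : 'M[C]_n := diag_mx (\row_i (ofR t) ^- w i).
have tn0 k : ofR t ^+ k != 0 :> C by rewrite expf_neq0 // ofR_eq0 gt_eqF.
have QQ' : Q *m Q' = 1%:M.
  rewrite mulmx_diag; apply/matrixP => i j; rewrite !mxE.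
  by case: eqP => [->|]; rewrite ?mulr0n // divff.
have [Qu _] := mulmx1_unit QQ'.
have Q'E : invmx Q = Q' by rewrite -[Q'](mulKmx Qu) QQ' mulmx1.
exists Q => // i j; rewrite Q'E.
have -> : (Q *m U *m Q') i j = ofR t ^+ w i * U i j / ofR t ^+ w j.
  by rewrite mul_mx_diag mul_diag_mx !mxE.
case: eqP => [->|/eqP wij].
  by rewrite mulrAC mulfV // mul1r subrr modulus0.
have [->|Uij] := eqVneq (U i j) 0; first by rewrite mulr0 mul0r subrr modulus0.
have wlt : (w j < w i)%N by rewrite ltn_neqAle eq_sym wij hw.
rewrite subr0 mulrAC -expfB // modulusM modulusX modulus_ofR (ger0_norm (ltW t0)).
apply: lt_le_trans te; apply: (@le_lt_trans _ _ (t * modulus (U i j))).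
  have tp : t ^+ (w i - w j) <= t.
    rewrite -[leRHS]expr1; apply: ler_wiXn2l; [exact: ltW|exact: t1|].
    by rewrite subn_gt0.
  by rewrite ler_wpM2r ?modulus_ge0.
by rewrite ltr_pM2l.
Qed.

(** Triangularize and weigh the indices in their order. This is how derogatory
    diagonal matrices are approached by conjugates of a cyclic matrix. *)
Lemma diag_degeneration (T : 'M[C]_n) : exists d : 'rV[C]_n,
  (forall z, \det (z%:M - T) = \prod_i (z - d 0 i)) /\
  forall e : R, 0 < e -> exists2 Q : 'M[C]_n, Q \in unitmx &
    forall i j, modulus ((Q *m T *m invmx Q) i j - diag_mx d i j) < e.
Proof.
have [P [U [Pu tU PT]]] := trigonalize T; have /is_trig_mxP tU' := tU.
exists (\row_i U i i); split.
  by move=> z; rewrite (det_similar z Pu PT) det_trig_sub //; apply: eq_bigr => i _; rewrite mxE.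
move=> e e0; have hw (i j : 'I_n) : U i j != 0 -> (j <= i)%N.
  by apply: contra_neqT; rewrite -ltnNge => /tU'.
have [Q Qu hQ] := @weight_degeneration U (@nat_of_ord n) e hw e0.
exists (Q *m P); first by rewrite unitmx_mul Qu.
move=> i j; have -> : Q *m P *m T *m invmx (Q *m P) = Q *m U *m invmx Q.
  have -> : invmx (Q *m P) = invmx P *m invmx Q.
    have QPu : Q *m P \in unitmx by rewrite unitmx_mul Qu.
    by rewrite -[RHS](mulmxK QPu) mulmxA mulmxKV // mulVmx // mul1mx.
  by rewrite -(mulmxA Q) PT !mulmxA mulmxK.
rewrite (_ : diag_mx _ i j = if nat_of_ord i == j then U i j else 0) //.
by rewrite !mxE -val_eqE; case: eqP => [/val_inj->|]; rewrite ?mulr1n ?mulr0n.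
Qed.

Definition cont (A : 'M[C]_n) : Prop :=
  {within ball, continuous (fun B : 'M[C]_n => lempert ball A B)}.

Lemma contP A : cont A <-> forall B, ball B -> forall e : R, 0 < e ->
  exists2 d : R, 0 < d & forall B', ball B' -> (forall i j, modulus (B' i j - B i j) < d) ->
    `|lempert ball A B - lempert ball A B'| < e.
Proof.
rewrite /cont subspace_continuousP; split=> h B hB.
  move=> e e0.
  have hS : nbhs (lempert ball A B) [set x | `|lempert ball A B - x| < e].
    by apply/nbhs_ballP; exists e.
  have hn : nbhs B [set B' | ball B' -> `|lempert ball A B - lempert ball A B'| < e].
    exact: (h B hB _ hS).
  have [d d0 hd] := (nbhsMP B _).1 hn.
  by exists d => // B' hB' hBB; exact: hd.
move=> P /nbhs_ballP [e e0 he]; have [d d0 hd] := h B hB e e0.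
apply: (nbhsMP B _).2; exists d => // B' hBB' hB'; apply: he; exact: hd.
Qed.

(** All conjugates of [T] are reached with the same parameter, and continuity
    carries this bound to the diagonal matrix at which they accumulate. *)
Lemma cont_diag_limit (A T : 'M[C]_n) (d : 'rV[C]_n) (a : C) : (0 < n)%N -> a != 0 ->
  cont A -> reach A T a -> ball (diag_mx d) ->
  (forall e : R, 0 < e -> exists2 Q : 'M[C]_n, Q \in unitmx &
    forall i j, modulus ((Q *m T *m invmx Q) i j - diag_mx d i j) < e) ->
  lempert ball A (diag_mx d) <= modulus a.
Proof.
move=> n0 a0 /contP cA hT hd hQ; apply/ler_addgt0Pr => e e0.
have [del del0 hdel] := cA _ hd _ e0; have [Q Qu hQd] := hQ _ del0.
have hr := reach_conj_r n0 Qu a0 hT; have [_ hb] := reach_ball hr.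
have := hdel _ hb hQd; have := lempert_le hr; have := ler_norm (lempert ball A (diag_mx d) -
  lempert ball A (Q *m T *m invmx Q)).
clear; move: (lempert _ _ _) (lempert _ _ _) => x y; move: `|x - y| => z; lra.
Qed.

Lemma lempert_eq A B A' B' : (forall a, reach A B a <-> reach A' B' a) ->
  lempert ball A B = lempert ball A' B'.
Proof.
move=> h; rewrite /lempert; congr inf; apply/seteqP; split=> _ [a ha <-];
  by exists a => //; apply/h.
Qed.

Lemma cont_transfer (A A' : 'M[C]_n) (Phi : 'M[C]_n -> 'M[C]_n) :
  (forall B, ball B -> ball (Phi B)) ->
  (forall B, ball B -> exists2 F : 'M[C]_n -> 'M[C]_n,
     mxK (@contAt 'M[C]_n B) F &
     forall B', ball B' -> F B' = Phi B') ->
  (forall B, ball B -> lempert ball A B = lempert ball A' (Phi B)) ->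
  cont A' -> cont A.
Proof.
move=> hb hc hl /contP cA'; apply/contP => B hB e e0.
have [d d0 hd] := cA' _ (hb _ hB) _ e0.
have [F hF FE] := hc _ hB.
have : \forall B' \near B, forall ij : 'I_n * 'I_n,
    modulus (F B' ij.1 ij.2 - F B ij.1 ij.2) < d.
  apply: (near_finite (P := fun (ij : 'I_n * 'I_n) (B' : 'M[C]_n) =>
    modulus (F B' ij.1 ij.2 - F B ij.1 ij.2) < d)) => -[i j].
  exact: (cont_near (hF i j) d0).
move=> /nbhsMP [d' d'0 hd']; exists d' => // B' hB' hBB'.
rewrite !hl //; apply: hd; first exact: hb.
by move=> i j; rewrite -!FE //; exact: (hd' B' hBB' (i, j)).
Qed.

Lemma cont_similar (A P : 'M[C]_n) : (0 < n)%N -> P \in unitmx ->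
  cont (P *m A *m invmx P) -> cont A.
Proof.
move=> n0 Pu; have Pi : invmx P \in unitmx by rewrite unitmx_inv.
have back (X : 'M[C]_n) : invmx P *m (P *m X *m invmx P) *m invmx (invmx P) = X.
  by rewrite invmxK !mulmxA mulVmx // mul1mx mulmxKV.
apply: (@cont_transfer _ _ (fun B => P *m B *m invmx P)).
- move=> B hB; have e : P *m B = P *m B *m invmx P *m P by rewrite mulmxKV.
  exact: (ball_similar n0 Pu e).1.
- move=> B hB; exists (fun B => P *m B *m invmx P) => //.
  have cr : fun_ring (@contAt 'M[C]_n B) := cont_ring B.
  exact: (mxK_mul cr (mxK_mul cr (mxK_cst cr P) (@cont_entries B)) (mxK_cst cr _)).
move=> B hB; apply: lempert_eq => a; split; first exact: reach_similar.
move=> h; exact: (eq_ind _ (fun X => reach X B a) (eq_ind _ (fun Y => reach _ Y a)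
  (reach_similar n0 Pi h) _ (back B)) _ (back A)).
Qed.

Lemma cont_mobmx (A : 'M[C]_n) (c : C) : (0 < n)%N -> D c -> ball A ->
  cont (mobmx c A) -> cont A.
Proof.
move=> n0 Dc hA; apply: (@cont_transfer _ _ (mobmx c)).
- by move=> B hB; exact: mobmx_ball.
- move=> B hB; pose E (X : 'M[C]_n) := 1%:M - conjC c *: X.
  have cr : fun_ring (@contAt 'M[C]_n B) := cont_ring B; have cE : mxK (@contAt 'M[C]_n B) E.
    exact: (mxK_sub cr (mxK_cst cr _) (mxK_scale cr (fr_cst cr _) (@cont_entries B))).
  exists (fun X => (c%:M - X) *m ((\det (E X))^-1 *: \adj (E X))).
    apply: (mxK_mul cr (mxK_sub cr (mxK_cst cr _) (@cont_entries B))).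
    apply: (mxK_scale cr _ (mxK_adj cr cE)).
    have E0 : \det (E B) != 0 by rewrite -unitfE -unitmxE; exact: mobmx_unit.
    exact: (@continuousV _ _ (fun X => \det (E X)) B E0 (fr_det cr cE)).
  by move=> X hX; rewrite /mobmx invmx_adj //; exact: mobmx_unit.
move=> B hB; apply: lempert_eq => a; split; first exact: reach_mobmx.
by move=> h; have := reach_mobmx n0 Dc h; rewrite (mobmxK n0 Dc hA) (mobmxK n0 Dc hB).
Qed.

End Spectrum.

(** * Scalar matrices *)

Section Scalar.
Context {R : realType} {n : nat}.
Local Notation C := (Cplx R).
Local Notation D := (@unit_disc R).
Local Notation ball := (spectral_ball R n).

Lemma cont_of (A : 'M[C]_n) (F : 'M[C]_n -> R) :
  (forall B, ball B -> lempert ball A B = F B) ->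
  (forall B, ball B -> forall e : R, 0 < e -> exists2 d : R, 0 < d &
    forall B', ball B' -> (forall i j, modulus (B' i j - B i j) < d) -> `|F B - F B'| < e) ->
  cont A.
Proof.
move=> hF cF; apply/contP => B hB e e0; have [d d0 hd] := cF B hB e e0.
by exists d => // B' hB' hBB'; rewrite !hF //; exact: hd.
Qed.

Lemma scale_eig (X : 'M[C]_n) (v : 'rV[C]_n) (c l : C) :
  c != 0 -> v *m (c *: X) = l *: v -> v *m X = (l / c) *: v.
Proof.
by move=> c0; rewrite -scalemxAr => h; rewrite mulrC -scalerA -h scalerA mulVf // scale1r.
Qed.

Lemma reach0 (B : 'M[C]_n) (a : C) : (0 < n)%N -> D a -> ball B ->
  (forall z, \det (z%:M - B) = 0 -> modulus z < modulus a) -> reach 0 B a.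
Proof.
move=> n0 Da hB hr.
have [[z0 hz0 _] _] := spectral_radiusP B n0.
have a0 : a != 0 by rewrite -modulus_gt0; apply: le_lt_trans (hr z0 hz0); exact: modulus_ge0.
apply/reachP; split=> //; exists (fun z => (z / a) *: B); split.
- exact: (mxK_scale hol_ring (holM (@hol_id R) (hol_cst a^-1)) (mxK_cst hol_ring B)).
- move=> z Dz; apply/ball_row => // l v v0.
  have [->|z0'] := eqVneq z 0.
    rewrite mul0r scale0r mulmx0 => /esym/eqP; rewrite scalemx_eq0 (negPf v0) orbF => /eqP ->.
    by rewrite modulus0.
  have za : z / a != 0 by rewrite mulf_neq0 // invr_eq0.
  move=> /(scale_eig za) hv.
  have := hr _ ((eigP B _).2 (ex_intro2 _ _ v v0 hv)).
  rewrite modulus_div modulus_div ltr_pdivrMr ?divr_gt0 ?modulus_gt0 // mulrC.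
  by rewrite divfK ?modulus_eq0 // => h; exact: lt_trans Dz.
- by rewrite mul0r scale0r.
- by rewrite divff // scale1r.
Qed.

Lemma disc_ofR (x : R) : 0 < x -> x < 1 -> D (ofR x) /\ modulus (ofR x) = x.
Proof.
move=> x0 x1; have e : modulus (ofR x) = x by rewrite modulus_ofR ger0_norm // ltW.
by rewrite /unit_disc /= e.
Qed.

Lemma lempert_eq_infimum (A B : 'M[C]_n) (m : R) : 0 <= m < 1 ->
  (forall c : R, m < c -> c < 1 -> reach A B (ofR c)) ->
  (forall a, reach A B a -> m <= modulus a) -> lempert ball A B = m.
Proof.
move=> /andP [m0 m1] hr hm; apply/le_anti/andP; split; last first.
  apply: le_lempert hm; exists (ofR ((m + 1) / 2)).
  by apply: hr; move: m1; clear; lra.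
apply/ler_addgt0Pr => e e0; pose c := m + Num.min e ((1 - m) / 2).
have k : 0 < (1 - m) / 2 by rewrite divr_gt0 // subr_gt0.
have mc : m < c by rewrite ltrDl lt_min e0.
have c1 : c < 1.
  apply: (@le_lt_trans _ _ (m + (1 - m) / 2)); last by move: k; clear; lra.
  by rewrite lerD2l ge_min lexx orbT.
apply: le_trans (lempert_le (hr c mc c1)) _.
rewrite (disc_ofR (le_lt_trans m0 mc) c1).2.
by rewrite lerD2l ge_min lexx.
Qed.

Lemma lempert0 (B : 'M[C]_n) : (0 < n)%N -> ball B -> lempert ball 0 B = spectral_radius B.
Proof.
move=> n0 hB; have [[z0 hz0 zr] hz] := spectral_radiusP B n0.
apply: lempert_eq_infimum.
- by rewrite -zr modulus_ge0; apply: (ballP B n0).1 hB z0 hz0.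
- move=> c rc c1; have c0 : 0 < c by apply: le_lt_trans rc; rewrite -zr modulus_ge0.
  have [Dc mc] := disc_ofR c0 c1; apply: reach0 => // z /hz h.
  by rewrite mc; exact: le_lt_trans rc.
move=> a /reachP [Da [f [h1 h2 h3 h4]]]; rewrite -zr.
by apply: (spectral_schwarz n0 h1 h3 h2 Da); rewrite h4.
Qed.

Lemma cont_scalar (c : C) : (0 < n)%N -> ball c%:M -> cont (c%:M : 'M[C]_n).
Proof.
move=> n0 hc.
have Dc : D c.
  have h := (ballP _ n0).1 hc c; apply: h.
  have -> : c%:M - c%:M = (0 : C)%:M :> 'M[C]_n by rewrite subrr raddf0.
  by rewrite det_scalar expr0n gtn_eqF.
apply: (cont_mobmx n0 Dc hc).
rewrite /mobmx subrr mul0mx; apply: (cont_of (F := @spectral_radius R n)).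
  by move=> B hB; exact: lempert0.
move=> B hB e e0.
have : nbhs B [set B' : 'M[C]_n | `|spectral_radius B - spectral_radius B'| < e].
  have hS : nbhs (spectral_radius B) [set x | `|spectral_radius B - x| < e].
    by apply/nbhs_ballP; exists e.
  exact: (spectral_radius_continuous (A := B) n0 hS).
by move=> /nbhsMP [d d0 hd]; exists d => // B' _; exact: hd.
Qed.

End Scalar.

(** * Pairs of eigenvalues: the symmetrized bidisc *)

Section Bidisc.
Context {R : realType}.
Local Notation C := (Cplx R).
Local Notation D := (@unit_disc R).

Definition unimod (w : C) : Prop := modulus w = 1.

Lemma unimod_conj w : unimod w -> w * conjC w = 1.
Proof. by move=> h; rewrite mul_conj h expr1n. Qed.

Lemma unimod_neq0 w : unimod w -> w != 0.
Proof. by move=> h; rewrite -modulus_gt0 h ltr01. Qed.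

(** For unimodular [w] the function [(2 w p - s) / (2 - w s)] of [s = z1 + z2] and
    [p = z1 z2] maps pairs of points of the unit disc to the unit disc. If [w = 1] then
    its value is [- z], where [z] is the midpoint of [z1] and [z2] in the coordinate
    [1 / (1 - z)], and discs are strictly convex. *)
Lemma bidisc_midpoint (z1 z2 : C) (r : R) :
  modulus z1 < r -> modulus z2 <= r -> r < 1 ->
  modulus (2 * (z1 * z2) - (z1 + z2)) < r * modulus (2 - (z1 + z2)).
Proof.
move=> h1 h2 r1; have r0 : 0 < r := le_lt_trans (modulus_ge0 z1) h1.
rewrite -ltr_sqr ?nnegrE ?mulr_ge0 ?modulus_ge0 ?(ltW r0) // exprMn.
have m1 : 0 < modulus (1 - z2) ^+ 2.
  have := modulus_ge_sub 1 z2; rewrite modulus1 => h.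
  by apply: exprn_gt0; move: h h2 r1; move: (modulus _) (modulus _); clear => x y; lra.
have a1 : modulus z1 ^+ 2 < r ^+ 2 by rewrite ltr_sqr ?nnegrE ?modulus_ge0 ?(ltW r0).
have a2 : modulus z2 ^+ 2 <= r ^+ 2 by rewrite ler_sqr ?nnegrE ?modulus_ge0 ?(ltW r0).
have a3 : r ^+ 2 < 1 by rewrite expr_lt1 // ltW.
rewrite -subr_lt0.
have -> : modulus (2 * (z1 * z2) - (z1 + z2)) ^+ 2 - r ^+ 2 * modulus (2 - (z1 + z2)) ^+ 2 =
  2 * modulus (1 - z2) ^+ 2 * (modulus z1 ^+ 2 - r ^+ 2)
  + 2 * modulus (1 - z1) ^+ 2 * (modulus z2 ^+ 2 - r ^+ 2)
  - (1 - r ^+ 2) * modulus (z1 - z2) ^+ 2.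
  rewrite !modulus_sqr -ofR1 -!ofR_nat; clear; case: z1 => a b; case: z2 => c d.
  by rewrite !(ReD, ImD, ReN, ImN, ReM, ImM) /=; ring.
have p1 : 2 * modulus (1 - z2) ^+ 2 * (modulus z1 ^+ 2 - r ^+ 2) < 0.
  by rewrite pmulr_rlt0 ?subr_lt0 // mulr_gt0.
have p2 : 2 * modulus (1 - z1) ^+ 2 * (modulus z2 ^+ 2 - r ^+ 2) <= 0.
  by rewrite mulr_ge0_le0 ?subr_le0 // mulr_ge0 // exprn_ge0 // modulus_ge0.
have p3 : 0 <= (1 - r ^+ 2) * modulus (z1 - z2) ^+ 2.
  by rewrite mulr_ge0 ?subr_ge0 ?exprn_ge0 ?modulus_ge0 // ltW.
by rewrite subr_lt0; apply: lt_le_trans p3; rewrite -[ltRHS]addr0; exact: ltr_leD.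
Qed.

Lemma unimod_scale (w z : C) : unimod w -> modulus (w * z) = modulus z.
Proof. by move=> h; rewrite modulusM h mul1r. Qed.

Lemma bidisc_bound (w z1 z2 : C) (r : R) : unimod w ->
  modulus z1 < r -> modulus z2 <= r -> r < 1 ->
  modulus (2 * w * (z1 * z2) - (z1 + z2)) < r * modulus (2 - w * (z1 + z2)).
Proof.
move=> hw h1 h2 r1.
have := @bidisc_midpoint (w * z1) (w * z2) r; rewrite !unimod_scale // => /(_ h1 h2 r1).
have -> : 2 * (w * z1 * (w * z2)) - (w * z1 + w * z2) = w * (2 * w * (z1 * z2) - (z1 + z2)) by ring.
by rewrite unimod_scale // mulrDr.
Qed.

(** Through each point of the symmetrized bidisc passes one of the discs
    [s = -2 (1 - k) t / (1 + k t)], [p = t (t + k) / (1 + k t)], up to rotation. *)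
Definition geodesic (s p w t : C) (k : R) : Prop := [/\ unimod w, 0 <= k <= 1,
  w * s * (1 + ofR k * t) = - 2 * (1 - ofR k) * t &
  w ^+ 2 * p * (1 + ofR k * t) = t * (t + ofR k)].

Lemma geodesicE s p w t k : geodesic s p w t k -> D t ->
  w * (2 * w * p - s) = t * (2 - w * s).
Proof.
move=> [hw /andP [k0 k1] e1 e2] Dt.
have d0 : 1 + ofR k * t != 0.
  rewrite addrC -[1]opprK subr_eq0; apply/eqP => h.
  have : modulus (ofR k * t) < 1.
    rewrite modulusM modulus_ofR ger0_norm //; apply: le_lt_trans Dt.
    by rewrite ler_piMl ?modulus_ge0.
  by rewrite h modulusN modulus1 ltxx.
apply: (mulIf d0).
have -> : w * (2 * w * p - s) * (1 + ofR k * t) =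
  2 * (w ^+ 2 * p * (1 + ofR k * t)) - w * s * (1 + ofR k * t) by ring.
have -> : t * (2 - w * s) * (1 + ofR k * t) =
  t * (2 * (1 + ofR k * t) - w * s * (1 + ofR k * t)) by ring.
by rewrite e1 e2; ring.
Qed.

(** The values at [(s, p)] of the functions of [bidisc_midpoint], as [w] runs through
    the unit circle, fill the circle of centre [- 2 s (1 - p) / (4 - s^2)] and radius
    [|4 p - s^2| / (4 - s^2)]. The geodesic belongs to the value of largest modulus,
    [rho], and [k <= 1] amounts to [rho <= 1]. *)
Lemma geodesic_real (s : R) (p : C) : 0 < s < 2 ->
  (forall w, unimod w -> modulus (2 * w * p - ofR s) < modulus (2 - w * ofR s)) ->
  4 * p - ofR s ^+ 2 != 0 ->
  exists w t k, geodesic (ofR s) p w t k /\ D t.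
Proof.
move=> /andP [s0 s2] hF Y0.
pose g := modulus (1 - p); pose Y := 4 * p - ofR s ^+ 2; pose y := modulus Y.
have y0 : 0 < y by rewrite modulus_gt0.
have g0 : 0 < g.
  rewrite modulus_gt0 subr_eq0 eq_sym; apply/eqP => p1.
  have := hF 1 modulus1; by rewrite p1 !mulr1 mul1r ltxx.
pose e : C := (1 - p) / ofR g.
have me : modulus e = 1.
  by rewrite modulus_div modulus_ofR (ger0_norm (ltW g0)) divff // gt_eqF.
pose del : R := 4 - s ^+ 2.
have del0 : 0 < del by rewrite subr_gt0; move: s0 s2; clear; nra.
pose rho : R := (2 * s * g + y) / del.
have rho0 : 0 < rho by rewrite divr_gt0 // ltr_wpDl // !mulr_ge0 // ltW.
pose eta : C := - e * ofR y / Y.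
have hY : eta * Y = - e * ofR y by rewrite /eta divfK.
have meta : unimod eta.
  by rewrite /unimod modulus_div modulusM modulusN me mul1r modulus_ofR ger0_norm ?(ltW y0) // divff ?gt_eqF.
pose den := 2 + eta * ofR s.
have den0 : den != 0.
  have := modulus_ge_sub 2 (- (eta * ofR s)); rewrite opprK -/den modulusN modulusM meta mul1r.
  rewrite -ofR_nat !modulus_ofR ger0_norm // (ger0_norm (ltW s0)) => h.
  by rewrite -modulus_gt0; apply: lt_le_trans h; rewrite subr_gt0.
pose w := (2 * eta + ofR s) / den.
have mden : modulus (2 * eta + ofR s) ^+ 2 = modulus den ^+ 2.
  have : modulus eta ^+ 2 = 1 by rewrite meta expr1n.
  rewrite /den !modulus_sqr -!ofR_nat; clear; case: eta => a b /= h.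
  have h' : b ^+ 2 = 1 - a ^+ 2 by rewrite -h; ring.
  by ring: h'.
have hw : unimod w.
  rewrite /unimod modulus_div.
  have -> : modulus (2 * eta + ofR s) = modulus den.
    by apply/eqP; rewrite -(eqrXn2 (n := 2)) ?modulus_ge0 // mden.
  by rewrite divff // modulus_eq0.
have wden : w * den = 2 * eta + ofR s by rewrite /w divfK.
have hden : (2 - w * ofR s) * den = ofR del.
  have -> : (2 - w * ofR s) * den = 2 * den - w * den * ofR s by ring.
  by rewrite wden /den /del ofRB ofRX ofR_nat; ring.
have q0 : 2 - w * ofR s != 0.
  by apply/eqP => h; move: hden; rewrite h mul0r => /esym/eqP; rewrite ofR_eq0 gt_eqF.
have hFw : 2 * w * p - ofR s = - e * ofR rho * (2 - w * ofR s).
  apply: (mulIf den0); rewrite -[RHS]mulrA hden -[RHS]mulrA -ofRM /rho divfK ?gt_eqF //.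
  have -> : (2 * w * p - ofR s) * den = 2 * (w * den) * p - ofR s * den by ring.
  have -> : - e * ofR (2 * s * g + y) = eta * Y - 2 * ofR s * (e * ofR g).
    by rewrite hY ofRD !ofRM ofR_nat; ring.
  have heg : e * ofR g = 1 - p by rewrite /e divfK // ofR_eq0 gt_eqF.
  by rewrite wden heg /den /Y; ring.
have rho1 : rho < 1.
  have := hF w hw; rewrite hFw modulusM -[ltRHS]mul1r ltr_pM2r ?modulus_gt0 //.
  by rewrite modulusM modulusN me mul1r modulus_ofR ger0_norm // ltW.
pose t := w * (- e * ofR rho).
have mt : modulus t = rho.
  by rewrite modulusM hw mul1r modulusM modulusN me mul1r modulus_ofR ger0_norm // ltW.
pose k : R := y * modulus den ^+ 2 / (del ^+ 2 * rho).
have k0 : 0 <= k.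
  apply: divr_ge0; first by apply: mulr_ge0 (ltW y0) _; rewrite exprn_ge0 ?modulus_ge0.
  by apply: mulr_ge0 (ltW rho0); rewrite exprn_ge0 // ltW.
have hk : ofR k * t * (2 - w * ofR s) ^+ 2 = w ^+ 2 * Y.
  apply: (mulIf (expf_neq0 2 den0)).
  have -> : ofR k * t * (2 - w * ofR s) ^+ 2 * den ^+ 2 =
    - e * w * (ofR k * ofR rho * ((2 - w * ofR s) * den) ^+ 2) by rewrite /t; ring.
  rewrite hden -ofRX -!ofRM.
  have -> : k * rho * del ^+ 2 = y * modulus den ^+ 2.
    by rewrite /k; field; rewrite ?gt_eqF.
  have -> : w ^+ 2 * Y * den ^+ 2 = w * (w * den) * den * Y by ring.
  rewrite wden ofRM -mul_conj.
  have -> : - e * w * (ofR y * (den * conjC den)) = w * den * conjC den * (- e * ofR y) by ring.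
  have -> : w * (2 * eta + ofR s) * den * Y = w * den * (2 * eta + ofR s) * Y by ring.
  rewrite -hY mulrA -[_ * conjC den * eta]mulrA; congr (_ * _ * _).
  rewrite conjCD conjCM conjC_ofR mulrDl mulrAC [conjC eta * eta]mulrC unimod_conj // mul1r.
  by rewrite -ofR_nat conjC_ofR.
have ht : t * (2 - w * ofR s) = 2 * w ^+ 2 * p - w * ofR s.
  by rewrite /t -mulrA -hFw; ring.
have hkt : ofR k * t * (2 - w * ofR s) = 2 * t + w * ofR s.
  apply: (mulIf q0); rewrite -[LHS]mulrA -expr2 hk.
  have -> : (2 * t + w * ofR s) * (2 - w * ofR s) =
    2 * (t * (2 - w * ofR s)) + w * ofR s * (2 - w * ofR s) by ring.
  by rewrite ht /Y; ring.
exists w, t, k; split; last by rewrite /unit_disc /= mt.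
have e1 : w * ofR s * (1 + ofR k * t) = - 2 * (1 - ofR k) * t.
  have -> : w * ofR s * (1 + ofR k * t) =
    w * ofR s + 2 * ofR k * t - ofR k * t * (2 - w * ofR s) by ring.
  by rewrite hkt; ring.
split=> //; last first.
  have two0 : (2 : C) != 0 by rewrite -ofR_nat ofR_eq0 pnatr_eq0.
  apply: (mulfI two0).
  have -> : 2 * (w ^+ 2 * p * (1 + ofR k * t)) = (1 + ofR k * t) *
    (2 * w ^+ 2 * p - w * ofR s) + w * ofR s * (1 + ofR k * t) by ring.
  rewrite -ht.
  have -> : (1 + ofR k * t) * (t * (2 - w * ofR s)) + w * ofR s * (1 + ofR k * t) =
    2 * t * (1 + ofR k * t) + (1 - t) * (w * ofR s * (1 + ofR k * t)) by ring.
  by rewrite e1; ring.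
rewrite k0 /= /k ler_pdivrMr ?mul1r ?(mulr_gt0 (exprn_gt0 2 del0) rho0) //.
have -> : del ^+ 2 * rho = del * (2 * s * g + y).
  by rewrite /rho; field; rewrite gt_eqF.
have hr : 2 * s * g + y < del by move: rho1; rewrite /rho ltr_pdivrMr // mul1r.
have E1 : g * y * complex.Re eta = - (del ^+ 2 - y ^+ 2 - 16 * g ^+ 2) / 8.
  have E2 : eta * ofR g * ofR y = - (1 - p) * conjC Y.
    have Yn : ofR y ^+ 2 = Y * conjC Y by rewrite mul_conj ofRX.
    rewrite /eta /e.
    have -> : - ((1 - p) / ofR g) * ofR y / Y * ofR g * ofR y =
      - (1 - p) * (ofR g / ofR g) * (ofR y ^+ 2 / Y) by ring.
    by rewrite Yn [Y * _]mulrC mulfK // divff ?mulr1 // ofR_eq0 gt_eqF.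
  have -> : g * y * complex.Re eta = complex.Re (eta * ofR g * ofR y).
    by clear; case: eta => a b; rewrite !(ReM, ImM) /=; ring.
  rewrite E2 /y /g !modulus_sqr /Y /del -ofR1 -!ofR_nat -ofRX; clear.
  case: p => a b; rewrite !(ReM, ImM, ReN, ImN, ReD, ImD, Re_conj, Im_conj) /=.
  by field.
have E3 : modulus den ^+ 2 = 4 + s ^+ 2 + 4 * s * complex.Re eta.
  have : modulus eta ^+ 2 = 1 by rewrite meta expr1n.
  rewrite /den !modulus_sqr -!ofR_nat; clear; case: eta => a b /= h.
  have h' : b ^+ 2 = 1 - a ^+ 2 by rewrite -h; ring.
  by ring: h'.
have sg : 0 < s * g / 8 by rewrite divr_gt0 // mulr_gt0.
rewrite -(ler_pM2l g0) -subr_ge0.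
have -> : g * (del * (2 * s * g + y)) - g * (y * modulus den ^+ 2) =
  s / 2 * (del ^+ 2 - (2 * s * g + y) ^+ 2).
  have -> : g * (y * modulus den ^+ 2) = g * y * (4 + s ^+ 2) + 4 * s * (g * y * complex.Re eta).
    by rewrite E3; ring.
  by rewrite E1 /del; field.
apply: mulr_ge0; first by rewrite divr_ge0 // ltW.
by rewrite subr_ge0 ler_sqr ?nnegrE ?(ltW del0) ?(ltW hr) // addr_ge0 ?(ltW y0) // !mulr_ge0 // ltW.
Qed.

Lemma bidisc_lt (w z1 z2 : C) : unimod w -> D z1 -> D z2 ->
  modulus (2 * w * (z1 * z2) - (z1 + z2)) < modulus (2 - w * (z1 + z2)).
Proof.
move=> hw D1 D2; pose r := (1 + Num.max (modulus z1) (modulus z2)) / 2.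
have hr : Num.max (modulus z1) (modulus z2) < 1 by rewrite gt_max D1.
have r1 : r < 1 by move: hr; rewrite /r; clear; lra.
have mr : Num.max (modulus z1) (modulus z2) < r by move: hr; rewrite /r; clear; lra.
move: mr; rewrite gt_max => /andP [h1 h2].
apply: lt_le_trans (bidisc_bound hw h1 (ltW h2) r1) _.
by rewrite ler_piMl ?modulus_ge0 // ltW.
Qed.

Lemma geodesic_exists (z1 z2 : C) : D z1 -> D z2 ->
  exists w t k, geodesic (z1 + z2) (z1 * z2) w t k /\ D t.
Proof.
move=> D1 D2; set s := z1 + z2; set p := z1 * z2.
have u1 : unimod 1 := modulus1.
have [s0|s0] := eqVneq s 0.
  exists 1, p, 1; split; last first.
    rewrite /unit_disc /= modulusM; apply: le_lt_trans D1.
    by rewrite ler_piMr ?modulus_ge0 // ltW.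
  by split=> //; [rewrite ler01 lexx|rewrite s0 ofR1; ring|rewrite ofR1; ring].
have s2 : modulus s < 2.
  by apply: le_lt_trans (modulusD _ _) _; move: D1 D2; rewrite /unit_disc /=; clear; lra.
have [Y0|Y0] := eqVneq (4 * p - s ^+ 2) 0.
  exists 1, (- s / 2), 0; split; last first.
    rewrite /unit_disc /= modulus_div modulusN -ofR_nat modulus_ofR ger0_norm //.
    by rewrite ltr_pdivrMr // mul1r.
  split=> //; rewrite ?ler01 ?lexx // ofR0; first by field.
  have -> : p = s ^+ 2 / 4 by rewrite -(subr0_eq Y0); field.
  by field.
have m0 : 0 < modulus s by rewrite modulus_gt0.
pose u := conjC s / ofR (modulus s).
have hu : unimod u.
  by rewrite /unimod modulus_div modulus_conj modulus_ofR ger0_norm ?modulus_ge0 // divff ?gt_eqF.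
have us : u * s = ofR (modulus s).
  rewrite /u mulrAC [conjC s * s]mulrC mul_conj ofRX expr2 mulfK //.
  by rewrite ofR_eq0 gt_eqF.
have s02 : 0 < modulus s < 2 by rewrite m0.
have hF w : unimod w ->
    modulus (2 * w * (u ^+ 2 * p) - ofR (modulus s)) < modulus (2 - w * ofR (modulus s)).
  move=> hw; rewrite -us.
  have := @bidisc_lt w (u * z1) (u * z2) hw; rewrite /unit_disc /= !unimod_scale // => /(_ D1 D2).
  have -> : u * z1 * (u * z2) = u ^+ 2 * p by rewrite /p; ring.
  by rewrite -mulrDr.
have Y0' : 4 * (u ^+ 2 * p) - ofR (modulus s) ^+ 2 != 0.
  rewrite -us; have -> : 4 * (u ^+ 2 * p) - (u * s) ^+ 2 = u ^+ 2 * (4 * p - s ^+ 2) by ring.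
  by rewrite mulf_neq0 // expf_neq0 // unimod_neq0.
have [w [t [k [[hw hk e1 e2] Dt]]]] := geodesic_real s02 hF Y0'.
exists (w * u), t, k; split=> //; split=> //.
- by rewrite /unimod modulusM hw hu mulr1.
- by rewrite -e1 -us; ring.
- by rewrite -e2; ring.
Qed.

Lemma geodesic_bound (z1 z2 w t : C) (k r : R) : geodesic (z1 + z2) (z1 * z2) w t k ->
  D t -> modulus z1 < r -> modulus z2 <= r -> r < 1 -> modulus t < r.
Proof.
move=> hg Dt h1 h2 r1; have hw : unimod w by case: hg.
have := geodesicE hg Dt => /(congr1 (@modulus R)); rewrite unimod_scale // modulusM => e.
have := bidisc_bound hw h1 h2 r1; rewrite e => h.
have q0 : 0 < modulus (2 - w * (z1 + z2)).
  rewrite lt_neqAle modulus_ge0 andbT; apply/eqP => q; move: h.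
  by rewrite -q !mulr0 ltxx.
by rewrite ltr_pM2r in h.
Qed.

(** The equation reads [(z + t)^2 = - k t (1 - z)^2]. *)
Lemma geodesic_root (t z : C) (k : R) : 0 <= k <= 1 -> D t ->
  (1 + ofR k * t) * z ^+ 2 + 2 * (1 - ofR k) * t * z + t * (t + ofR k) = 0 -> D z.
Proof.
move=> /andP [k0 k1] Dt hz.
pose c : C := sqrtC (- (ofR k * t)).
have hc : c ^+ 2 = - (ofR k * t) by rewrite sqrtCK.
have [tau htau e] : exists2 tau : C, tau ^+ 2 = - (ofR k * t) & z + t = tau * (1 - z).
  have : (z + t - c * (1 - z)) * (z + t - - c * (1 - z)) == 0.
    by rewrite -hz; apply/eqP; ring: hc.
  rewrite mulf_eq0 !subr_eq0 => /orP [] /eqP h; first by exists c.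
  by exists (- c) => //; rewrite sqrrN.
have mtau : modulus tau ^+ 2 = k * modulus t.
  by rewrite -modulusX htau modulusN modulusM modulus_ofR ger0_norm.
have ez : z * (1 + tau) = tau - t.
  have e' : tau * z = tau - (z + t) by rewrite e; ring.
  by rewrite mulrDr mulr1 [z * tau]mulrC e'; ring.
have hRe : complex.Re (tau * conjC t) = - modulus t * complex.Re tau.
  have [k0'|k0'] := eqVneq k 0.
    have /eqP : tau ^+ 2 = 0 by rewrite htau k0' ofR0 mul0r oppr0.
    by rewrite expf_eq0 /= => /eqP ->; rewrite mul0r mulr0.
  apply: (mulfI k0'); rewrite mulrA mulrN -mtau modulus_sqr.
  have -> : k * complex.Re (tau * conjC t) = complex.Re (tau * conjC (ofR k * t)).
    by rewrite conjCM conjC_ofR; clear; case: tau (conjC t) => a b [c d]; rewrite !(ReM, ImM) /=; ring.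
  have -> : ofR k * t = - tau ^+ 2 by rewrite htau opprK.
  clear; case: tau => a b; rewrite expr2 !(ReM, ImM, ReN, ImN, Re_conj, Im_conj) /=; ring.
have key : modulus (1 + tau) ^+ 2 - modulus (tau - t) ^+ 2 =
    (1 - modulus t) * (1 + modulus t + 2 * complex.Re tau).
  have -> : modulus (tau - t) ^+ 2 = modulus tau ^+ 2 + modulus t ^+ 2 - 2 * complex.Re (tau * conjC t).
    by rewrite !modulus_sqr; clear; case: tau t => a b [c d];
      rewrite !(ReM, ImM, ReN, ImN, ReD, ImD, Re_conj, Im_conj) /=; ring.
  have -> : modulus (1 + tau) ^+ 2 = 1 + 2 * complex.Re tau + modulus tau ^+ 2.
    by rewrite !modulus_sqr -ofR1; clear; case: tau => a b; rewrite !(ReD, ImD) /=; ring.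
  by rewrite hRe; ring.
have pos : 0 < (1 - modulus t) * (1 + modulus t + 2 * complex.Re tau).
  rewrite mulr_gt0 ?subr_gt0 //.
  have a1 := Re_le_modulus tau; have m0 := modulus_ge0 tau; have t0 := modulus_ge0 t.
  have a2 : modulus tau ^+ 2 <= modulus t by rewrite mtau ler_piMl.
  move: (Dt) a1 a2 m0; rewrite /unit_disc /= ler_norml; clear.
  move: (modulus t) (modulus tau) (complex.Re tau) => x m a x1 /andP [a1 _] a2 m0.
  have m1 : m < 1.
    have h : m ^+ 2 < 1 := le_lt_trans a2 x1.
    by rewrite expr_lt1 // in h.
  have : 0 < (1 - m) ^+ 2 by rewrite exprn_gt0 // subr_gt0.
  by move: a1 a2; clear; nra.
rewrite -key subr_gt0 ltr_sqr ?nnegrE ?modulus_ge0 // -ez modulusM in pos.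
have q0 : 0 < modulus (1 + tau).
  by rewrite lt_neqAle modulus_ge0 andbT; apply/eqP => q; move: pos; rewrite -q mulr0 ltxx.
by rewrite /unit_disc /= -(ltr_pM2r q0) mul1r.
Qed.

End Bidisc.

(** * Matrices of discs with two by two blocks *)

Section Pairs.
Context {R : realType} {n : nat}.
Local Notation C := (Cplx R).
Local Notation D := (@unit_disc R).
Local Notation ball := (spectral_ball R n).
Variable pi : 'I_n -> 'I_n.
Hypothesis piK : involutive pi.

(** Up to a permutation of the indices, a block diagonal matrix whose blocks are
    the orbits of the involution [pi]. *)
Definition orbit_mx (a b : 'I_n -> C) : 'M[C]_n :=
  \matrix_(i, j) (if j == i then a i else if j == pi i then b i else 0).

Lemma mul_orbit_mx m (V : 'M[C]_(m, n)) a b i j : (V *m orbit_mx a b) i j =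
  V i j * a j + (if pi j == j then 0 else V i (pi j) * b (pi j)).
Proof.
rewrite !mxE (bigD1 j) //= mxE eqxx; congr (_ + _).
case: (eqVneq (pi j) j) => [pj|pj].
  apply: big1 => k kj; rewrite mxE eq_sym (negPf kj) ifN ?mulr0 //.
  by apply: contra kj => /eqP jk; rewrite -(piK k) -jk pj.
rewrite (bigD1 (pi j)) //= mxE piK eqxx eq_sym (negPf pj) big1 ?addr0 // => k /andP [kj kpj].
rewrite mxE eq_sym (negPf kj) ifN ?mulr0 //.
by apply: contra kpj => /eqP ->; rewrite piK.
Qed.

Variable Y : pred 'I_n.
Hypothesis piY : forall i, pi i != i -> Y (pi i) = ~~ Y i.

(** Companion blocks with trace [s] and determinant [p] on the orbits of size two,
    the entries of [e] on the fixed points of [pi]. *)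
Definition pair_mx (s p : C) (e : 'I_n -> C) : 'M[C]_n :=
  orbit_mx (fun i => if pi i == i then e i else if Y i then s else 0)
           (fun i => if Y i then - p else 1).

Lemma pair_mx_row (v : 'rV[C]_n) s p e j : (v *m pair_mx s p e) 0 j =
  if pi j == j then v 0 j * e j else
  if Y j then v 0 j * s + v 0 (pi j) else - (v 0 (pi j) * p).
Proof.
rewrite mul_orbit_mx; case: (eqVneq (pi j) j) => [_|pj]; first by rewrite addr0.
by rewrite piY //; case: (Y j); rewrite /= ?mulr1 ?mulr0 ?add0r ?mulrN.
Qed.

Lemma pair_mx_eig (v : 'rV[C]_n) s p e l : v != 0 -> v *m pair_mx s p e = l *: v ->
  (exists2 j, pi j = j & l = e j) \/ l ^+ 2 - s * l + p = 0.
Proof.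
move=> v0 hv.
have hj j : (if pi j == j then v 0 j * e j else
  if Y j then v 0 j * s + v 0 (pi j) else - (v 0 (pi j) * p)) = l * v 0 j.
  by rewrite -pair_mx_row hv mxE.
have /rV0Pn [j vj] := v0.
have [pj|pj] := eqVneq (pi j) j.
  left; exists j => //; move: (hj j); rewrite pj eqxx mulrC => /(mulIf vj) ->; by [].
right.
have [y [Yy py vy]] : exists y, [/\ Y y, pi y != y & v 0 y != 0 \/ v 0 (pi y) != 0].
  case Yj : (Y j); first by exists j; split=> //; left.
  by exists (pi j); rewrite piY ?Yj // piK eq_sym; split=> //; right.
have := hj y; rewrite (negPf py) Yy => h1.
have := hj (pi y); rewrite piK eq_sym (negPf py) piY // Yy /= => h2.
have {}vy : v 0 y != 0.
  case: vy => // vx; apply/eqP => vy; move: h1; rewrite vy mul0r add0r mulr0 => h.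
  by rewrite h eqxx in vx.
apply: (mulfI vy); rewrite mulr0.
have -> : v 0 y * (l ^+ 2 - s * l + p) =
  l * (l * v 0 y) - l * (v 0 y * s + v 0 (pi y)) + (l * v 0 (pi y) - - (v 0 y * p)) by ring.
by rewrite h1 h2; ring.
Qed.

Lemma pair_mx_diag (x y : C) (e : 'I_n -> C) : x != y ->
  (forall i, pi i != i -> e i = if Y i then y else x) ->
  exists2 P : 'M[C]_n, P \in unitmx &
    P *m pair_mx (x + y) (x * y) e = diag_mx (\row_i e i) *m P.
Proof.
move=> xy he; pose P := orbit_mx (fun i => if pi i == i then 1 else if Y i then 1 else - y)
  (fun i => if Y i then - x else 1).
exists P.
  rewrite unitmxE unitfE; apply/negP => /det0P [v v0 hv].
  have hj j : v 0 j * (if pi j == j then 1 else if Y j then 1 else - y) +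
      (if pi j == j then 0 else v 0 (pi j) * (if Y (pi j) then - x else 1)) = 0.
    by have /esym := mul_orbit_mx v (fun i => if pi i == i then 1 else if Y i then 1 else - y)
      (fun i => if Y i then - x else 1) 0 j; rewrite -/P hv mxE.
  case/eqP: v0; apply/rowP => i; rewrite mxE.
  have [pj|pj] := eqVneq (pi i) i.
    by have := hj i; rewrite pj eqxx mulr1 addr0.
  have := hj i; have := hj (pi i); rewrite piK [i == _]eq_sym (negPf pj) piY //.
  have q : x - y != 0 by rewrite subr_eq0.
  case: (Y i) => /= h1 h2; apply: (mulfI q); rewrite mulr0.
    have -> : (x - y) * v 0 i = - y * (v 0 i * 1 + v 0 (pi i) * 1) * 1
      - (v 0 (pi i) * - y + v 0 i * - x) by ring.
    by rewrite h1 h2; ring.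
  have -> : (x - y) * v 0 i = x * (v 0 (pi i) * 1 + v 0 i * 1)
      + (v 0 i * - y + v 0 (pi i) * - x) by ring.
  by rewrite h1 h2; ring.
apply/matrixP => i j; rewrite mul_orbit_mx mul_diag_mx !mxE.
have [->|ji] := eqVneq j i.
  rewrite eqxx; have [pi_i|pi_i] := eqVneq (pi i) i; first by ring.
  by rewrite piY // he //; case: (Y i) => /=; ring.
have [jpi|jpi] := eqVneq j (pi i).
  rewrite jpi piK eqxx; have pi_i : pi i != i by rewrite -jpi.
  rewrite eq_sym (negPf pi_i) piY // he //; case: (Y i) => /=; ring.
have pji : pi j != i by apply: contra jpi => /eqP <-; rewrite piK.
rewrite (negPf pji) mul0r mulr0 add0r; case: ifP => // pjj.
have [pjpi|_] := eqVneq (pi j) (pi i); last by rewrite mul0r.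
by case/eqP: ji; rewrite -(piK j) pjpi piK.
Qed.

Lemma pair_reach (s p w t a : C) (k : R) (e : 'I_n -> C) : (0 < n)%N ->
  geodesic s p w t k -> D t -> D a -> a != 0 -> modulus t <= modulus a ->
  (forall i, pi i = i -> modulus (e i) <= modulus a) ->
  reach (pair_mx 0 0 (fun=> 0)) (pair_mx s p e) a.
Proof.
move=> n0 [hw hk e1 e2] Dt Da a0 ta ea; apply/reachP; split=> //.
have w0 := unimod_neq0 hw.
pose T (z : C) := z / a * t; pose q z := 1 + ofR k * T z.
have ra (c : C) : modulus c <= modulus a -> forall z, D z -> D (z / a * c).
  move=> ca z Dz; rewrite /unit_disc /= mulrAC -mulrA modulusM; apply: le_lt_trans Dz.
  by rewrite ler_piMr ?modulus_ge0 // modulus_div ler_pdivrMr ?modulus_gt0 // mul1r.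
have DT z : D z -> D (T z) := ra t ta z.
have q0 z : D z -> q z != 0.
  move=> /DT DTz; rewrite /q addrC -[1]opprK subr_eq0; apply/eqP => h.
  case/andP: hk => k0 k1.
  have : modulus (ofR k * T z) < 1.
    rewrite modulusM modulus_ofR ger0_norm //; apply: le_lt_trans DTz.
    by rewrite ler_piMl ?modulus_ge0.
  by rewrite h modulusN modulus1 ltxx.
pose S z := - 2 * (1 - ofR k) * w^-1 * (T z / q z).
pose Q z := w^-1 ^+ 2 * (T z * (T z + ofR k) / q z).
have Ta : T a = t by rewrite /T divff // mul1r.
have T0 : T 0 = 0 by rewrite /T !mul0r.
have Da0 : q a != 0 := q0 a Da.
have Sa : S a = s.
  apply: (mulfI w0); apply: (mulIf Da0); rewrite /S /q Ta e1 -Ta -/(q a).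
  by field; rewrite ?w0 ?Da0.
have Qa : Q a = p.
  apply: (mulfI (expf_neq0 2 w0)); apply: (mulIf Da0); rewrite /Q /q Ta e2 -Ta -/(q a).
  by field; rewrite ?w0 ?Da0.
have hz : hol (fun z => z / a) := holM (@hol_id R) (hol_cst a^-1).
have hT : hol T := holM hz (hol_cst t).
have hq : hol q := holD (hol_cst 1) (holM (hol_cst _) hT).
have hiq : hol (fun z => (q z)^-1) := holV hq q0.
have hS : hol S := holM (hol_cst _) (holM hT hiq).
have hQ : hol Q := holM (hol_cst _) (holM (holM hT (holD hT (hol_cst _))) hiq).
exists (fun z => pair_mx (S z) (Q z) (fun i => z / a * e i)); split.
- move=> i j; apply: (fr_ext (f := fun z => if j == i then
     (if pi i == i then z / a * e i else if Y i then S z else 0)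
     else if j == pi i then (if Y i then - Q z else 1) else 0)).
    by move=> z; rewrite mxE.
  case: (j == i); case: (pi i == i); case: (Y i); case: (j == pi i);
    first [exact: hS | exact: (holM hz (hol_cst _)) | exact: (holN hQ) | exact: hol_cst].
- move=> z Dz; apply/ball_row => // l v v0 /(pair_mx_eig v0) [[j pj ->]|hl].
    exact: ra (ea j pj) z Dz.
  have := @geodesic_root R (T z) (w * l) k hk (DT z Dz).
  rewrite /unit_disc /= unimod_scale //; apply.
  have -> : (1 + ofR k * T z) * (w * l) ^+ 2 + 2 * (1 - ofR k) * T z * (w * l) +
    T z * (T z + ofR k) = w ^+ 2 * q z * (l ^+ 2 - S z * l + Q z).
    rewrite -/(q z) /S /Q; have := q0 z Dz; move: (q z) (T z) => qz Tz qz0.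
    by field; rewrite ?w0 ?qz0.
  by rewrite hl mulr0.
- apply/matrixP => i j; rewrite !mxE /S /Q T0 !mul0r !mulr0.
  by case: (j == i); case: (j == pi i); case: (Y i); rewrite ?oppr0.
- rewrite Sa Qa; apply/matrixP => i j; rewrite !mxE divff // mul1r //.
Qed.

End Pairs.

(** * Two by two matrices with a single eigenvalue *)

Section TwoByTwo.
Context {R : realType}.
Local Notation C := (Cplx R).
Local Notation D := (@unit_disc R).
Local Notation ball := (spectral_ball R 2).
Implicit Types (A B : 'M[C]_2).

Definition mx2 (a b c d : C) : 'M[C]_2 :=
  \matrix_(i, j) (if i == 0 then if j == 0 then a else b else if j == 0 then c else d).

Lemma mx2E A : A = mx2 (A 0 0) (A 0 1) (A 1 0) (A 1 1).
Proof.
by apply/matrixP => -[[|[|i]] hi] -[[|[|j]] hj]; rewrite ?mxE //=; congr (A _ _); exact: val_inj.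
Qed.

Lemma mul_mx2 a b c d a' b' c' d' : mx2 a b c d *m mx2 a' b' c' d' =
  mx2 (a * a' + b * c') (a * b' + b * d') (c * a' + d * c') (c * b' + d * d').
Proof.
by apply/matrixP => -[[|[|i]] hi] -[[|[|j]] hj]; rewrite ?mxE //= !big_ord_recl big_ord0 !mxE /= addr0.
Qed.

Lemma tr_mx2 a b c d : \tr (mx2 a b c d) = a + d.
Proof. by rewrite /mxtrace !big_ord_recl big_ord0 !mxE /= addr0. Qed.

Lemma det_mx2 a b c d : \det (mx2 a b c d) = a * d - b * c.
Proof.
rewrite (expand_det_row _ ord0) !big_ord_recl big_ord0 /cofactor !det_mx11 !mxE /=.
by rewrite expr0 expr1 mul1r addr0 mulN1r mulrN.
Qed.

Definition companion2 (s p : C) : 'M[C]_2 :=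
  pair_mx (@rev_ord 2) (fun i => i == 1) s p (fun=> 0).

Lemma companion2E s p : companion2 s p = mx2 0 1 (- p) s.
Proof. by apply/matrixP => -[[|[|i]] hi] -[[|[|j]] hj]; rewrite ?mxE. Qed.

Lemma scalar_mx2 c : (c%:M : 'M[C]_2) = mx2 c 0 0 c.
Proof. by apply/matrixP => -[[|[|i]] hi] -[[|[|j]] hj]; rewrite ?mxE. Qed.

(** The rows [v] and [v B] conjugate [B] to its companion matrix as soon as they are
    independent, and one of [(1, 0)], [(0, 1)], [(1, 1)] is not an eigenvector. *)
Lemma nonscalar_companion2 B : (forall c, B <> c%:M) -> exists2 P, P \in unitmx &
  P *m B = companion2 (\tr B) (\det B) *m P.
Proof.
rewrite (mx2E B) tr_mx2 det_mx2 companion2E; move: (B 0 0) (B 0 1) (B 1 0) (B 1 1) => a b c d hB.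
have key x y : x * (x * b + y * d) - y * (x * a + y * c) != 0 ->
    exists2 P, P \in unitmx & P *m mx2 a b c d = mx2 0 1 (- (a * d - b * c)) (a + d) *m P.
  move=> h; exists (mx2 x y (x * a + y * c) (x * b + y * d)).
    by rewrite unitmxE unitfE det_mx2.
  by rewrite !mul_mx2; congr mx2; ring.
have [b0|b0] := eqVneq b 0; last first.
  by apply: (key 1 0); rewrite !mul0r !mul1r subr0 addr0.
have [c0|c0] := eqVneq c 0; last first.
  by apply: (key 0 1); rewrite !mul0r !mul1r !add0r oppr_eq0.
apply: (key 1 1); rewrite !mul1r b0 c0 add0r addr0 subr_eq0; apply/eqP => ad.
by apply: (hB a); rewrite scalar_mx2 b0 c0 ad.
Qed.

Lemma eig_pair B : ball B -> exists z1 z2, [/\ D z1, D z2, \tr B = z1 + z2 & \det B = z1 * z2].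
Proof.
move=> hB; have [P [U [Pu tU PB]]] := trigonalize B.
have hU : ball U := (ball_similar (isT : (0 < 2)%N) Pu PB).1 hB.
have hD i : D (U i i).
  by apply: (ballP U (isT : (0 < 2)%N)).1 hU _ _; apply/eig_trig => //; exists i.
have e : \det B = \det U.
  have P0 : \det P != 0 by rewrite -unitfE -unitmxE.
  by apply: (mulfI P0); rewrite -det_mulmx PB det_mulmx mulrC.
exists (U 0 0), (U 1 1); split=> //.
  by rewrite (tr_similar Pu PB) {1}(mx2E U) tr_mx2.
by rewrite e det_trig // !big_ord_recl big_ord0 mulr1; congr (_ * U _ _); exact: val_inj.
Qed.

(** The functions of [bidisc_lt] turn a disc centred at a nilpotent matrix into a
    self-map of the unit disc that fixes the origin. *)
Lemma bidisc_schwarz A B w a : unimod w -> \tr A = 0 -> \det A = 0 -> reach A B a ->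
  modulus (2 * w * \det B - \tr B) <= modulus a * modulus (2 - w * \tr B).
Proof.
move=> hw tA dA /reachP [Da [f [h1 h2 f0 fa]]].
have lt z : D z -> modulus (2 * w * \det (f z) - \tr (f z)) < modulus (2 - w * \tr (f z)).
  by move=> Dz; have [z1 [z2 [D1 D2 -> ->]]] := eig_pair (h2 z Dz); exact: bidisc_lt.
have q z : D z -> 2 - w * \tr (f z) != 0.
  by move=> /lt h; rewrite -modulus_gt0; apply: le_lt_trans h; exact: modulus_ge0.
have htr : hol (fun z => \tr (f z)) := fr_tr hol_ring h1.
have hdet : hol (fun z => \det (f z)) := fr_det hol_ring h1.
have hnum : hol (fun z => 2 * w * \det (f z) - \tr (f z)) := holB (holM (hol_cst _) hdet) htr.
have hden : hol (fun z => 2 - w * \tr (f z)) := holB (hol_cst _) (holM (hol_cst _) htr).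
have hF := holM hnum (holV hden q).
have := schwarz (hol_ahol hF) (holP hF (@D0 R)) _ ler01 _ Da.
rewrite f0 tA dA mulr0 subr0 mul0r fa mul1r modulus_div => h.
rewrite -ler_pdivrMr; last by rewrite modulus_gt0 -fa; exact: q.
apply: h => // z Dz; rewrite modulus_div ler_pdivrMr ?modulus_gt0 ?q // mul1r ltW //; exact: lt.
Qed.

(** The matrices conjugate to the nilpotent Jordan block. *)
Definition jordan2 A : Prop := [/\ forall c, A <> c%:M, \tr A = 0 & \det A = 0].

Lemma nilpotent2_eig A z : jordan2 A -> \det (z%:M - A) = 0 -> z = 0.
Proof.
move=> [_ trA detA].
have t0 : A 0 0 + A 1 1 = 0 by rewrite -(tr_mx2 _ (A 0 1) (A 1 0)) -mx2E.
have d0 : A 0 0 * A 1 1 - A 0 1 * A 1 0 = 0 by rewrite -det_mx2 -mx2E.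
rewrite {1}(mx2E A) scalar_mx2.
have -> : mx2 z 0 0 z - mx2 (A 0 0) (A 0 1) (A 1 0) (A 1 1) =
    mx2 (z - A 0 0) (- A 0 1) (- A 1 0) (z - A 1 1).
  by apply/matrixP => -[[|[|i]] hi] -[[|[|j]] hj]; rewrite !mxE //= sub0r.
rewrite det_mx2 => h; have : z ^+ 2 = 0.
  have -> : z ^+ 2 = (z - A 0 0) * (z - A 1 1) - - A 0 1 * - A 1 0 +
    z * (A 0 0 + A 1 1) - (A 0 0 * A 1 1 - A 0 1 * A 1 0) by ring.
  by rewrite h t0 d0 mulr0 addr0 subr0.
by move=> /eqP; rewrite expf_eq0 /= => /eqP.
Qed.

Lemma nilpotent_ball A : jordan2 A -> ball A.
Proof. by move=> hA; apply/ballP => // z /(nilpotent2_eig hA) ->; rewrite modulus0. Qed.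

Lemma nilpotent_reach A B z1 z2 w t k a : jordan2 A -> ball B ->
  D z1 -> \tr B = z1 + z2 -> \det B = z1 * z2 ->
  geodesic (z1 + z2) (z1 * z2) w t k -> D t -> D a -> modulus t < modulus a -> reach A B a.
Proof.
move=> jA hB D1 hs hp hg Dt Da ta; have [A_nonscalar trA detA] := jA.
have a0 : a != 0 by rewrite -modulus_gt0; apply: le_lt_trans ta; exact: modulus_ge0.
have hA := nilpotent_ball jA.
have [[c Bc]|/forallNP Bn] := pselect (exists c, B = c%:M); last first.
  have [P Pu hP] := nonscalar_companion2 Bn.
  have [Q Qu hQ] := nonscalar_companion2 A_nonscalar.
  rewrite trA detA in hQ; rewrite hs hp in hP.
  have r : reach (companion2 0 0) (companion2 (z1 + z2) (z1 * z2)) a.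
    apply: (@pair_reach R 2 (@rev_ord 2) (@rev_ordK 2) _ _ _ _ w t a k _ _ hg) => //.
    - by move=> -[[|[|i]] hi].
    - by rewrite ltW.
    - by move=> i _; rewrite modulus0 modulus_ge0.
  have PB : B = invmx P *m companion2 (z1 + z2) (z1 * z2) *m invmx (invmx P).
    by rewrite invmxK -mulmxA -hP mulKmx.
  have QA : A = invmx Q *m companion2 0 0 *m invmx (invmx Q).
    by rewrite invmxK -mulmxA -hQ mulKmx.
  rewrite PB; apply: reach_conj_r => //; first by rewrite unitmx_inv.
  by rewrite QA; apply: reach_conj_l => //; rewrite unitmx_inv.
have n0 : (0 < 2)%N by [].
have mc : modulus c = modulus t.
  have hw : unimod w by case: hg.
  move: (hs) (hp); rewrite Bc scalar_mx2 tr_mx2 det_mx2 mulr0 subr0 => es ep.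
  have := geodesicE hg Dt; rewrite -es -ep => /(congr1 (@modulus R)).
  have -> : w * (2 * w * (c * c) - (c + c)) = - (w * c) * (2 - w * (c + c)) by ring.
  rewrite !modulusM modulusN modulusM hw mul1r => /mulIf; apply.
  rewrite modulus_eq0 es; have [z1' [z2' [D1' D2' e1 e2]]] := eig_pair hB.
  have := @bidisc_lt R w z1' z2' hw D1' D2'.
  rewrite -modulus_gt0 -hs e1; apply: le_lt_trans; exact: modulus_ge0.
have Dc : D c by rewrite /unit_disc /= mc.
have r : reach 0 (mobmx c A) a.
  refine (reach0 n0 Da (mobmx_ball n0 Dc hA) _) => l.
  move=> /eigP [v v0 hv]; have [m hm ->] := mobmx_eig_inv n0 Dc hA v0 hv.
  have -> : m = 0 by apply: (nilpotent2_eig jA); apply/eigP; exists v.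
  by rewrite mob0 mc.
apply: reach_sym; have := reach_mobmx n0 Dc r; rewrite mobmxK //.
have -> : mobmx c 0 = B; last by [].
by rewrite Bc /mobmx subr0 scaler0 subr0 invmx1 mulmx1.
Qed.

(** The infimum for a nonzero nilpotent matrix is the modulus of the parameter of
    the geodesic, which is also the maximum over the unit circle of the functions of
    [bidisc_lt]; these are equicontinuous. *)
Lemma nilpotent_lempert A B : jordan2 A -> ball B -> 
  (forall w, unimod w -> modulus (2 * w * \det B - \tr B) <=
     lempert ball A B * modulus (2 - w * \tr B)) /\
  exists2 w, unimod w &
    modulus (2 * w * \det B - \tr B) = lempert ball A B * modulus (2 - w * \tr B).
Proof.
move=> jA hB; have [_ trA detA] := jA; have [z1 [z2 [D1 D2 hs hp]]] := eig_pair hB.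
have [w [t [k [hg Dt]]]] := geodesic_exists D1 D2.
have hw : unimod w by case: hg.
have lb w' a : unimod w' -> reach A B a -> modulus (2 * w' * \det B - \tr B) <=
    modulus a * modulus (2 - w' * \tr B).
  by move=> hw'; exact: bidisc_schwarz hw' trA detA.
have q w' : unimod w' -> 0 < modulus (2 - w' * \tr B).
  by move=> hw'; rewrite hs; apply: le_lt_trans (bidisc_lt hw' D1 D2); exact: modulus_ge0.
have tE : modulus (2 * w * \det B - \tr B) = modulus t * modulus (2 - w * \tr B).
  have := geodesicE hg Dt; rewrite -hs -hp => /(congr1 (@modulus R)).
  by rewrite unimod_scale // modulusM.
have hr (c : R) : modulus t < c -> c < 1 -> reach A B (ofR c).
  move=> tc c1; have [Dc mc] := disc_ofR (le_lt_trans (modulus_ge0 t) tc) c1.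
  by apply: (nilpotent_reach jA hB D1 hs hp hg Dt Dc); rewrite mc.
have lE : lempert ball A B = modulus t.
  apply: lempert_eq_infimum hr _; first by rewrite modulus_ge0.
  by move=> a ha; rewrite -(ler_pM2r (q w hw)) -tE; exact: lb.
have ne : exists a, reach A B a.
  exists (ofR ((modulus t + 1) / 2)); apply: hr; move: Dt; rewrite /unit_disc /=; clear; lra.
split; last by exists w => //; rewrite lE.
move=> w' hw'; rewrite -ler_pdivrMr ?q //; apply: le_lempert => // a ha.
by rewrite ler_pdivrMr ?q //; exact: lb.
Qed.

Lemma bidisc_lipschitz (w s p s' p' : C) (r d : R) : unimod w -> modulus p <= 1 ->
  0 < r -> modulus s <= 2 - r -> modulus s' <= 2 - r ->
  modulus (s' - s) <= d -> modulus (p' - p) <= d ->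
  modulus (2 * w * p - s) / modulus (2 - w * s) <=
  modulus (2 * w * p' - s') / modulus (2 - w * s') + 16 * d / r ^+ 2.
Proof.
move=> hw p1 r0 hs hs' ds dp.
have q x : modulus x <= 2 - r -> r <= modulus (2 - w * x).
  move=> hx; have := modulus_ge_sub 2 (w * x).
  by rewrite unimod_scale // -ofR_nat modulus_ofR ger0_norm //; move: hx; clear; lra.
have q1 := q s hs; have q2 := q s' hs'.
have p1' := lt_le_trans r0 q1; have p2' := lt_le_trans r0 q2.
rewrite -lerBlDl -!modulus_div.
apply: le_trans (modulus_ge_sub _ _) _.
have -> : (2 * w * p - s) / (2 - w * s) - (2 * w * p' - s') / (2 - w * s') =
  (2 * (s' - s) - 4 * w * (p' - p) + 2 * w ^+ 2 * (s * (p' - p) - p * (s' - s))) /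
   ((2 - w * s) * (2 - w * s')).
  by field; rewrite -!modulus_gt0 p1' p2'.
rewrite modulus_div modulusM ler_pdivrMr ?mulr_gt0 //.
have d0 : 0 <= d := le_trans (modulus_ge0 _) ds.
apply: (@le_trans _ _ (16 * d)); last first.
  rewrite mulrAC -mulrA ler_peMr ?mulr_ge0 // ler_pdivlMr ?exprn_gt0 // mul1r expr2.
  by apply: ler_pM => //; exact: ltW.
have two : modulus (2 : C) = 2 by rewrite -ofR_nat modulus_ofR ger0_norm.
have four : modulus (4 : C) = 4 by rewrite -ofR_nat modulus_ofR ger0_norm.
have h1 : modulus (2 * (s' - s)) <= 2 * d by rewrite modulusM two ler_pM2l.
have h2 : modulus (4 * w * (p' - p)) <= 4 * d by rewrite !modulusM four hw mulr1 ler_pM2l.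
have h3 : modulus (s * (p' - p)) <= 2 * d.
  by rewrite modulusM; apply: ler_pM; rewrite ?modulus_ge0 //; move: hs r0; clear; lra.
have h4 : modulus (p * (s' - s)) <= d.
  by rewrite modulusM -[d]mul1r; apply: ler_pM; rewrite ?modulus_ge0.
have h5 : modulus (2 * w ^+ 2 * (s * (p' - p) - p * (s' - s))) <= 2 * (2 * d + d).
  rewrite modulusM modulusM modulusX hw expr1n mulr1 two ler_pM2l //.
  by apply: le_trans (modulusB _ _) _; exact: lerD.
apply: le_trans (modulusD _ _) _; have := modulusB (2 * (s' - s)) (4 * w * (p' - p)).
by move: h1 h2 h5 d0; clear; lra.
Qed.

Lemma cont_jordan2 A : jordan2 A -> cont A.
Proof.
move=> jA; apply/contP => B hB e e0.
have [z1 [z2 [D1 D2 hs hp]]] := eig_pair hB.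
have s2 : modulus (\tr B) < 2.
  by rewrite hs; apply: le_lt_trans (modulusD _ _) _; move: D1 D2; rewrite /unit_disc /=; clear; lra.
pose r := (2 - modulus (\tr B)) / 2.
have r0 : 0 < r by rewrite divr_gt0 // subr_gt0.
pose d := Num.min r (e * r ^+ 2 / 32).
have d0 : 0 < d by rewrite lt_min r0 !divr_gt0 // mulr_gt0 // exprn_gt0.
have ctr : contAt B (fun B : 'M[C]_2 => \tr B) := fr_tr (cont_ring B) (@cont_entries R 2 B).
have cdet : contAt B (fun B : 'M[C]_2 => \det B) := fr_det (cont_ring B) (@cont_entries R 2 B).
have : \forall B' \near B, modulus (\tr (B' : 'M[C]_2) - \tr B) < d /\
    modulus (\det B' - \det B) < d.
  by apply: filterI; [exact: (cont_near ctr d0)|exact: (cont_near cdet d0)].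
move=> /nbhsMP [d' d'0 hd']; exists d' => // B' hB' /(hd' B') [ds dp].
have [u1 [w1 hw1 l1]] := nilpotent_lempert jA hB.
have [u2 [w2 hw2 l2]] := nilpotent_lempert jA hB'.
have q X w : ball X -> unimod w -> 0 < modulus (2 - w * \tr X).
  move=> hX hw; have [x1 [x2 [Dx1 Dx2 -> _]]] := eig_pair hX.
  by apply: le_lt_trans (bidisc_lt hw Dx1 Dx2); exact: modulus_ge0.
have det1 X : ball X -> modulus (\det X) <= 1.
  move=> /eig_pair [x1 [x2 [Dx1 Dx2 _ ->]]]; rewrite modulusM -[leRHS]mulr1.
  by apply: ler_pM; rewrite ?modulus_ge0 //; exact: ltW.
have dr : d <= r by rewrite ge_min lexx.
have de : 16 * d / r ^+ 2 <= e / 2.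
  rewrite ler_pdivrMr ?exprn_gt0 //.
  have -> : e / 2 * r ^+ 2 = 16 * (e * r ^+ 2 / 32) by field.
  by rewrite ler_pM2l // ge_min lexx orbT.
have b1 : modulus (\tr B) <= 2 - r by rewrite /r; move: s2; clear; lra.
have b2 : modulus (\tr B') <= 2 - r.
  have := modulus_ge_sub (\tr B') (\tr B); move: ds dr; rewrite /r; clear; lra.
have k1 : lempert ball A B <= lempert ball A B' + e / 2.
  have := bidisc_lipschitz hw1 (det1 _ hB) r0 b1 b2 (ltW ds) (ltW dp).
  rewrite l1 mulfK ?gt_eqF ?q //.
  have := u2 w1 hw1; rewrite -ler_pdivrMr ?q //.
  by move=> h1 h2; apply: le_trans h2 _; exact: lerD.
have k2 : lempert ball A B' <= lempert ball A B + e / 2.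
  rewrite modulusC in ds; rewrite modulusC in dp.
  have := bidisc_lipschitz hw2 (det1 _ hB') r0 b2 b1 (ltW ds) (ltW dp).
  rewrite l2 mulfK ?gt_eqF ?q //.
  have := u1 w2 hw2; rewrite -ler_pdivrMr ?q //.
  by move=> h1 h2; apply: le_trans h2 _; exact: lerD.
rewrite ltr_norml; move: k1 k2 e0; clear.
by move: (lempert _ _ _) (lempert _ _ _) => x y ? ? ?; apply/andP; split; lra.
Qed.

End TwoByTwo.

(** * Lower bounds for discs ending at a nearly scalar matrix *)

Section Pencil.
Context {R : realType} {n : nat}.
Local Notation C := (Cplx R).
Local Notation D := (@unit_disc R).
Local Notation N := n.+1.
Local Notation ball := (spectral_ball R N).
Implicit Types (A B : 'M[C]_N).

Lemma derivable_ring (x : C) : fun_ring (fun f : C -> C => derivable f x 1).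
Proof.
split=> [c|f g hf hg|f g hf hg]; first exact: derivable_cst.
  exact: (derivableD hf hg).
exact: (derivableM hf hg).
Qed.

Lemma poly_ext (p q : {poly C}) : (forall z, p.[z] = q.[z]) -> p = q.
Proof.
move=> h; apply/eqP; rewrite -subr_eq0; apply: contraT => nz.
have := @max_poly_roots _ (p - q) [seq (k%:R : C) | k <- iota 0 (size (p - q))] nz.
rewrite size_map size_iota ltnn => -> //.
  by apply/allP => z _; rewrite rootE !hornerE h subrr.
by rewrite map_inj_uniq ?iota_uniq // => i j /eqP; rewrite eqr_nat => /eqP.
Qed.

Lemma char_poly_similar m (P A B : 'M[C]_m) : P \in unitmx -> P *m A = B *m P ->
  char_poly A = char_poly B.
Proof.
move=> Pu PA; refine (@poly_ext (char_poly A) (char_poly B) _) => z.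
have e : \det (z%:M - A) = \det (z%:M - B) := det_similar z Pu PA.
exact: (etrans (horner_char_poly A z) (etrans e (esym (horner_char_poly B z)))).
Qed.

Lemma coef_prod_bound (s : seq C) (r : R) i : 0 <= r -> (forall x, x \in s -> modulus x <= r) ->
  modulus (\prod_(x <- s) ('X - x%:P))`_i <= (1 + r) ^+ size s.
Proof.
move=> r0; elim: s i => [|x s ih] i hs.
  by rewrite big_nil coef1 /=; case: eqP; rewrite ?modulus1 ?modulus0.
rewrite big_cons mulrBl coefB coefXM coefCM exprS.
have {}ih j : modulus (\prod_(x <- s) ('X - x%:P))`_j <= (1 + r) ^+ size s.
  by apply: ih => y ys; apply: hs; rewrite inE ys orbT.
have xr : modulus x <= r by apply: hs; rewrite inE eqxx.
have e0 : 0 <= (1 + r) ^+ size s by rewrite exprn_ge0 // addr_ge0.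
apply: le_trans (modulusB _ _) _; rewrite mulrDl mul1r; apply: lerD.
  by case: eqP => _; rewrite ?modulus0 //.
by rewrite modulusM; apply: ler_pM; rewrite ?modulus_ge0.
Qed.

Lemma coef_char_bound B (r : R) i : 0 <= r -> 
  (forall z, \det (z%:M - B) = 0 -> modulus z <= r) ->
  modulus (char_poly B)`_i <= (1 + r) ^+ N.
Proof.
move=> r0 hB; have [P [U [Pu tU PB]]] := trigonalize B.
rewrite (char_poly_similar Pu PB) char_poly_trig //.
have := @coef_prod_bound [seq U i i | i <- enum 'I_N] r i r0.
rewrite big_map size_map size_enum_ord big_enum /=; apply => _ /mapP [j _ ->].
by apply: hB; rewrite (det_similar _ Pu PB); apply/eig_trig => //; exists j.
Qed.

(** If [f a] is scalar up to one row then [f - b] is divisible by [z - a] in all rows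
    but one, so that [z - a] comes out of the characteristic polynomial of the
    family [n] times, and the quotients obey the maximum principle. *)
Lemma pencil (f : C -> 'M[C]_N) (a b c : C) (k : 'I_N) :
  mxK (@hol R) f -> (forall z, D z -> ball (f z)) ->
  f a = b%:M + c *: delta_mx k k -> modulus a <= 4^-1 -> modulus b <= 1 ->
  exists K : C -> {poly C},
  [/\ polyK (@ahol R) K, a != 0 -> polyK (fun g : C -> C => derivable g 0 1) K,
      forall z i, z != a ->
        (z - a) ^+ n * (K z)`_i = (z - a) ^+ i * (char_poly (b%:M - f z))`_i,
      forall z y, (z - a) ^+ n * (K z).[y] = \det (((z - a) * y - b)%:M + f z) &
      forall z i, D z -> modulus (K z)`_i <= 24 ^+ N].
Proof.
move=> hf hb fa a4 b1.
have Da : D a by apply: le_lt_trans a4 _; rewrite invf_lt1 // ltr1n.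
have hq ij : exists h : C -> C, [/\ ahol h, forall z, f z ij.1 ij.2 = f a ij.1 ij.2 + (z - a) * h z &
    forall z, D z -> z != a -> derivable h z 1].
  have [h h1 [h2 h3]] := ahol_quotient Da (hol_ahol (hf ij.1 ij.2)) (holP (hf ij.1 ij.2) Da).
  by exists h; split=> // z Dz za; apply: h3 => //; exact: (holP (hf ij.1 ij.2) Dz).
have /choice [Psi hPsi] := hq.
pose Mz z : 'M[{poly C}]_N := \matrix_(i, j)
  (if i == k then (z - a)%:P * ('X *+ (i == j) + (Psi (i, j) z)%:P) + (c *+ (k == j))%:P
   else 'X *+ (i == j) + (Psi (i, j) z)%:P).
pose K z := \det (Mz z).
have hK (Q : (C -> C) -> Prop) : fun_ring Q -> (forall ij, Q (Psi ij)) -> Q id -> polyK Q K.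
  move=> Qr QP Qid; apply: (fr_det (poly_ring Qr)) => i j.
  have pc g : Q g -> polyK Q (fun z => (g z)%:P).
    move=> Qg l; apply: (fr_ext (f := fun z => if l == 0%N then g z else 0)).
      by move=> z; rewrite coefC.
    by case: (l == 0%N) => //; exact: (fr_cst Qr).
  have Pr := poly_ring Qr.
  have e0 : polyK Q (fun z => 'X *+ (i == j) + (Psi (i, j) z)%:P).
    exact: (fr_add Pr (fr_cst Pr _) (pc _ (QP _))).
  have e1 : polyK Q (fun z => (z - a)%:P * ('X *+ (i == j) + (Psi (i, j) z)%:P) + (c *+ (k == j))%:P).
    exact: (fr_add Pr (fr_mul Pr (pc _ (fr_sub Qr Qid (fr_cst Qr _))) e0) (fr_cst Pr _)).
  apply: (fr_ext (K := polyK Q) (f := fun z => if i == k then (z - a)%:P * ('X *+ (i == j) + (Psi (i, j) z)%:P) + (c *+ (k == j))%:P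
     else 'X *+ (i == j) + (Psi (i, j) z)%:P)); first by move=> z; rewrite mxE.
  by case: (i == k).
have Kval z y : (z - a) ^+ n * (K z).[y] = \det (((z - a) * y - b)%:M + f z).
  have -> : (K z).[y] = \det (map_mx (fun p : {poly C} => p.[y]) (Mz z)).
    by rewrite /K -horner_evalE -det_map_mx.
  have -> : (z - a) ^+ n = \det (diag_mx (\row_i (if i == k then 1 else z - a))).
    rewrite det_diag (bigD1 k) //= mxE eqxx mul1r.
    rewrite (eq_bigr (fun=> z - a)); last by move=> i ik; rewrite mxE (negPf ik).
    by rewrite prodr_const cardC1 card_ord.
  rewrite -det_mulmx; congr (\det _); apply/matrixP => i j.
  have [_ e _] := hPsi (i, j); have {}e := e z; rewrite /= fa in e.
  rewrite mul_diag_mx !mxE e !mxE [j == k]eq_sym.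
  case: (eqVneq i k) => [->|ik] /=.
    by rewrite mul1r !hornerE /= [(k == j)]eq_sym; case: (j == k); rewrite ?mulr1n ?mulr0n !hornerE; ring.
  by rewrite !hornerE /=; case: (i == j); rewrite ?mulr1n ?mulr0n !hornerE; ring.
have Kcoef z i : z != a ->
    (z - a) ^+ n * (K z)`_i = (z - a) ^+ i * (char_poly (b%:M - f z))`_i.
  move=> za.
  have : (z - a) ^+ n *: K z = \poly_(i < N.+1) ((z - a) ^+ i * (char_poly (b%:M - f z))`_i).
    apply: poly_ext => y; rewrite hornerZ Kval horner_poly.
    have -> : ((z - a) * y - b)%:M + f z = ((z - a) * y)%:M - (b%:M - f z).
      by rewrite raddfB /= opprB addrCA addrC.
    rewrite det_coef; apply: eq_bigr => j _; rewrite exprMn; ring.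
  move=> /(congr1 (fun p : {poly C} => p`_i)); rewrite coefZ coef_poly => ->.
  case: ltnP => // hi; rewrite [(char_poly _)`_i]nth_default ?mulr0 //.
  by rewrite size_char_poly.
exists K; split=> //.
- by apply: (hK _ ahol_ring) => [ij|]; [case: (hPsi ij)|exact: hol_ahol (@hol_id R)].
- move=> a0; apply: (hK _ (derivable_ring 0)) => [ij|]; last exact: derivable_id.
  by have [_ _ h] := hPsi ij; apply: h; [exact: D0|rewrite eq_sym].
move=> z i Dz.
have hKi : ahol (fun z => (K z)`_i).
  have := hK _ ahol_ring; apply; last exact: hol_ahol (@hol_id R).
  by move=> ij; case: (hPsi ij).
(* Outside of the disc of radius [1 / 2] the modulus of [z - a] is between [1 / 4] and
   [2], and the eigenvalues of [b - f z] have modulus at most [2], so that the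
   coefficients of the characteristic polynomial are at most [3 ^ N]. *)
apply: (ahol_bound hKi) Dz => e e0; exists 2^-1; first by rewrite invf_lt1 // ltr1n.
move=> w /andP [w2 w1]; apply: le_trans (_ : _ <= 24 ^+ N) _; last by rewrite lerDl ltW.
have Dw : D w := w1.
have wa : 4^-1 <= modulus (w - a).
  have := modulus_ge_sub w a; move: a4 w2; clear; lra.
have wa2 : modulus (w - a) <= 2.
  by have := modulusB w a; move: a4 w1; clear; lra.
have wan : w != a by rewrite -subr_eq0 -modulus_gt0; apply: lt_le_trans wa; rewrite invr_gt0.
have [iN|iN] := ltnP N i.
  have : (w - a) ^+ n * (K w)`_i = 0.
    by rewrite Kcoef // [(char_poly _)`_i]nth_default ?mulr0 // size_char_poly.
  move=> /eqP; rewrite mulf_eq0 expf_eq0 subr_eq0 (negPf wan) andbF /= => /eqP ->.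
  by rewrite modulus0 exprn_ge0.
have cb : modulus (char_poly (b%:M - f w))`_i <= 3 ^+ N.
  have -> : (3 : R) = 1 + 2 by ring.
  apply: coef_char_bound => // l hl.
  have : \det ((b - l)%:M - f w) = 0.
    have -> : (b - l)%:M - f w = - (l%:M - (b%:M - f w)).
      by apply/matrixP => u v; rewrite !mxE; case: (u == v); rewrite ?mulr1n ?mulr0n; ring.
    by rewrite -scaleN1r detZ hl mulr0.
  move=> /(ballP _ (ltn0Sn n)).1 -/(_ (hb w Dw)) h.
  have := modulus_ge_sub l b; rewrite modulusC in h; move: h b1; clear; lra.
have p4 : 0 < modulus (w - a) ^+ n.
  by rewrite exprn_gt0 // modulus_gt0 subr_eq0.
rewrite -(ler_pM2l p4) -modulusX -modulusM Kcoef // modulusM modulusX.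
have -> : (24 : R) = 2 * 3 * 4 by ring.
rewrite !exprMn.
apply: (@le_trans _ _ (2 ^+ N * 3 ^+ N)).
  apply: ler_pM; rewrite ?modulus_ge0 ?exprn_ge0 ?modulus_ge0 //.
  apply: (@le_trans _ _ (2 ^+ i)); first by rewrite lerXn2r ?nnegrE ?modulus_ge0.
  by rewrite ler_eXn2l // ltr1n.
rewrite modulusX mulrCA ler_peMr ?mulr_ge0 ?exprn_ge0 //.
rewrite exprS mulrCA -exprMn; apply: (@le_trans _ _ 4); first by rewrite ler1n.
rewrite ler_peMr // exprn_ege1 //.
by rewrite -ler_pdivrMr // mul1r.
Qed.

Lemma ahol_zero (f : C -> C) : ahol f -> (forall z, D z -> z != 0 -> f z = 0) -> f 0 = 0.
Proof.
move=> hf h; apply/eqP; rewrite -modulus_eq0 eq_le modulus_ge0 andbT.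
apply: (ahol_bound hf) (@D0 R) => e e0; exists 0 => // z /andP [z0 z1].
by rewrite h ?modulus0 ?addr_ge0 ?(ltW e0) // -modulus_gt0.
Qed.

(** At [z = y = 0] the pencil writes [(- b)^(n+1)] as a bounded multiple of [a^n]. *)
Lemma lower_regular A (a b c : C) (k : 'I_N) : reach A (b%:M + c *: delta_mx k k) a ->
  \det (A - b%:M) = (- b) ^+ N -> modulus a <= 4^-1 -> modulus b <= 1 ->
  modulus b ^+ N <= 24 ^+ N * modulus a ^+ n.
Proof.
move=> /reachP [Da [f [hf hb f0 fa]]] dA a4 b1.
have [K [_ _ _ hK hM]] := pencil hf hb fa a4 b1.
have := hK 0 0; rewrite f0 mulr0 !sub0r raddfN /= addrC dA horner_coef0 => /(congr1 (@modulus R)).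
rewrite modulusM !modulusX !modulusN => <-; rewrite mulrC ler_wpM2r ?exprn_ge0 ?modulus_ge0 //.
exact: hM D0.
Qed.

(** In a reduced form of [A] at least two rows of the perturbed matrix are divisible
    by [z]. *)
Lemma det_corank2 A (X : C -> 'M[C]_N) : (\rank A <= n.-1)%N -> (0 < n)%N -> mxK (@ahol R) X ->
  exists2 g, ahol g & forall z, \det (A + z *: X z) = z ^+ 2 * g z.
Proof.
move=> rA n0 hX; set r := \rank A.
pose L := col_ebase A; pose U := row_ebase A; pose X' z := invmx L *m X z *m invmx U.
have Lu : L \in unitmx := col_ebase_unit A; have Uu : U \in unitmx := row_ebase_unit A.
have rn : (r.+2 <= N)%N by rewrite /r; move: rA n0; lia.
pose W z : 'M[C]_N := \matrix_(i, j) if (i < r)%N then (pid_mx r + z *: X' z) i j else X' z i j.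
have hX' : mxK (@ahol R) X'.
  exact: (mxK_mul ahol_ring (mxK_mul ahol_ring (mxK_cst ahol_ring _) hX) (mxK_cst ahol_ring _)).
have hid : ahol (fun z : C => z) := hol_ahol (@hol_id R).
have hW : mxK (@ahol R) W.
  move=> i j; apply: (fr_ext (K := @ahol R) (f := fun z => if (i < r)%N then
    (pid_mx r + z *: X' z) i j else X' z i j)); first by move=> z; rewrite [RHS]mxE.
  case: (i < r)%N => //.
  exact: (mxK_add ahol_ring (mxK_cst ahol_ring _) (mxK_scale ahol_ring hid hX')).
exists (fun z => \det L * \det U * (z ^+ (N - r).-2 * \det (W z))).
  exact: (aholM (ahol_cst _) (aholM (fr_exp ahol_ring _ hid) (fr_det ahol_ring hW))).
move=> z.
have -> : A + z *: X z = L *m (pid_mx r + z *: X' z) *m U.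
  rewrite mulmxDr mulmxDl mulmx_ebase -scalemxAr -scalemxAl; congr (_ + _ *: _).
  by rewrite /X' !mulmxA (mulmxV Lu) mul1mx (mulmxKV Uu).
have -> : pid_mx r + z *: X' z = diag_mx (\row_i (if (i < r)%N then 1 else z)) *m W z.
  apply/matrixP => i j; rewrite mul_diag_mx !mxE.
  by case: ltnP => ir; rewrite ?mul1r // andbF mulr0n add0r.
rewrite !det_mulmx det_diag.
have -> : \prod_(i < N) (\row_(i0 < N) (if (i0 < r)%N then 1 else z)) 0 i = z ^+ 2 * z ^+ (N - r).-2 :> C.
  rewrite -(exprD z 2 (N - r).-2).
  have -> : (2 + (N - r).-2 = N - r)%N by lia.
  rewrite (eq_bigr (fun i : 'I_N => if (i < r)%N then 1 else z)); last by move=> i _; rewrite mxE.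
  rewrite -(big_mkord xpredT (fun i => if (i < r)%N then 1 else z)).
  rewrite (big_cat_nat (n := r)) //=; last by lia.
  rewrite big_nat_cond big1 ?mul1r; last by move=> i; rewrite andbT => /andP [_ ->].
  rewrite big_nat_cond (eq_bigr (fun=> z)); last by move=> i; rewrite andbT leqNgt => /andP [/negPf ->].
  by rewrite -big_nat_cond prodr_const_nat.
move: (\det L) (\det U) (\det (W z)) (z ^+ _) (z ^+ _) => x1 x2 x3 x4 x5; clear; ring.
Qed.

Lemma root_bound (y C0 : R) m : 0 <= y -> 0 <= C0 -> (0 < m)%N ->
  y ^+ m <= \sum_(i < m) C0 * y ^+ i -> y <= 1 + m%:R * C0.
Proof.
move=> y0 c0 m0 h; have [y1|y1] := leP y 1.
  by apply: le_trans y1 _; rewrite lerDl mulr_ge0.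
apply: ler_wpDl => //; have yp : 0 < y ^+ m.-1 by rewrite exprn_gt0 // (lt_trans _ y1).
rewrite -(ler_pM2r yp) -exprS prednK //; apply: le_trans h _.
rewrite -mulrA mulr_natl -[X in _ *+ X](card_ord m) -sumr_const; apply: ler_sum => i _; rewrite ler_wpM2l //.
by rewrite ler_eXn2l //; have := ltn_ord i; lia.
Qed.

(** If the starting point has corank two then the endpoint is at most linear in the
    parameter: at [y = - b / a] the pencil vanishes to second order at the origin. *)
Lemma lower_corank2 A (a b c : C) (k : 'I_N) : reach A (b%:M + c *: delta_mx k k) a ->
  (\rank A <= n.-1)%N -> (0 < n)%N -> a != 0 -> modulus a <= 4^-1 -> modulus b <= 1 ->
  modulus b <= (1 + N%:R * (4 * 24 ^+ N)) * modulus a.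
Proof.
move=> /reachP [Da [f [hf hb f0 fa]]] rA n0 a0 a4 b1.
have [K [aK dK Kc hK hM]] := pencil hf hb fa a4 b1.
pose y := - b / a.
have D0 := @D0 R.
have hq ij : exists2 h : C -> C, ahol h & forall z, f z ij.1 ij.2 = f 0 ij.1 ij.2 + z * h z.
  have [h h1 [h2 _]] := ahol_quotient D0 (hol_ahol (hf ij.1 ij.2)) (holP (hf ij.1 ij.2) D0).
  by exists h => // z; rewrite h2 subr0.
have /choice [Psi hPsi] : forall ij, exists h : C -> C, ahol h /\ forall z, f z ij.1 ij.2 = f 0 ij.1 ij.2 + z * h z.
  by move=> ij; have [h] := hq ij; exists h.
pose X z : 'M[C]_N := \matrix_(i, j) (y *+ (i == j) + Psi (i, j) z).
have hX : mxK (@ahol R) X.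
  move=> i j; apply: (fr_ext (K := @ahol R) (f := fun z => y *+ (i == j) + Psi (i, j) z)).
    by move=> z; rewrite mxE.
  exact: (aholD (ahol_cst _) (hPsi _).1).
have [g hg gE] := det_corank2 rA n0 hX.
have e1 z : (z - a) ^+ n * (K z).[y] = z ^+ 2 * g z.
  rewrite hK -gE; congr (\det _); apply/matrixP => i j.
  have := (hPsi (i, j)).2 z; rewrite /= f0 => hij; rewrite !mxE hij.
  have -> : (z - a) * y - b = z * y by rewrite /y; field.
  by case: (i == j); rewrite ?mulr1n ?mulr0n; ring.
have hk (i : 'I_N) : exists h : C -> C, [/\ ahol h, forall z, (K z)`_i = (K 0)`_i + z * h z &
    forall z, D z -> modulus (h z) <= 4 * 24 ^+ N].
  have [h h1 [h2 _]] := ahol_quotient D0 (aK i) (dK a0 i).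
  have hE z : (K z)`_i = (K 0)`_i + z * h z by rewrite h2 subr0.
  exists h; split=> // z Dz; apply: (ahol_bound h1) Dz => e e0.
  exists 2^-1; first by rewrite invf_lt1 // ltr1n.
  move=> w /andP [w2 w1]; apply: (@le_trans _ _ (4 * 24 ^+ N)); last by rewrite lerDl ltW.
  have := hM w i w1; have := hM 0 i D0; have := modulusB (K w)`_i (K 0)`_i.
  rewrite hE addrC addKr modulusM; have := modulus_ge0 (h w).
  move: w2; clear; move: (24 ^+ N) => M; nra.
have /choice [h hh] := hk.
have P0 : (K 0).[y] = 0.
  have := e1 0; rewrite expr0n /= mul0r sub0r => /eqP.
  by rewrite mulf_eq0 expf_eq0 oppr_eq0 (negPf a0) andbF => /eqP.
have KN z : z != a -> (K z).[y] = \sum_(i < N) (K z)`_i * y ^+ i + (z - a) * y ^+ N.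
  move=> za; have zn : (z - a) ^+ n != 0 by rewrite expf_neq0 // subr_eq0.
  have sK : (size (K z) <= N.+1)%N.
    apply/leq_sizeP => j hj; apply: (mulfI zn); rewrite Kc // mulr0.
    by rewrite [(char_poly _)`_j]nth_default ?mulr0 // size_char_poly.
  rewrite (horner_coef_wide _ sK) big_ord_recr /=; congr (_ + _ * _).
  apply: (mulfI zn); rewrite Kc // -exprSr.
  have := char_poly_monic (b%:M - f z); rewrite monicE lead_coefE size_char_poly /= => /eqP ->.
  by rewrite mulr1.
(* [S] is the quotient of [(K z).[y]] by [z]; the leading coefficient [z - a] of [K z]
   contributes the term [y ^ N]. *)
pose S z := \sum_(i < N) h i z * y ^+ i + y ^+ N.
have hS : ahol S.
  apply: (aholD _ (ahol_cst _)); apply: (fr_sum ahol_ring) => i _.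
  by apply: (aholM _ (ahol_cst _)); case: (hh i).
have SE z : z != a -> (K z).[y] = z * S z.
  move=> za; have -> : (K z).[y] = (K z).[y] - (K 0).[y] by rewrite P0 subr0.
  rewrite (KN z) // (KN 0) 1?eq_sym // /S mulrDr mulr_sumr.
  have -> : \sum_(i < N) (K z)`_i * y ^+ i = \sum_(i < N) (K 0)`_i * y ^+ i +
      \sum_(i < N) z * (h i z * y ^+ i).
    rewrite -big_split /=; apply: eq_bigr => i _; have [_ -> _] := hh i; ring.
  ring.
have S0 : S 0 = 0.
  have hF : ahol (fun z => (z - a) * ((z - a) ^+ n * S z - z * g z)).
    have hid : ahol (fun z : C => z) := hol_ahol (@hol_id R).
    have hza : ahol (fun z => z - a) := fr_sub ahol_ring hid (ahol_cst a).
    exact: (aholM hza (fr_sub ahol_ring (aholM (fr_exp ahol_ring n hza) hS) (aholM hid hg))).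
  have := ahol_zero hF; rewrite /= sub0r mul0r subr0 => hz.
  have : - a * ((- a) ^+ n * S 0) = 0.
    apply: hz => z Dz z0; have [->|za] := eqVneq z a; first by rewrite subrr mul0r.
    have -> : (z - a) ^+ n * S z - z * g z = 0; last by rewrite mulr0.
    apply: (mulfI z0); rewrite mulr0 mulrBr !mulrA -expr2 -e1 SE //; ring.
  move=> /eqP; rewrite mulf_eq0 oppr_eq0 (negPf a0) mulf_eq0 expf_eq0 oppr_eq0 (negPf a0) andbF.
  by move=> /eqP.
have : modulus y ^+ N <= \sum_(i < N) (4 * 24 ^+ N) * modulus y ^+ i.
  have -> : modulus y ^+ N = modulus (\sum_(i < N) h i 0 * y ^+ i).
    by rewrite -modulusX -modulusN; congr modulus; apply/eqP; rewrite eq_sym -subr_eq0 opprK; apply/eqP.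
  apply: le_trans (modulus_sum _ _ _) _; apply: ler_sum => i _.
  rewrite modulusM modulusX ler_wpM2r ?exprn_ge0 ?modulus_ge0 //.
  by have [_ _ hi] := hh i; exact: hi.
move=> /root_bound -/(_ (modulus_ge0 _)) hy.
have := hy _ (ltn0Sn n); rewrite /y modulus_div modulusN ler_pdivrMr ?modulus_gt0 //; apply.
by rewrite mulr_ge0 // exprn_ge0.
Qed.

End Pencil.

(** * Nilpotent matrices of size at least three *)

Section Nilpotent.
Context {R : realType}.
Local Notation C := (Cplx R).
Local Notation D := (@unit_disc R).

Lemma roots_perm m (d e : 'I_m -> C) : (forall z, \prod_i (z - d i) = \prod_i (z - e i)) ->
  exists s : 'S_m, forall i, d i = e (s i).
Proof.
move=> h; pose t1 := [tuple d i | i < m]; pose t2 := [tuple e i | i < m].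
have : perm_eq t1 t2.
  apply: prod_XsubC_eq.
  have tE (f : 'I_m -> C) : \prod_(x <- [tuple f i | i < m]) ('X - x%:P) = \prod_i ('X - (f i)%:P).
    by rewrite big_tuple; apply: eq_bigr => i _; rewrite tnth_mktuple.
  rewrite !tE; apply: poly_ext => z; rewrite !horner_prod.
  have E (f : 'I_m -> C) : \prod_i ('X - (f i)%:P).[z] = \prod_i (z - f i).
    by apply: eq_bigr => i _; rewrite !hornerE.
  by rewrite !E.
move=> /tuple_permP [s hs]; exists s => i.
have t12 : t1 = [tuple tnth t2 (s j) | j < m] by apply: val_inj.
have := congr1 (fun t => tnth t i) t12.
by rewrite !tnth_mktuple.
Qed.

Lemma reach_lt m (A B : 'M[C]_m) (c : R) : (exists a, reach A B a) ->
  lempert (spectral_ball R m) A B < c -> exists2 a, reach A B a & modulus a < c.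
Proof.
move=> ne lt; apply: contrapT => h; move: lt; apply/negP; rewrite -leNgt.
apply: le_lempert => // a ha; rewrite leNgt; apply/negP => ac.
by apply: h; exists a.
Qed.

Context {n : nat}.
Local Notation N := n.+1.
Local Notation ball := (spectral_ball R N).
Let N0 : (0 < N)%N := ltn0Sn n.

Lemma reach_trig (A : 'M[C]_N) (d : 'rV[C]_N) (a : C) : is_trig_mx A ->
  (forall i, A i i = 0) -> D a -> a != 0 -> (forall i, modulus (d 0 i) <= modulus a) ->
  reach A (diag_mx d) a.
Proof.
move=> /is_trig_mxP tA dA Da a0 hd; apply/reachP; split=> //.
exists (fun z => (1 - z / a) *: A + (z / a) *: diag_mx d).
have hz : hol (fun z => z / a) := holM (@hol_id R) (hol_cst a^-1).
split.
- exact: (mxK_add hol_ring (mxK_scale hol_ring (holB (hol_cst 1) hz) (mxK_cst hol_ring _))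
    (mxK_scale hol_ring hz (mxK_cst hol_ring _))).
- move=> z Dz; apply: ball_trig => //.
    apply/is_trig_mxP => i j ij; rewrite !mxE tA // mulr0 add0r.
    by rewrite -val_eqE ltn_eqF // mulr0n mulr0.
  move=> i; rewrite !mxE dA mulr0 add0r eqxx mulr1n mulrAC -mulrA modulusM.
  apply: le_lt_trans Dz; rewrite ler_piMr ?modulus_ge0 // modulus_div.
  by rewrite ler_pdivrMr ?modulus_gt0 // mul1r.
- by rewrite mul0r subr0 scale1r scale0r addr0.
- by rewrite divff // subrr scale0r scale1r add0r.
Qed.

Definition shift_mx : 'M[C]_N := \matrix_(i, j) (i.+1 == j :> nat)%:R.

Definition last_row_mx (l : 'I_N -> C) : 'M[C]_N :=
  \matrix_(i, j) (if i == ord_max then l j else 0).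

Lemma mul_shift m (V : 'M[C]_(m, N)) i (j : 'I_N) : (V *m shift_mx) i j =
  if (j : nat) is k.+1 then V i (inord k) else 0.
Proof.
rewrite !mxE; case: j => -[|k] hk /=.
  by apply: big1 => l _; rewrite mxE mulr0.
rewrite (bigD1 (inord k)) //= mxE inordK ?eqxx ?mulr1; last by lia.
rewrite big1 ?addr0 // => l lk; rewrite mxE eqSS.
case: eqP => [e|]; rewrite ?mulr0 //.
by case/eqP: lk; apply: val_inj; rewrite /= inordK //; lia.
Qed.

Lemma mul_last_row m (V : 'M[C]_(m, N)) l i j : (V *m last_row_mx l) i j = V i ord_max * l j.
Proof.
rewrite !mxE (bigD1 ord_max) //= mxE eqxx big1 ?addr0 // => k /negPf kn.
by rewrite mxE kn mulr0.
Qed.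

(** The equation for an eigenvalue [z] of [c J + d L] is
    [z^(n+1) = sum of d c^(n-j) l_j z^j]. *)
Lemma shift_ball (c d : C) l :
  \sum_(j < N) modulus d * modulus c ^+ (n - j) * modulus (l j) < 1 ->
  ball (c *: shift_mx + d *: last_row_mx l).
Proof.
move=> hS; apply/ball_row => // z v v0 hv; rewrite ltNge; apply/negP => z1.
have hj (j : 'I_N) : z * v 0 j = c * (if (j : nat) is k.+1 then v 0 (inord k) else 0) +
    d * (v 0 ord_max * l j).
  have e : (v *m (c *: shift_mx + d *: last_row_mx l)) 0 j =
      c * (v *m shift_mx) 0 j + d * (v *m last_row_mx l) 0 j.
    rewrite mulmxDr -!scalemxAr; move: (v *m shift_mx) (v *m _) => X Y.
    by rewrite !mxE.
  by rewrite hv mul_shift mul_last_row mxE in e.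
pose S k := \sum_(j < k.+1) modulus d * modulus c ^+ (k - j) * modulus (l (inord j)).
have bound k : (k < N)%N -> modulus (v 0 (inord k)) <= S k * modulus (v 0 ord_max).
  elim: k => [|k ih] hk.
    have := hj (inord 0); rewrite inordK //= mulr0 add0r => /(congr1 (@modulus R)).
    rewrite !modulusM => e; rewrite /S big_ord_recl big_ord0 addr0 /= subn0 expr0 mulr1.
    rewrite mulrAC -mulrA -e; exact: ler_peMl (modulus_ge0 _) z1.
  have := hj (inord k.+1); rewrite inordK //= => /(congr1 (@modulus R)); rewrite modulusM => e.
  apply: (@le_trans _ _ (modulus z * modulus (v 0 (inord k.+1)))).
    exact: ler_peMl (modulus_ge0 _) z1.
  rewrite e; apply: le_trans (modulusD _ _) _; rewrite !modulusM.
  rewrite /S big_ord_recr /= subnn expr0 mulr1 mulrDl; apply: lerD; last first.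
    by rewrite [modulus (v _ _) * _]mulrC mulrA.
  have -> : \sum_(i < k.+1) modulus d * modulus c ^+ (k.+1 - i) * modulus (l (inord i)) =
      modulus c * S k.
    rewrite /S mulr_sumr; apply: eq_bigr => i _.
    by rewrite subSn ?exprS; [ring|rewrite -ltnS].
  rewrite -mulrA ler_wpM2l ?modulus_ge0 //; apply: ih; lia.
have vn : 0 < modulus (v 0 ord_max).
  rewrite lt_neqAle modulus_ge0 andbT eq_sym; apply: contra v0 => /eqP vn.
  apply/eqP/rowP => j; rewrite mxE; apply/eqP; rewrite -modulus_eq0 eq_le modulus_ge0 andbT.
  by have := bound j (ltn_ord j); rewrite vn mulr0 inord_val.
have := bound n (ltnSn n).
have -> : inord n = ord_max :> 'I_N by apply: val_inj; rewrite /= inordK.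
rewrite -[X in X <= _]mul1r ler_pM2r // /S leNgt => /negP; apply.
by under eq_bigr do rewrite inord_val.
Qed.

(** The diagonal matrices that test continuity. They are scalar up to one row, and
    their trace is zero, so that the coefficient of degree [n] of the characteristic
    polynomial does not contribute to the companion matrix. *)
Definition spectrum_row (k : 'I_N) : 'rV[C]_N := \row_i (if i == k then - n%:R else 1).

Definition spectrum_poly : {poly C} := char_poly (diag_mx (spectrum_row ord_max)).

Definition lastcoef (j : 'I_N) : C := - spectrum_poly`_j.

Lemma lastcoef_max : (0 < n)%N -> lastcoef ord_max = 0.
Proof.
move=> n0; rewrite /lastcoef /spectrum_poly /=.
rewrite -[X in _`_X]/(N.-1) char_poly_trace // opprK mxtrace_diag (bigD1 ord_max) //= mxE eqxx.
rewrite (eq_bigr (fun=> 1)); last by move=> i /negPf h; rewrite mxE h.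
by rewrite sumr_const cardC1 card_ord /= addNr.
Qed.

Lemma lastcoef0 : (0 < n)%N -> lastcoef ord0 != 0.
Proof.
move=> n0; rewrite oppr_eq0 /spectrum_poly /= char_poly_det mulf_eq0 signr_eq0 /= det_diag.
rewrite prodf_seq_neq0; apply/allP => i _; apply/implyP => _; rewrite mxE.
by case: (i == ord_max); rewrite ?oner_eq0 // oppr_eq0 pnatr_eq0 -lt0n.
Qed.

Lemma companion_cast m (p : {poly C}) : size p = m.+1 -> p \is monic ->
  char_poly (\matrix_(i < m, j < m) (if (i == m.-1 :> nat) then - p`_j else (i.+1 == j :> nat)%:R)) = p.
Proof.
move=> sp mp; have e : (size p).-1 = m by rewrite sp.
by case: _ / e; exact: companionmxK.
Qed.

Lemma shift_char_poly : (0 < n)%N ->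
  char_poly (shift_mx + last_row_mx lastcoef) = spectrum_poly.
Proof.
move=> n0; rewrite -[RHS](@companion_cast N spectrum_poly); last first.
- exact: char_poly_monic.
- exact: size_char_poly.
congr char_poly; apply/matrixP => i j; rewrite !mxE /= -val_eqE /=.
case: (eqVneq (nat_of_ord i) n) => [-> |_]; last by rewrite addr0.
by rewrite gtn_eqF ?add0r.
Qed.

Lemma shift_degeneration : (0 < n)%N -> exists k, forall e : R, 0 < e ->
  exists2 Q : 'M[C]_N, Q \in unitmx & forall i j,
    modulus ((Q *m (shift_mx + last_row_mx lastcoef) *m invmx Q) i j - diag_mx (spectrum_row k) i j) < e.
Proof.
move=> n0; have [d [hd hQ]] := diag_degeneration (shift_mx + last_row_mx lastcoef).
have [z|s hs] := @roots_perm N (fun i => d 0 i) (fun i => spectrum_row ord_max 0 i).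
  rewrite -hd -horner_char_poly shift_char_poly // horner_char_poly det_trig_sub ?diag_mx_is_trig //.
  by apply: eq_bigr => i _; rewrite !mxE eqxx mulr1n.
exists ((s^-1)%g ord_max).
have -> : spectrum_row ((s^-1)%g ord_max) = d.
  by apply/rowP => i; rewrite hs !mxE -(inj_eq (@perm_inj _ s)) permKV.
exact: hQ.
Qed.

End Nilpotent.

Section NilpotentDiscontinuity.
Context {R : realType} {n : nat}.
Local Notation C := (Cplx R).
Local Notation D := (@unit_disc R).
Local Notation N := n.+1.
Local Notation ball := (spectral_ball R N).
Local Notation J := (@shift_mx R n).
Local Notation L := (@last_row_mx R n (@lastcoef R n)).
Let N0 : (0 < N)%N := ltn0Sn n.

Lemma nilpotent_trig (A : 'M[C]_N) : is_trig_mx A -> (forall i, A i i = 0) -> A ^+ N = 0.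
Proof.
move=> tA dA; have := Cayley_Hamilton A.
rewrite char_poly_trig // (eq_bigr (fun=> 'X)); last by move=> i _; rewrite dA subr0.
by rewrite prodr_const card_ord rmorphXn /= horner_mx_X.
Qed.

Lemma rank_exp (A : 'M[C]_N) k : \rank A = n -> (N - k <= \rank (A ^+ k))%N.
Proof.
move=> rA; elim: k => [|k ih]; first by rewrite expr0 mxrank1 subn0.
have := mxrank_mul_min A (A ^+ k); rewrite -[A *m _]exprS rA; lia.
Qed.

(** The rows [b^-k v A^k] with [v A^n] nonzero form a Jordan basis. *)
Lemma regular_shift (A : 'M[C]_N) (b : C) : A ^+ n != 0 -> A ^+ N = 0 -> b != 0 ->
  exists2 P : 'M[C]_N, P \in unitmx & P *m A = (b *: J) *m P.
Proof.
move=> An AN b0.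
have [i0 hi0] : exists i, row i (A ^+ n) != 0.
  apply/existsP; apply: contraR An => /existsPn h; apply/eqP/row_matrixP => i.
  by apply/eqP; move: (h i); rewrite negbK row0.
pose v : 'rV[C]_N := delta_mx 0 i0.
have vAn : v *m A ^+ n != 0 by rewrite -rowE.
have vA k : (n < k)%N -> v *m A ^+ k = 0.
  by move=> nk; rewrite -(subnK nk) exprD AN mulr0 mulmx0.
pose P : 'M[C]_N := \matrix_k (b ^- k *: (v *m A ^+ k)).
exists P.
  rewrite unitmxE unitfE; apply/negP => /det0P [x x0 hx]; case/eqP: x0.
  suff h k : (k < N)%N -> x 0 (inord k) = 0.
    by apply/rowP => i; rewrite mxE -(inord_val i); exact: h.
  elim/ltn_ind: k => k ih hk.
  have : x *m P *m A ^+ (n - k) = 0 by rewrite hx mul0mx.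
  rewrite (mulmx_sum_row x P) mulmx_suml (bigD1 (inord k)) //= big1 ?addr0.
    rewrite rowK inordK // -!scalemxAl -mulmxA -[_ *m A ^+ (n - k)]exprD.
    rewrite subnKC; last by rewrite -ltnS.
    move=> /eqP; rewrite !scalemx_eq0 (negPf vAn) orbF invr_eq0 expf_eq0 (negPf b0) andbF orbF.
    by move=> /eqP.
  move=> i ik; rewrite rowK -!scalemxAl -mulmxA -[_ *m A ^+ (n - k)]exprD.
  have [ik'|ki] := ltnP i k.
    by have := ih i ik' (ltn_ord i); rewrite inord_val => ->; rewrite scale0r.
  rewrite vA ?scaler0 //; have : (k != i)%N; last by lia.
  by apply: contra ik => /eqP ->; rewrite inord_val.
apply/row_matrixP => k; rewrite row_mul rowK -[LHS]scalemxAl -[in LHS]mulmxA -[_ *m A]exprSr.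
rewrite -scalemxAl; apply/rowP => j; rewrite !mxE.
have [kn|kn] := eqVneq (nat_of_ord k) n.
  rewrite [X in b * X]big1 ?mulr0; last first.
    by move=> l _; rewrite mxE kn gtn_eqF ?mul0r.
  have hv : v *m A ^+ k.+1 = 0 by apply: vA; rewrite kn.
  by have /rowP /(_ j) := hv; rewrite !mxE => ->; rewrite mulr0.
have kN : (k.+1 < N)%N by have := ltn_ord k; lia.
rewrite [X in _ = b * X](bigD1 (Ordinal kN)) //= [J _ _]mxE eqxx mul1r.
rewrite [X in b * (_ + X)]big1 ?addr0; last first.
  by move=> l lk; rewrite mxE; case: eqP => [e|]; rewrite ?mul0r //;
    case/eqP: lk; apply: val_inj.
have -> : P (Ordinal kN) j = (b ^- k.+1 *: (v *m A ^+ k.+1)) 0 j by rewrite mxE.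
by rewrite !mxE (exprS b k) invfM mulrA mulrA divff // mul1r.
Qed.

(** Matrices of rank one and square zero are conjugate to each other. *)
Lemma rank_one_conj (l : 'I_N -> C) (b c : C) (i0 j0 : 'I_N) : (0 < n)%N ->
  l ord_max = 0 -> l ord0 != 0 -> i0 != j0 -> b != 0 -> c != 0 ->
  exists2 P : 'M[C]_N, P \in unitmx &
    P *m (b *: last_row_mx l) = (c *: delta_mx i0 j0) *m P.
Proof.
move=> n0 lm l0 ij b0 c0.
have m0 : (ord_max : 'I_N) != ord0 by rewrite -val_eqE /= -lt0n.
have [s si sj] : exists2 s : {perm 'I_N}, s i0 = ord_max & s j0 = ord0.
  pose s1 := tperm i0 ord_max; exists (s1 * tperm (s1 j0) ord0)%g.
    rewrite permM tpermL tpermD //; last by rewrite eq_sym.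
    by rewrite -(tpermL i0 (ord_max : 'I_N)) (inj_eq perm_inj) eq_sym.
  by rewrite permM tpermL.
pose P0 : 'M[C]_N := \matrix_(i, j) (if i == ord0 then b / c * l j else (i == j)%:R).
have P0u : P0 \in unitmx.
  rewrite unitmxE -det_tr det_trig; last first.
    apply/is_trig_mxP => i j ij'; rewrite !mxE ifN; last by rewrite -val_eqE /= -lt0n (leq_ltn_trans _ ij').
    by rewrite -val_eqE gtn_eqF.
  rewrite unitfE prodf_seq_neq0; apply/allP => i _; apply/implyP => _; rewrite !mxE.
  case: (eqVneq i ord0) => [->|_]; last by rewrite eqxx oner_eq0.
  by rewrite mulf_neq0 // mulf_neq0 // invr_eq0.
exists (perm_mx s *m P0); first by rewrite unitmx_mul unitmx_perm.
have e1 : P0 *m (b *: last_row_mx l) = c *: (delta_mx ord_max ord0 *m P0).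
  apply/matrixP => i j; rewrite -scalemxAr mxE mul_last_row [RHS]mxE [in RHS]mxE.
  rewrite (bigD1 ord0) //= big1 ?addr0; last first.
    by move=> k k0; rewrite mxE (negPf k0) andbF mul0r.
  rewrite !mxE eqxx andbT; have [->|im] := eqVneq i ord_max.
    by rewrite (negPf m0) /= !mulr1n !mul1r; field.
  by rewrite mulr0n mul0r mulr0; case: ifP => _; rewrite ?lm ?mulr0 ?mul0r ?mulr0.
have e2 : perm_mx s *m delta_mx ord_max ord0 = delta_mx i0 j0 *m perm_mx s :> 'M[C]_N.
  have -> : perm_mx s *m delta_mx ord_max ord0 = row_perm s (delta_mx ord_max ord0) :> 'M[C]_N.
    by rewrite row_permE.
  have -> : delta_mx i0 j0 *m perm_mx s = col_perm s^-1 (delta_mx i0 j0) :> 'M[C]_N.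
    by rewrite col_permE invgK.
  apply/matrixP => i j; rewrite !mxE -si -sj !(inj_eq perm_inj).
  by rewrite -(inj_eq (@perm_inj _ s) (s^-1%g j) j0) permKV.
by rewrite -[LHS]mulmxA e1 -[LHS]scalemxAr (mulmxA (perm_mx s)) e2 -(mulmxA _ (perm_mx s)) scalemxAl.
Qed.

(** Choose [(i0, j0)] among the nonzero entries nearest to the diagonal. When the
    indices are weighed in their order, except that [i0] gets the weight of [j0], it is
    the only nonzero entry between indices of equal weight. *)
Lemma delta_degeneration (A : 'M[C]_N) : is_trig_mx A -> (forall i, A i i = 0) -> A != 0 ->
  exists i0 j0, [/\ i0 != j0, A i0 j0 != 0 & forall e : R, 0 < e ->
    exists2 Q : 'M[C]_N, Q \in unitmx & forall i j,
      modulus ((Q *m A *m invmx Q) i j - (A i0 j0 *: delta_mx i0 j0) i j) < e].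
Proof.
move=> /is_trig_mxP tA dA A0.
have low i j : A i j != 0 -> (j < i)%N.
  move=> h; rewrite ltnNge leq_eqVlt; apply: contra h => /orP [/eqP/val_inj ->|/tA ->//].
  by rewrite dA.
have [ij0 hij0] : exists ij : 'I_N * 'I_N, A ij.1 ij.2 != 0.
  apply/existsP; apply: contraR A0 => /existsPn h; apply/eqP/matrixP => i j; rewrite mxE.
  by apply/eqP; move: (h (i, j)); rewrite negbK.
pose P := [pred ij : 'I_N * 'I_N | A ij.1 ij.2 != 0].
have [[i0 j0] /= h0 hmin] := @arg_minnP _ ij0 P (fun ij => ij.1 - ij.2)%N hij0.
have ji0 := low _ _ h0.
exists i0, j0; split=> //; first by rewrite -val_eqE gtn_eqF.
pose w (k : 'I_N) : nat := if k == i0 then j0 else k.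
have wE i j : A i j != 0 -> (w j <= w i)%N /\ (w i == w j) = ((i == i0) && (j == j0)).
  move=> h; have ji := low _ _ h; have := hmin (i, j) h; rewrite /= /w.
  have [ei|ii] := eqVneq i i0; have [e|jj] := eqVneq j i0 => /= hm.
  - by move: ji; rewrite ei e ltnn.
  - rewrite ei in hm ji; split; first lia.
    by rewrite -(val_eqE j j0) /=; apply/eqP/eqP; lia.
  - rewrite e in ji; split; first lia.
    by apply/eqP; lia.
  - by split; [lia|apply/eqP; lia].
move=> e e0.
have [Q Qu hQ] := @weight_degeneration R N A w e (fun i j h => (wE i j h).1) e0.
exists Q => // i j; have := hQ i j; congr (modulus (_ - _) < _).
rewrite !mxE; have [Aij|Aij] := eqVneq (A i j) 0.
  rewrite Aij if_same; case: (eqVneq i i0) => [ei|_]; last by rewrite mulr0.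
  case: (eqVneq j j0) => [ej|_]; last by rewrite mulr0.
  by move: h0; rewrite -ei -ej Aij eqxx.
rewrite (wE i j Aij).2; case: (eqVneq i i0) => [->|_] /=; last by rewrite mulr0.
by case: (eqVneq j j0) => [->|_] /=; rewrite ?mulr1 ?mulr0.
Qed.

Lemma shift_reach (c d : C -> C) a : hol c -> hol d -> D a ->
  (forall z, D z -> \sum_(j < N) modulus (d z) * modulus (c z) ^+ (n - j) * modulus (lastcoef j : C) < 1) ->
  reach (c 0 *: J + d 0 *: L) (c a *: J + d a *: L) a.
Proof.
move=> hc hd Da hS; apply/reachP; split=> //.
exists (fun z => c z *: J + d z *: L); split=> //.
  exact: (mxK_add hol_ring (mxK_scale hol_ring hc (mxK_cst hol_ring J))
                           (mxK_scale hol_ring hd (mxK_cst hol_ring L))).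
by move=> z Dz; apply: shift_ball; exact: hS.
Qed.

Definition coefsum : R := \sum_(j < N) modulus (lastcoef j : C) + 1.

Lemma coefsum_ge1 : 1 <= coefsum.
Proof. by rewrite lerDr sumr_ge0 // => j _; exact: modulus_ge0. Qed.

Lemma coefsum_small (c d : C) : (0 < n)%N ->
  (forall j, (j < n)%N -> modulus d * modulus c ^+ (n - j) <= coefsum^-1) ->
  \sum_(j < N) modulus d * modulus c ^+ (n - j) * modulus (lastcoef j : C) < 1.
Proof.
move=> n0 h; have K0 : 0 < coefsum by apply: lt_le_trans coefsum_ge1.
apply: (@le_lt_trans _ _ (\sum_(j < N) coefsum^-1 * modulus (lastcoef j : C))).
  apply: ler_sum => j _; have [jn|jn] := ltnP j n.
    by rewrite ler_wpM2r ?modulus_ge0 // h.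
  have -> : j = ord_max by apply: val_inj => /=; have := ltn_ord j; lia.
  by rewrite lastcoef_max // modulus0 !mulr0.
by rewrite -mulr_sumr mulrC ltr_pdivrMr // mul1r /coefsum ltrDl.
Qed.

Local Notation T1 := (J + L).

Lemma spectrum_rowE (b : C) k :
  b *: diag_mx (spectrum_row k) = b%:M + (- (N%:R * b)) *: delta_mx k k :> 'M[C]_N.
Proof.
apply/matrixP => i j; rewrite !mxE; have [->|ij] := eqVneq i j.
  rewrite !mulr1n; case: (j == k) => /=; rewrite ?mulr1n ?mulr0n; last by ring.
  by rewrite -[N]addn1 natrD; ring.
rewrite !mulr0n mulr0; case: (eqVneq i k) => [ik|_]; rewrite ?mulr0 ?addr0 //.
by case: (eqVneq j k) => [jk|_]; rewrite ?mulr0 ?addr0 //; move: ij; rewrite ik jk eqxx.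
Qed.

(** Conjugates of [b T1] accumulate at a diagonal matrix, which under continuity is
    reached with nearly the same parameter. *)
Lemma reach_spectrum (A : 'M[C]_N) (b : R) (a : C) (c : R) : (0 < n)%N -> is_trig_mx A ->
  (forall i, A i i = 0) -> cont A -> 0 < b -> n%:R * b < 1 ->
  a != 0 -> reach A (ofR b *: T1) a -> modulus a < c ->
  exists k a', reach A ((ofR b)%:M + (- (N%:R * ofR b)) *: delta_mx k k) a' /\ modulus a' < c.
Proof.
move=> n0 tA dA cA b0 nb a0 hr ac; have [k hk] := @shift_degeneration R n n0.
exists k; rewrite -spectrum_rowE.
have n1 : 1 <= n%:R :> R by rewrite ler1n.
have bn : b <= n%:R * b by rewrite ler_peMl // ltW.
have mb : modulus (ofR b) = b by rewrite modulus_ofR ger0_norm // ltW.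
have hd i : modulus ((ofR b *: spectrum_row k) 0 i) <= n%:R * b.
  rewrite !mxE modulusM mb; case: (i == k); last by rewrite modulus1 mulr1.
  by rewrite modulusN -ofR_nat modulus_ofR ger0_norm // mulrC.
have dE : ofR b *: diag_mx (spectrum_row k) = diag_mx (ofR b *: spectrum_row k) :> 'M[C]_N.
  by apply/matrixP => i j; rewrite !mxE; case: (i == j); rewrite ?mulr1n ?mulr0n ?mulr0.
have hball : ball (diag_mx (ofR b *: spectrum_row k)).
  apply: (ball_trig N0 (diag_mx_is_trig _)) => i.
  by rewrite [diag_mx _ _ _]mxE eqxx mulr1n; exact: le_lt_trans (hd i) nb.
have hne : exists a, reach A (diag_mx (ofR b *: spectrum_row k)) a.
  have nb0 : 0 < n%:R * b by apply: lt_le_trans bn.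
  exists (ofR (n%:R * b)).
  have mnb : modulus (ofR (n%:R * b)) = n%:R * b by rewrite modulus_ofR ger0_norm // ltW.
  apply: reach_trig => //; first by rewrite /unit_disc /= mnb.
    by rewrite ofR_eq0 gt_eqF.
  by move=> i; rewrite mnb.
have hl : lempert ball A (diag_mx (ofR b *: spectrum_row k)) <= modulus a.
  apply: (cont_diag_limit N0 a0 cA hr hball) => e e0.
  have [Q Qu hQ] := hk _ (divr_gt0 e0 b0); exists Q; first exact: Qu.
  move=> i j.
  rewrite -scalemxAr -scalemxAl -dE.
  have := hQ i j; move: (Q *m T1 *m invmx Q) (diag_mx _) => X Y h.
  by rewrite !mxE -mulrBr modulusM mb mulrC -ltr_pdivlMr.
have [a' ha' lt] := reach_lt hne (le_lt_trans hl ac).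
by exists a'; rewrite dE.
Qed.

Lemma exp_le_self (x : R) k : 0 <= x -> x <= 1 -> (0 < k)%N -> x ^+ k <= x.
Proof. by move=> x0 x1 k0; rewrite -[leRHS]expr1; apply: ler_wiXn2l. Qed.

Lemma det_trig_shift (A : 'M[C]_N) (b : C) : is_trig_mx A -> (forall i, A i i = 0) ->
  \det (A - b%:M) = (- b) ^+ N.
Proof.
move=> tA dA; have -> : A - b%:M = - (b%:M - A) by rewrite opprB.
rewrite -scaleN1r detZ det_trig_sub // (eq_bigr (fun=> b)); last by move=> i _; rewrite dA subr0.
by rewrite prodr_const card_ord -exprMn mulN1r.
Qed.

(** If [A] has rank [n] then it is conjugate to [b J], and [b T1] is at distance
    of order [b^2]; but [b^(n+1)] is bounded by a multiple of the [n]-th power of the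
    parameter of any disc to the diagonal matrix. *)
Lemma regular_not_cont (A : 'M[C]_N) : (1 < n)%N -> is_trig_mx A -> (forall i, A i i = 0) ->
  \rank A = n -> cont A -> False.
Proof.
move=> n1 tA dA rA cA; have n0 : (0 < n)%N := ltnW n1.
pose K := coefsum; have K1 : 1 <= K := coefsum_ge1.
have K0 : 0 < K := lt_le_trans ltr01 K1.
pose M : R := 24 ^+ N * (2 * K) ^+ n.
have M0 : 0 < M by rewrite mulr_gt0 ?exprn_gt0 // mulr_gt0.
(* [S] exceeds every constant that its inverse has to compensate. *)
pose S : R := n%:R + 8 * K + M + 1.
have S0 : 0 < S by rewrite /S; have := ler0n R n; move: K0 M0; clear; lra.
pose b : R := S^-1; have b0 : 0 < b by rewrite invr_gt0.
have Sb (x : R) : 0 <= x -> x < S -> x * b < 1.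
  by move=> x0 xS; rewrite /b ltr_pdivrMr // mul1r.
have nb : n%:R * b < 1 by apply: Sb => //; rewrite /S; move: K0 M0; clear; lra.
have Kb : 8 * K * b < 1.
  by apply: Sb; rewrite /S; have := ler0n R n; move: K0 M0; clear; lra.
have Mb : M * b < 1 by apply: Sb; rewrite /S; have := ler0n R n; move: K0 M0; clear; lra.
have b1 : b < 1 by apply: le_lt_trans nb; rewrite ler_peMl ?(ltW b0) // ler1n.
pose al : R := K * b ^+ 2.
have al0 : 0 < al by rewrite mulr_gt0 // exprn_gt0.
have al8 : 8 * al < 1.
  have -> : 8 * al = 8 * K * b * b by rewrite /al; ring.
  by apply: le_lt_trans b1; rewrite ler_piMl // ltW.
have [Da ma] : D (ofR al) /\ modulus (ofR al) = al.
  by apply: disc_ofR => //; move: al8 al0; clear; lra.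
have an0 : ofR al != 0 :> C by rewrite ofR_eq0 gt_eqF.
have [_ mb] := disc_ofR b0 b1.
have bn0 : ofR b != 0 :> C by rewrite ofR_eq0 gt_eqF.
have h1 : reach (ofR b *: J) (ofR b *: T1) (ofR al).
  have hd : hol (fun z => z / ofR al * ofR b) := holM (holM (@hol_id R) (hol_cst _)) (hol_cst _).
  have hS z : D z -> \sum_(j < N) modulus (z / ofR al * ofR b) * modulus (ofR b : C) ^+ (n - j) *
      modulus (lastcoef j : C) < 1.
    move=> Dz; apply: coefsum_small => // j jn; rewrite mb modulusM modulus_div ma mb.
    apply: (@le_trans _ _ (1 / al * b * b)).
      have p1 : 0 <= modulus z / al * b.
        exact: mulr_ge0 (divr_ge0 (modulus_ge0 _) (ltW al0)) (ltW b0).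
      apply: (ler_pM p1 (exprn_ge0 _ (ltW b0))).
        by rewrite ler_wpM2r ?(ltW b0) // ler_wpM2r ?invr_ge0 ?(ltW al0) // ltW.
      by apply: exp_le_self; rewrite ?subn_gt0 ?ltW.
    have -> : 1 / al * b * b = K^-1; last by [].
    by rewrite /al; field; rewrite ?gt_eqF.
  have := shift_reach (hol_cst (ofR b)) hd Da hS.
  by rewrite !mul0r scale0r addr0 divff // mul1r -scalerDr.
have An : A ^+ n != 0.
  rewrite -mxrank_eq0 -lt0n; apply: leq_trans (rank_exp n rA).
  by rewrite subSnn.
have [P Pu hP] := regular_shift An (nilpotent_trig tA dA) bn0.
have AE : A = invmx P *m (ofR b *: J) *m invmx (invmx P).
  by rewrite invmxK -mulmxA -hP mulKmx.
have h2 : reach A (ofR b *: T1) (ofR al).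
  by rewrite AE; apply: reach_conj_l => //; rewrite unitmx_inv.
have al2 : modulus (ofR al) < 2 * al by rewrite ma; move: al0; clear; lra.
have [k [a [ha aa]]] := reach_spectrum n0 tA dA cA b0 nb an0 h2 al2.
have := lower_regular ha (det_trig_shift (ofR b) tA dA).
have a4 : modulus a <= 4^-1 by move: aa al8; clear; lra.
rewrite mb => /(_ a4 (ltW b1)); apply/negP; rewrite -ltNge.
apply: (@le_lt_trans _ _ (24 ^+ N * (2 * al) ^+ n)).
  have al20 : 0 < 2 * al by rewrite mulr_gt0.
  rewrite ler_wpM2l ?exprn_ge0 // lerXn2r ?nnegrE ?modulus_ge0 ?(ltW al20) //.
  exact: ltW.
have -> : 24 ^+ N * (2 * al) ^+ n = M * b ^+ n.-1 * b ^+ N.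
  rewrite /M /al [2 * (K * _)]mulrA [(2 * K * _) ^+ n]exprMn -exprM -!mulrA -exprD.
  by have -> : (2 * n = n.-1 + N)%N by move: n0; clear; lia.
rewrite gtr_pMl ?exprn_gt0 //; apply: le_lt_trans Mb.
rewrite ler_wpM2l ?(ltW M0) //; apply: exp_le_self; rewrite ?ltW //.
by move: n1; clear; case: n => [|[]].
Qed.

(** If [A] has rank less than [n] then discs start at [b L], a matrix to which
    conjugates of [A] degenerate, and the endpoint [b = beta^n] is reached at a
    parameter of order [beta^(n+1)], in conflict with the linear lower bound. *)
Lemma corank2_not_cont (A : 'M[C]_N) : (1 < n)%N -> is_trig_mx A -> (forall i, A i i = 0) ->
  A != 0 -> (\rank A <= n.-1)%N -> cont A -> False.
Proof.
move=> n1 tA dA A0 rA cA; have n0 : (0 < n)%N := ltnW n1.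
pose K := coefsum; have K1 : 1 <= K := coefsum_ge1.
have K0 : 0 < K := lt_le_trans ltr01 K1.
pose M : R := 1 + N%:R * (4 * 24 ^+ N).
have M0 : 0 < M by rewrite ltr_pwDl // !mulr_ge0 // exprn_ge0.
(* [S] exceeds every constant that its inverse has to compensate. *)
pose S : R := n%:R + 12 * K + 3 * M * K + 1.
have MK : 0 < M * K by rewrite mulr_gt0.
have S0 : 0 < S by rewrite /S; have := ler0n R n; move: K0 MK; clear; nra.
pose be : R := S^-1; have be0 : 0 < be by rewrite invr_gt0.
have Sb (x : R) : x < S -> x * be < 1.
  by move=> xS; rewrite /be ltr_pdivrMr // mul1r.
have nbe : n%:R * be < 1 by apply: Sb; rewrite /S; move: K0 MK; clear; nra.
have Kb : 12 * K * be < 1 by apply: Sb; rewrite /S; have := ler0n R n; move: K0 MK; clear; nra.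
have Mb : 3 * M * K * be < 1 by apply: Sb; rewrite /S; have := ler0n R n; move: K0 MK; clear; nra.
have be1 : be < 1 by apply: le_lt_trans nbe; rewrite ler_peMl ?(ltW be0) // ler1n.
pose b := be ^+ n; have b0 : 0 < b by rewrite exprn_gt0.
have bbe : b <= be by apply: exp_le_self; rewrite ?ltW.
have b1 : b < 1 := le_lt_trans bbe be1.
have nb : n%:R * b < 1 by apply: le_lt_trans nbe; rewrite ler_wpM2l.
pose al : R := K * be * b.
have al0 : 0 < al by rewrite !mulr_gt0.
have al12 : 12 * al < 1.
  have -> : 12 * al = 12 * K * be * b by rewrite /al; ring.
  by apply: le_lt_trans b1; rewrite ler_piMl // ltW.
have [Da ma] : D (ofR al) /\ modulus (ofR al) = al.
  by apply: disc_ofR => //; move: al12 al0; clear; lra.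
have [Da2 ma2] : D (ofR (2 * al)) /\ modulus (ofR (2 * al)) = 2 * al.
  by apply: disc_ofR; move: al12 al0; clear; lra.
have an0 : ofR al != 0 :> C by rewrite ofR_eq0 gt_eqF.
have [_ mb] := disc_ofR b0 b1.
have bn0 : ofR b != 0 :> C by rewrite ofR_eq0 gt_eqF.
have h1 : reach (ofR b *: L) (ofR b *: T1) (ofR al).
  have hc : hol (fun z => z / ofR al * ofR b) := holM (holM (@hol_id R) (hol_cst _)) (hol_cst _).
  have hS z : D z -> \sum_(j < N) modulus (ofR b : C) * modulus (z / ofR al * ofR b) ^+ (n - j) *
      modulus (lastcoef j : C) < 1.
    move=> Dz; apply: coefsum_small => // j jn; rewrite mb modulusM modulus_div ma mb.
    apply: (@le_trans _ _ (b * (K * be)^-1 ^+ (n - j))).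
      rewrite ler_wpM2l ?(ltW b0) // lerXn2r ?nnegrE //.
      - by rewrite mulr_ge0 ?divr_ge0 ?modulus_ge0 ?ltW.
      - by rewrite invr_ge0 mulr_ge0 ?ltW.
      have -> : (K * be)^-1 = 1 / al * b by rewrite /al; field; rewrite ?gt_eqF.
      by rewrite ler_wpM2r ?(ltW b0) // ler_wpM2r ?invr_ge0 ?(ltW al0) // ltW.
    rewrite invfM exprMn mulrCA /b.
    have -> : be ^+ n * be^-1 ^+ (n - j) = be ^+ j.
      by rewrite exprVn -[X in be ^+ X](subnKC (ltnW jn)) exprD mulfK // expf_neq0 // gt_eqF.
    apply: (@le_trans _ _ (K^-1 * 1)); last by rewrite mulr1.
    apply: ler_pM; rewrite ?exprn_ge0 ?(ltW be0) ?invr_ge0 ?(ltW K0) //.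
      by apply: exp_le_self; rewrite ?subn_gt0 ?invr_ge0 ?(ltW K0) ?invf_le1.
    by rewrite exprn_ile1 // ltW.
  have := shift_reach hc (hol_cst (ofR b)) Da hS.
  by rewrite !mul0r scale0r add0r divff // mul1r -scalerDr.
have [i0 [j0 [ij hA0 hdeg]]] := delta_degeneration tA dA A0.
have [P Pu hP] := @rank_one_conj (@lastcoef R n) (ofR b) (A i0 j0) i0 j0 n0
  (lastcoef_max n0) (lastcoef0 n0) ij bn0 hA0.
have h2 : reach (A i0 j0 *: delta_mx i0 j0) (ofR b *: T1) (ofR al).
  have -> : A i0 j0 *: delta_mx i0 j0 = P *m (ofR b *: L) *m invmx P by rewrite hP mulmxK.
  exact: reach_conj_l.
have lt12 : modulus (ofR al) < modulus (ofR (2 * al)) by rewrite ma ma2; move: al0; clear; lra.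
have [e e0 he] := (nbhsMP _ _).1 (reach_perturb N0 h2 Da2 lt12).
have [Q Qu hQ] := hdeg e e0.
have an20 : ofR (2 * al) != 0 :> C by rewrite ofR_eq0 mulf_neq0 ?gt_eqF.
have h3 : reach A (ofR b *: T1) (ofR (2 * al)).
  have AE : A = invmx Q *m (Q *m A *m invmx Q) *m invmx (invmx Q).
    by rewrite invmxK -(mulmxA (invmx Q)) mulmxKV // mulKmx.
  rewrite AE; apply: reach_conj_l => //; first by rewrite unitmx_inv.
  exact: he.
have al3 : modulus (ofR (2 * al)) < 3 * al by rewrite ma2; move: al0; clear; lra.
have [k [a [ha aa]]] := reach_spectrum n0 tA dA cA b0 nb an20 h3 al3.
have a0 : a != 0.
  apply/eqP => a0; have [_ [f [_ f0 fa]]] := ha.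
  have {f0 fa} AE : A = (ofR b)%:M + - (N%:R * ofR b) *: delta_mx k k by rewrite -f0 -fa a0.
  have [i ik] : exists i : 'I_N, i != k.
    have [->|k0] := eqVneq k ord0; last by exists ord0; rewrite eq_sym.
    by exists ord_max; rewrite -val_eqE /= -lt0n.
  have := dA i; rewrite AE !mxE eqxx (negPf ik) mulr0 addr0 mulr1n => /eqP.
  by rewrite (negPf bn0).
have a4 : modulus a <= 4^-1 by move: aa al12; clear; lra.
have := lower_corank2 ha rA n0 a0 a4; rewrite mb => /(_ (ltW b1)).
apply/negP; rewrite -ltNge -/M.
apply: (@lt_trans _ _ (M * (3 * al))); first by rewrite ltr_pM2l.
have -> : M * (3 * al) = 3 * M * K * be * b by rewrite /al; ring.
by rewrite gtr_pMl.
Qed.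

End NilpotentDiscontinuity.

(** * Matrices with several eigenvalues *)

Section SeveralEigenvalues.
Context {R : realType} {n : nat}.
Local Notation C := (Cplx R).
Local Notation D := (@unit_disc R).
Local Notation ball := (spectral_ball R n).

Lemma pairing (T : finType) (X Y : pred T) : (forall i, X i -> ~~ Y i) -> (#|Y| <= #|X|)%N ->
  exists pi : T -> T, [/\ involutive pi, forall i, Y i -> X (pi i) &
    forall i, pi i != i -> Y i \/ X i /\ Y (pi i)].
Proof.
move: {2}#|Y| (erefl #|Y|) => m; elim: m X Y => [|m ih] X Y hY dXY leXY.
  exists id; split=> // i; last by rewrite eqxx.
  by have := card0_eq hY i; rewrite !inE unfold_in /= => ->.
have [y yY] : exists y, Y y.
  have /card_gt0P [y yY] : (0 < #|Y|)%N by rewrite hY.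
  by exists y.
have [x xX] : exists x, X x.
  have /card_gt0P [x xX] : (0 < #|X|)%N by apply: leq_trans leXY; rewrite hY.
  by exists x.
have xnY : Y x = false by apply/negbTE; exact: dXY.
have ynX : X y = false by apply/negbTE; apply/negP => /dXY; rewrite yY.
have yx : y != x by apply/eqP => e; move: xnY; rewrite -e yY.
pose X' := [pred i | (i != x) && X i]; pose Y' := [pred i | (i != y) && Y i].
have hX' : #|X| = #|X'|.+1.
  by rewrite (cardD1 x) unfold_in xX add1n; congr S; apply: eq_card => i; rewrite !inE.
have hY' : #|Y| = #|Y'|.+1.
  by rewrite (cardD1 y) unfold_in yY add1n; congr S; apply: eq_card => i; rewrite !inE.
have [|i /andP [_ /dXY h]||pi [piK piX pim]] := ih X' Y'.
- by move: hY; rewrite hY' => -[].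
- by rewrite /= (negPf h) andbF.
- by move: leXY; rewrite hX' hY'.
have fx : pi x = x.
  by apply/eqP; apply: contraT => /pim []; rewrite /= ?eqxx ?xnY ?andbF // => -[].
have fy : pi y = y.
  by apply/eqP; apply: contraT => /pim []; rewrite /= ?eqxx ?ynX ?andbF // => -[].
exists (fun i => if i == x then y else if i == y then x else pi i); split.
- move=> i; have [->|ix] := eqVneq i x; first by rewrite (negPf yx) eqxx.
  have [->|iy] := eqVneq i y; first by rewrite eqxx.
  rewrite ifN; last by apply: contra ix => /eqP e; rewrite -(piK i) e fx.
  by rewrite ifN ?piK //; apply: contra iy => /eqP e; rewrite -(piK i) e fy.
- move=> i iY; have [ix|ix] := eqVneq i x; first by rewrite ix xnY in iY.
  have [//|iy] := eqVneq i y.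
  by have := piX i; rewrite /= iY iy => /(_ isT) /andP [].
- move=> i; have [->|ix] := eqVneq i x; first by right.
  have [->|iy] := eqVneq i y; first by left.
  by move=> /pim /= [/andP [_ ->]|[/andP [_ ->] /andP [_ ->]]]; [left|right].
Qed.

Lemma finite_bound (I : finType) (P : pred I) (f : I -> R) (c0 c : R) : c0 < c ->
  (forall i, P i -> f i < c) -> exists r, [/\ r < c, c0 <= r & forall i, P i -> f i <= r].
Proof.
move=> c0c hf; exists (\big[Order.max/c0]_(i | P i) f i); split.
- exact: bigmax_lt.
- exact: bigmax_ge_id.
- by move=> i Pi; exact: le_bigmax_cond.
Qed.

(** An eigenvalue [y] of largest modulus whose copies can be paired with copies of a
    smaller one: blocks with eigenvalues [x, y] are reached from nilpotent ones in
    less than [|y|], which is the distance to zero. *)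
Lemma unbalanced_not_cont (A : 'M[C]_n) (e : 'I_n -> C) (x y : C) : (0 < n)%N -> ball A ->
  (forall z, \det (z%:M - A) = \prod_i (z - e i)) ->
  modulus x < modulus y -> (exists i, e i = y) ->
  (forall i, e i = y \/ modulus (e i) < modulus y) ->
  (#|[pred i | e i == y]| <= #|[pred i | e i == x]|)%N -> cont A -> False.
Proof.
move=> n0 hA he xy [iy ey] hlt hcard cA.
have [d [hd hQ]] := diag_degeneration A.
have [z|s hs] := @roots_perm R n (fun i => d 0 i) e; first by rewrite -hd he.
have Dy : D y by apply: (ballP A n0).1 hA _ _; rewrite he (bigD1 iy) //= ey subrr mul0r.
have Dx : D x := lt_trans xy Dy.
have cardE v : #|[pred i | d 0 i == v]| = #|[pred i | e i == v]|.
  rewrite -(fintype.card_image (@perm_inj _ s)); apply: eq_card => i.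
  apply/fintype.imageP/idP => [[j]|hi]; first by rewrite !inE hs => hj ->.
  by exists ((s^-1)%g i); rewrite ?permKV // !inE hs permKV.
pose X := [pred i | d 0 i == x]; pose Y := [pred i | d 0 i == y].
have xny : x != y by apply: contraTneq xy => ->; rewrite ltxx.
have dXY i : X i -> ~~ Y i by move=> /eqP /= ->.
have leXY : (#|Y| <= #|X|)%N by rewrite !cardE.
have [pi [piK piX pim]] := pairing dXY leXY.
have piY i : pi i != i -> Y (pi i) = ~~ Y i.
  move=> /pim [h|[h1 h2]]; first by rewrite h; apply/negbTE; apply: dXY; exact: piX.
  by rewrite h2 (dXY _ h1).
have [w [t [k [hg Dt]]]] := geodesic_exists Dx Dy.
have ty : modulus t < modulus y := geodesic_bound hg Dt xy (lexx _) Dy.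
have hsm i : d 0 i != y -> modulus (d 0 i) < modulus y.
  by rewrite hs => h; case: (hlt (s i)) => // h'; rewrite h' eqxx in h.
have [r [ry tr hr]] := finite_bound ty hsm.
have y0 : 0 < modulus y := le_lt_trans (modulus_ge0 x) xy.
have r0 : 0 <= r := le_trans (modulus_ge0 t) tr.
pose al := (r + modulus y) / 2; pose al' := (al + modulus y) / 2.
have [al0 ral aly] : [/\ 0 < al, r <= al & al < modulus y].
  by rewrite /al; move: r0 y0 ry; clear; split; lra.
have [al'0 alal' al'y] : [/\ 0 < al', al < al' & al' < modulus y].
  by rewrite /al'; move: al0 aly; clear; split; lra.
have mk (c : R) : 0 < c -> c < modulus y -> [/\ D (ofR c), modulus (ofR c) = c & ofR c != 0 :> C].
  move=> c0 cy; have [Dc mc] := disc_ofR c0 (lt_trans cy Dy).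
  by split=> //; rewrite ofR_eq0 gt_eqF.
have [Da ma a0] := mk al al0 aly; have [Da' ma' a'0] := mk al' al'0 al'y.
pose Z := pair_mx pi Y 0 0 (fun=> 0 : C).
have h1 : reach Z (pair_mx pi Y (x + y) (x * y) (fun i => d 0 i)) (ofR al).
  apply: (pair_reach piK piY n0 hg Dt Da a0); rewrite ma; first exact: le_trans tr ral.
  move=> i pii; apply: le_trans ral; apply: hr; apply/negP => iY.
  have := dXY _ (piX i iY); rewrite pii; apply/negP; rewrite negbK; exact: iY.
have [i pii|P Pu hP] := @pair_mx_diag R n pi piK Y piY x y (fun i => d 0 i) xny.
  have [iY|[iX piYi]] := pim i pii; first by rewrite iY; apply/eqP.
  by rewrite (negPf (dXY _ iX)); apply/eqP.
have dE : \row_i d 0 i = d by apply/rowP => i; rewrite mxE.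
have h2 : reach (diag_mx d) Z (ofR al).
  apply: reach_sym; rewrite -[diag_mx d](mulmxK Pu) -{1}dE -hP.
  exact: reach_conj_r.
have lt' : modulus (ofR al) < modulus (ofR al') by rewrite ma ma'.
have [eps eps0 heps] := (nbhsMP _ _).1 (reach_perturb n0 h2 Da' lt').
have [Q Qu hQ'] := hQ eps eps0.
have h3 : reach A Z (ofR al').
  have AE : A = invmx Q *m (Q *m A *m invmx Q) *m invmx (invmx Q).
    by rewrite invmxK -(mulmxA (invmx Q)) mulmxKV // mulKmx.
  rewrite AE; apply: reach_conj_l => //; first by rewrite unitmx_inv.
  exact: heps.
have [d0 [hd0 hQ0]] := diag_degeneration Z.
have d00 : diag_mx d0 = 0.
  suff -> : d0 = 0 by rewrite raddf0.
  apply/rowP => i; rewrite mxE.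
  have : \det ((d0 0 i)%:M - Z) = 0 by rewrite hd0 (bigD1 i) //= subrr mul0r.
  move=> /eigP [v v0 /(pair_mx_eig piK piY v0)] [[j _ ->]//|].
  by rewrite mul0r subr0 addr0 => /eqP; rewrite expf_eq0 => /eqP.
have b0 : ball 0.
  apply/ball_row => // z v v0; rewrite mulmx0 => /esym /eqP.
  by rewrite scalemx_eq0 (negPf v0) orbF => /eqP ->; rewrite modulus0.
have hl' : lempert ball A 0 <= al'.
  have bd0 : ball (diag_mx d0) by rewrite d00.
  by have := cont_diag_limit n0 a'0 cA h3 bd0 hQ0; rewrite d00 ma'.
have lE : lempert ball A 0 = lempert ball 0 A.
  by apply: lempert_eq => a; split; exact: reach_sym.
have [_ hrad] := spectral_radiusP A n0.
have : modulus y <= spectral_radius A.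
  by apply: hrad; rewrite he (bigD1 iy) //= ey subrr mul0r.
rewrite -(lempert0 n0 hA) -lE => h; have := le_trans h hl'.
by rewrite leNgt al'y.
Qed.

Lemma det_affine (X : 'M[C]_n) (d : 'I_n -> C) (a b : C) :
  (forall z, \det (z%:M - X) = \prod_i (z - d i)) ->
  \det (a%:M + b *: X) = \prod_i (a + b * d i).
Proof.
move=> hd; have [->|b0] := eqVneq b 0.
  rewrite scale0r addr0 det_scalar (eq_bigr (fun=> a)) ?prodr_const ?card_ord // => i _.
  by rewrite mul0r addr0.
have -> : a%:M + b *: X = (- b) *: ((- a / b)%:M - X).
  by apply/matrixP => i j; rewrite !mxE; case: (i == j); rewrite ?mulr1n ?mulr0n; field.
rewrite detZ hd -[X in _ ^+ X](card_ord n) -prodr_const -big_split /=.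
by apply: eq_bigr => i _; field.
Qed.

Lemma mobmx_factor (X : 'M[C]_n) (d : 'I_n -> C) (c : C) : (0 < n)%N -> D c -> ball X ->
  (forall z, \det (z%:M - X) = \prod_i (z - d i)) ->
  forall z, \det (z%:M - mobmx c X) = \prod_i (z - mob c (d i)).
Proof.
move=> n0 Dc hX hd z; have Eu := mobmx_unit n0 Dc hX.
have detE : \det (1%:M - conjC c *: X) = \prod_i (1 - conjC c * d i).
  by rewrite -scaleNr (det_affine _ _ hd); apply: eq_bigr => i _; rewrite mulNr.
have E0 : \det (1%:M - conjC c *: X) != 0 by rewrite -unitfE -unitmxE.
have q0 i : 1 - conjC c * d i != 0.
  by move: E0; rewrite detE => /prodf_neq0; apply.
apply: (mulIf E0); rewrite -det_mulmx mulmxBl mulmxKV // detE -big_split /=.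
have -> : z%:M *m (1%:M - conjC c *: X) - (c%:M - X) = (z - c)%:M + (1 - z * conjC c) *: X.
  rewrite mul_scalar_mx; apply/matrixP => i j; rewrite !mxE.
  by case: (i == j); rewrite ?mulr1n ?mulr0n; ring.
rewrite (det_affine _ _ hd); apply: eq_bigr => i _.
by rewrite /mob [RHS]mulrBl divfK //; ring.
Qed.

Lemma mob_inj (a : C) z w : D a -> D z -> D w -> mob a z = mob a w -> z = w.
Proof.
move=> Da Dz Dw; have qz := mob_denom_neq0 Da Dz; have qw := mob_denom_neq0 Da Dw.
rewrite /mob => /eqP; rewrite eqr_div // => /eqP h.
have k : 1 - a * conjC a != 0 by rewrite mul_conj -ofR1 -ofRB ofR_eq0 gt_eqF // D_sqr.
apply: (mulfI k).
have -> : (1 - a * conjC a) * z = (1 - a * conjC a) * w +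
   ((a - w) * (1 - conjC a * z) - (a - z) * (1 - conjC a * w)) by ring.
by rewrite h subrr addr0.
Qed.

(** With [z] the other eigenvalues, none larger than [c], the base point [- c] makes
    [c] the only farthest eigenvalue. *)
Lemma mob_farthest (c z : C) : D c -> modulus z <= modulus c -> z != c ->
  modulus (mob (- c) z) < modulus (mob (- c) c).
Proof.
move=> Dc zc znc; have Dz : D z := le_lt_trans zc Dc.
have Dnc : D (- c) by rewrite /unit_disc /= modulusN.
rewrite /mob !modulus_div conjCN !mulNr !opprK.
have q1 : 0 < modulus (1 + conjC c * z).
  by have := mob_denom_neq0 Dnc Dz; rewrite conjCN mulNr opprK -modulus_gt0.
have q2 : 0 < modulus (1 + conjC c * c).
  by have := mob_denom_neq0 Dnc Dc; rewrite conjCN mulNr opprK -modulus_gt0.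
rewrite ltr_pdivrMr // mulrAC ltr_pdivlMr //.
rewrite -ltr_sqr ?nnegrE ?mulr_ge0 ?modulus_ge0 // !exprMn -subr_gt0.
have u1 : modulus c ^+ 2 < 1 by rewrite expr_lt1 ?modulus_ge0.
have su : modulus z ^+ 2 <= modulus c ^+ 2 by rewrite ler_sqr ?nnegrE ?modulus_ge0.
have p0 : 0 < modulus (z - c) ^+ 2 by rewrite exprn_gt0 // modulus_gt0 subr_eq0.
set u := modulus c ^+ 2 in u1 su *; set s := modulus z ^+ 2 in su *.
have -> : modulus (- c - c) ^+ 2 * modulus (1 + conjC c * z) ^+ 2 -
    modulus (- c - z) ^+ 2 * modulus (1 + conjC c * c) ^+ 2 =
  (modulus (z - c) ^+ 2 + (u - s)) * (1 - u) ^+ 2 + (u - s) * (1 - u) * (1 + 3 * u).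
  rewrite /u /s !modulus_sqr -ofR1; clear; case: c => a b; case: z => p q.
  by rewrite !(ReD, ImD, ReN, ImN, ReM, ImM, Re_conj, Im_conj) /=; ring.
have u0 : 0 <= u by rewrite exprn_ge0 // modulus_ge0.
rewrite ltr_pwDl //; last first.
  by rewrite !mulr_ge0 ?subr_ge0 ?(ltW u1) // addr_ge0 // mulr_ge0.
by rewrite mulr_gt0 ?exprn_gt0 ?subr_gt0 // ltr_pwDl // subr_ge0.
Qed.

Lemma several_eigenvalues_not_cont (A : 'M[C]_n) (z1 z2 : C) : (0 < n)%N -> ball A ->
  \det (z1%:M - A) = 0 -> \det (z2%:M - A) = 0 -> z1 != z2 -> cont A -> False.
Proof.
move=> n0 hA hz1 hz2 z12 cA; have [d hd] := eig_factor A.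
have hD i : D (d i).
  by apply: (ballP A n0).1 hA _ _; rewrite hd (bigD1 i) //= subrr mul0r.
(* [x] has the largest multiplicity, and [d iy] is farthest from [x]. *)
pose m v := #|[pred i | d i == v]|.
have i00 : 'I_n := Ordinal n0.
have [ix hx] : exists ix, forall i, (m (d i) <= m (d ix))%N.
  by exists [arg max_(i > Ordinal n0) m (d i)]%N => i; case: arg_maxnP => // j _; apply.
set x := d ix in hx; have Dx : D x := hD ix.
have [iy hy] : exists iy, forall i, modulus (mob x (d i)) <= modulus (mob x (d iy)).
  exists [arg max_(i > Ordinal n0) modulus (mob x (d i))]%O => i.
  by case: Order.TotalTheory.arg_maxP => //= j _; apply.
set c := mob x (d iy) in hy; have Dc : D c := mob_disc Dx (hD iy).
have Dnc : D (- c) by rewrite /unit_disc /= modulusN.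
have c0 : c != 0.
  have [i hi] : exists i, d i != x.
    have [i1 h1] := (eig_factorP z1 hd).1 hz1; have [i2 h2] := (eig_factorP z2 hd).1 hz2.
    have [e|] := eqVneq (d i1) x; last by exists i1.
    by exists i2; rewrite -e -h1 -h2 eq_sym.
  rewrite -modulus_gt0; apply: lt_le_trans (hy i); rewrite modulus_gt0.
  by apply: contra hi => /eqP h; apply/eqP; apply: (mob_inj Dx) => //; rewrite h mobaa.
have hA1 := mobmx_ball n0 Dx hA; have hA2 := mobmx_ball n0 Dnc hA1.
have f1 := mobmx_factor n0 Dx hA hd; have f2 := mobmx_factor n0 Dnc hA1 f1.
have c1 : cont (mobmx x A) by apply: (cont_mobmx n0 Dx hA1); rewrite mobmxK.
have c2 : cont (mobmx (- c) (mobmx x A)) by apply: (cont_mobmx n0 Dnc hA2); rewrite mobmxK.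
have far i : mob x (d i) != c -> modulus (mob (- c) (mob x (d i))) < modulus (mob (- c) c).
  by move=> h; exact: mob_farthest.
apply: (@unbalanced_not_cont _ _ (- c) (mob (- c) c) n0 hA2 f2 _ _ _ _ c2).
- have := @mob_farthest c 0 Dc; rewrite mob0 modulus0 modulus_ge0 eq_sym c0; exact.
- by exists iy.
- by move=> i; have [->|] := eqVneq (mob x (d i)) c; [left|move/far; right].
apply: (@leq_trans (m x)).
  apply: leq_trans (hx iy); apply: fintype.subset_leq_card; apply/fintype.subsetP => i; rewrite !inE => /eqP h.
  apply/eqP; apply: (mob_inj Dx) => //; apply/eqP; apply: contraT => /far.
  by rewrite h ltxx.
apply: fintype.subset_leq_card; apply/fintype.subsetP => i; rewrite !inE => /eqP ->.
by rewrite mobaa mob0.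
Qed.

End SeveralEigenvalues.

(** * The classification *)

Section Classification.
Context {R : realType}.
Local Notation C := (Cplx R).
Local Notation D := (@unit_disc R).

Lemma cont_similar_inv n (A P : 'M[C]_n) : (0 < n)%N -> P \in unitmx -> cont A ->
  cont (P *m A *m invmx P).
Proof.
move=> n0 Pu cA; apply: (@cont_similar R n _ (invmx P)) => //; first by rewrite unitmx_inv.
by rewrite invmxK !mulmxA mulVmx // mul1mx mulmxKV.
Qed.

(** Up to conjugation the matrix is strictly triangular, of rank at most [n]. *)
Lemma nilpotent_not_cont n (A : 'M[C]_n.+1) : (1 < n)%N ->
  (forall z, \det (z%:M - A) = 0 -> z = 0) -> A != 0 -> cont A -> False.
Proof.
move=> n1 hA A0 cA; have [P [U [Pu tU PA]]] := trigonalize A.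
have UE : P *m A *m invmx P = U by rewrite PA mulmxK.
have dU i : U i i = 0.
  by apply: hA; rewrite (det_similar _ Pu PA); apply/eig_trig => //; exists i.
have U0 : U != 0.
  apply: contra A0 => /eqP U0; move: PA; rewrite U0 mul0mx => /(congr1 (mulmx (invmx P))).
  by rewrite mulKmx // mulmx0 => ->.
have cU : cont U by rewrite -UE; exact: cont_similar_inv.
have rU : (\rank U <= n)%N.
  rewrite -ltnS ltn_neqAle rank_leq_row andbT; apply/negP => rf.
  have : U \in unitmx by rewrite -row_free_unit.
  rewrite unitmxE unitfE det_trig // (bigD1 ord0) //= dU mul0r eqxx //.
have [r1|r1] := eqVneq (\rank U) n; first exact: regular_not_cont n1 tU dU r1 cU.
by apply: (corank2_not_cont n1 tU dU U0 _ cU); move: rU r1; lia.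
Qed.

Lemma mobmx0 n (a : C) : mobmx a 0 = a%:M :> 'M[C]_n.
Proof. by rewrite /mobmx subr0 scaler0 subr0 invmx1 mulmx1. Qed.

Lemma mobmx_single n (A : 'M[C]_n) (a : C) : (0 < n)%N -> spectral_ball R n A -> D a ->
  (forall z, \det (z%:M - A) = 0 -> z = a) ->
  forall z, \det (z%:M - mobmx a A) = 0 -> z = 0.
Proof.
move=> n0 hA Da ha z /eigP [v v0 hv]; have [m hm ->] := mobmx_eig_inv n0 Da hA v0 hv.
by rewrite (ha m) ?mobaa //; apply/eigP; exists v.
Qed.

Lemma cont_mobmx_inv n (A : 'M[C]_n) (a : C) : (0 < n)%N -> D a -> spectral_ball R n A ->
  cont A -> cont (mobmx a A).
Proof.
by move=> n0 Da hA cA; apply: (cont_mobmx n0 Da (mobmx_ball n0 Da hA)); rewrite mobmxK.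
Qed.

Lemma jordan2_nilpotent (A : 'M[C]_2) : (forall c, A <> c%:M) ->
  (forall z, \det (z%:M - A) = 0 -> z = 0) -> jordan2 A.
Proof.
move=> ns hA; have [P [U [Pu tU PA]]] := trigonalize A.
have dU i : U i i = 0.
  by apply: hA; rewrite (det_similar _ Pu PA); apply/eig_trig => //; exists i.
split=> //.
  by rewrite (tr_similar Pu PA) /mxtrace big1.
have : \det P * \det A = 0.
  by rewrite -det_mulmx PA det_mulmx det_trig // (bigD1 ord0) //= dU !mul0r.
by move=> /eqP; rewrite mulf_eq0 -[_ == 0]negbK -unitfE -unitmxE Pu => /eqP.
Qed.

Lemma cont_double_eigenvalue (A : 'M[C]_2) (a : C) : spectral_ball R 2 A ->
  (forall c, A <> c%:M) -> (forall z, \det (z%:M - A) = 0 <-> z = a) -> cont A.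
Proof.
move=> hA ns ha; have n0 : (0 < 2)%N by [].
have Da : D a := (ballP A n0).1 hA a ((ha a).2 erefl).
apply: (cont_mobmx n0 Da hA); apply: cont_jordan2; apply: jordan2_nilpotent.
  move=> c hc; apply: (ns a).
  have c0 : c = 0.
    apply: (mobmx_single n0 hA Da (fun z => (ha z).1)).
    by rewrite hc subrr det0.
  by rewrite -(mobmxK n0 Da hA) hc c0 raddf0 mobmx0.
exact: mobmx_single n0 hA Da (fun z => (ha z).1).
Qed.

Lemma cyclic2 (A : 'M[C]_2) : (forall c, A <> c%:M) -> cyclic_mx A.
Proof.
move=> ns; have nsT c : A^T <> c%:M.
  by move=> h; apply: (ns c); rewrite -[A]trmxK h tr_scalar_mx.
have [P Pu hP] := nonscalar_companion2 nsT.
pose v : 'cV[C]_2 := (row 0 P)^T.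
have Av : A *m v = (row 1 P)^T.
  rewrite /v -[A]trmxK -trmx_mul; congr trmx.
  rewrite -row_mul hP companion2E row_mul; apply/rowP => j.
  by rewrite !mxE !big_ord_recl big_ord0 !mxE /= mul0r mul1r add0r addr0; congr (P _ _); exact: val_inj.
exists v; apply/eqP; rewrite eqEsubv subvf /=; apply/subvP => u _.
have -> : u = (u^T *m invmx P) 0 0 *: v + (u^T *m invmx P) 0 1 *: (A *m v).
  apply: (can_inj (@trmxK _ _ _)); rewrite linearD !linearZ /= Av !trmxK.
  rewrite -[LHS](mulmxKV Pu) mulmx_sum_row !big_ord_recl big_ord0 addr0.
  by have -> : lift ord0 ord0 = 1 :> 'I_2 by exact: val_inj.
apply: memvD; apply: memvZ; apply: memv_span; rewrite /= !inE.
  by rewrite expr0 mul1mx eqxx.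
by rewrite expr1 eqxx orbT.
Qed.

Lemma single_char_poly n (A : 'M[C]_n) (a : C) : (forall z, \det (z%:M - A) = 0 -> z = a) ->
  char_poly A = ('X - a%:P) ^+ n.
Proof.
move=> ha; have [P [U [Pu tU PA]]] := trigonalize A.
rewrite (char_poly_similar Pu PA) char_poly_trig // (eq_bigr (fun=> 'X - a%:P)).
  by rewrite prodr_const card_ord.
by move=> i _; rewrite (ha (U i i)) // (det_similar _ Pu PA); apply/eig_trig => //; exists i.
Qed.

End Classification.

Theorem theorem1 (R : realType) (n : nat) (hn : (1 <= n)%N)
    (A : 'M[Cplx R]_n) (hA : spectral_ball R n A) :
  {within spectral_ball R n,
    continuous (fun B : 'M[Cplx R]_n => lempert (spectral_ball R n) A B)} <->
  (exists a : Cplx R, A = a%:M) \/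
  [/\ n = 2%N, cyclic_mx A &
      exists a : Cplx R, char_poly A = ('X - a%:P) ^+ 2].
Proof.
split=> [cA|[[a Aa]|[n2 _ [a pA]]]]; last first.
- move: A hA pA; rewrite n2 => {hn} A hA pA.
  have hz z : \det (z%:M - A) = 0 <-> z = a.
    rewrite -horner_char_poly pA !hornerE; split=> [/eqP|->]; last by rewrite subrr expr0n.
    by rewrite expf_eq0 subr_eq0 => /eqP.
  have [[c Ac]|/forallNP ns] := pselect (exists c, A = c%:M).
    by rewrite Ac in hA *; exact: (cont_scalar (isT : (0 < 2)%N) hA).
  exact: cont_double_eigenvalue hA ns hz.
- by rewrite Aa in hA *; exact: (cont_scalar hn hA).
have [sc|/forallNP ns] := pselect (exists c, A = c%:M); [by left|right].
have [[a ha _] _] := spectral_radiusP A hn.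
have single z : \det (z%:M - A) = 0 -> z = a.
  move=> hz; apply: contrapT => /eqP za.
  exact: several_eigenvalues_not_cont hn hA hz ha za cA.
have Da : unit_disc a := (ballP A hn).1 hA a ha.
case: n hn A hA cA ns ha single => [//|[|[|n]]] hn A hA cA ns ha single.
- by case: (ns (A 0 0)); exact: mx11_scalar.
- by split=> //; [exact: cyclic2|exists a; exact: single_char_poly].
exfalso; apply: (@nilpotent_not_cont R n.+2 (mobmx a A)) => //.
- exact: mobmx_single.
- by apply/eqP => h; apply: (ns a); rewrite -(mobmxK hn Da hA) h mobmx0.
- exact: cont_mobmx_inv.
Qed.
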